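(* (i) Let $\mathbb F$ be a field of characteristic $0$. If $\mathbf x\in\mathbb F^6$ and the parametrized one-relation operad $\mathcal O_{\mathbf x}$ is regular, then its defining relation is one of the following: (a) $(a_1a_2)a_3 = s\, a_3(a_1a_2)$ with $s\in\mathbb F$, $s\neq\pm1$; (b) $(a_1a_2)a_3=a_1(a_2a_3) + s\big[a_1(a_3a_2) - a_2(a_1a_3) + a_2(a_3a_1) -a_3(a_1a_2)\big]$ with $s\in\mathbb F$, $s\ne -1$; (c) $(a_1a_2)a_3= u\big[a_1(a_2a_3) + a_1(a_3a_2) + a_3(a_2a_1)\big] -v \big[ a_2(a_1a_3) + a_2(a_3a_1) + a_3(a_1a_2)\big] - a_3(a_2a_1)$; (d) $(a_1a_2)a_3=u\big[a_1(a_2a_3) - a_2(a_1a_3) - a_3(a_2a_1)\big] +v \big[ a_1(a_3a_2)- a_2(a_3a_1) - a_3(a_1a_2)\big] + a_3(a_2a_1)$; where in (c) and (d) the point $(u,v)\in\mathbb F^2$ satisfies $v^2-v-(u-1)^2=0$ and $(u,v)\notin\{(1,1),(\tfrac13,-\tfrac13)\}$. (ii) If $\mathbb F$ is algebraically closed of characteristic $0$, then every regular parametrized one-relation operad is isomorphic (as a symmetric operad) to one of the following five operads: the left-nilpotent operad ($\mathbf x=(0,0,0,0,0,0)$, i.e. $(a_1a_2)a_3=0$), the associative operad ($\mathbf x=(1,0,0,0,0,0)$), the left Leibniz operad ($\mathbf x=(1,0,-1,0,0,0)$), the right Zinbiel operad ($\mathbf x=(1,1,0,0,0,0)$), and the Poisson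 operad ($\mathbf x=(1,\tfrac13,-\tfrac13,\tfrac13,-\tfrac13,0)$).
   Context: Let $\mathbb F$ be a field of characteristic $0$. Let $\mathcal T$ be the free symmetric operad over $\mathbb F$ generated by one binary operation $(a_1,a_2)\mapsto a_1a_2$ with no symmetry; its arity-$n$ component $\mathcal T(n)$ is the vector space with basis all multilinear bracketed (nonassociative) monomials in $a_1,\dots,a_n$, with the right $S_n$-action permuting arguments. For $\mathbf x=(x_1,\dots,x_6)\in\mathbb F^6$, $\mathcal O_{\mathbf x}$ denotes the quotient of $\mathcal T$ by the operad ideal $\mathcal J_{\mathbf x}$ generated by the relation (LR): $(a_1a_2)a_3 = x_1a_1(a_2a_3)+x_2a_1(a_3a_2)+x_3a_2(a_1a_3)+x_4a_2(a_3a_1)+x_5a_3(a_1a_2)+x_6a_3(a_2a_1)$. Such an operad is called a parametrized one-relation operad. $\mathcal O_{\mathbf x}$ is called regular if for every $n\ge1$ the right $S_n$-module $\mathcal O_{\mathbf x}(n)$ is isomorphic to the regular module $\mathbb FS_n$. *)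

(* Defs.v *)
From HB Require Import structures.
From mathcomp Require Import all_boot all_order all_fingroup all_algebra.
Set Implicit Arguments. Unset Strict Implicit. Unset Printing Implicit Defensive.
Import GRing.Theory.
Local Open Scope ring_scope.

(* Bracketed (nonassociative) monomials = full binary trees with labelled leaves. *)
Inductive tree (T : Type) := Leaf of T | Node of tree T & tree T.
Arguments Leaf {T}. Arguments Node {T}.

Fixpoint tree_eqb (T : eqType) (t u : tree T) : bool :=
  match t, u with
  | Leaf a, Leaf b => a == b
  | Node l r, Node l' r' => tree_eqb l l' && tree_eqb r r'
  | _, _ => false
  end.

Lemma tree_eqP (T : eqType) : Equality.axiom (@tree_eqb T).
Proof.
move=> t u; apply: (iffP idP) => [|<-].
  elim: t u => [a|l IHl r IHr] [b|l' r'] //=; first by move/eqP->.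
  by case/andP => /IHl -> /IHr ->.
by elim: t => [a|l IHl r IHr] /=; [exact: eqxx | rewrite IHl IHr].
Qed.

HB.instance Definition _ (T : eqType) := hasDecEq.Build (tree T) (@tree_eqP T).

Fixpoint leaves T (t : tree T) : seq T :=
  match t with Leaf a => [:: a] | Node l r => leaves l ++ leaves r end.

Fixpoint tmap T U (f : T -> U) (t : tree T) : tree U :=
  match t with Leaf a => Leaf (f a) | Node l r => Node (tmap f l) (tmap f r) end.

(* Basis of T(n): multilinear monomials in a_1..a_n (labels 'I_n), each
   variable occurring exactly once. *)
Definition mono n (t : tree 'I_n) : bool := perm_eq (leaves t) (enum 'I_n).

Definition fsum (F : Type) (T : Type) := seq (F * tree T).

Section Operad.
Variable F : fieldType.

Definition coef (T : eqType) (s : fsum F T) (t : tree T) : F :=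
  \sum_(p <- s) (if p.2 == t then p.1 else 0).

Definition scale T (a : F) (s : fsum F T) : fsum F T := [seq (a * p.1, p.2) | p <- s].

Definition allmono n (s : fsum F 'I_n) : bool := all (fun p => mono p.2) s.

Inductive ctx (T : Type) := Hole | CL of ctx T & tree T | CR of tree T & ctx T.
Arguments Hole {T}.

Fixpoint plug T (c : ctx T) (u : tree T) : tree T :=
  match c with
  | Hole => u
  | CL c' r => Node (plug c' u) r
  | CR l c' => Node l (plug c' u)
  end.

Definition relgen T (x : 6.-tuple F) (c : ctx T) (A B C : tree T) : fsum F T :=
  let P := plug c in
  [:: (1, P (Node (Node A B) C));
      (- x`_0, P (Node A (Node B C)));
      (- x`_1, P (Node A (Node C B)));
      (- x`_2, P (Node B (Node A C)));
      (- x`_3, P (Node B (Node C A)));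
      (- x`_4, P (Node C (Node A B)));
      (- x`_5, P (Node C (Node B A)))].

(* Membership in J_x(n): the formal sum s equals (coefficientwise) a linear
   combination of relations applied at some node of a multilinear monomial. *)
Definition inJ (x : 6.-tuple F) n (s : fsum F 'I_n) : Prop :=
  exists g : seq (F * (ctx 'I_n * tree 'I_n * tree 'I_n * tree 'I_n)),
    all (fun q => mono (plug q.2.1.1.1 (Node (Node q.2.1.1.2 q.2.1.2) q.2.2))) g /\
    forall t, coef s t =
      coef (flatten [seq scale q.1 (relgen x q.2.1.1.1 q.2.1.1.2 q.2.1.2 q.2.2) | q <- g]) t.

Definition phi n (b : tree 'I_n -> {ffun 'S_n -> F}) (s : fsum F 'I_n) : {ffun 'S_n -> F} :=
  [ffun g => \sum_(p <- s) p.1 * b p.2 g].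

(* Right regular action of S_n on F S_n (functions S_n -> F):
   e_g . sigma = e_(g sigma). *)
Definition ract n (f : {ffun 'S_n -> F}) (sigma : 'S_n) : {ffun 'S_n -> F} :=
  [ffun g => f (g * sigma^-1)%g].

(* O_x(n) = T(n)/J_x(n) is isomorphic to F S_n as a right S_n-module:
   there is an S_n-equivariant linear surjection T(n) -> F S_n with kernel J_x(n).
   (Right action on monomials: relabel a_i by a_(sigma i).) *)
Definition regular_at (x : 6.-tuple F) n : Prop :=
  exists b : tree 'I_n -> {ffun 'S_n -> F},
    [/\ forall (t : tree 'I_n) (sigma : 'S_n), mono t ->
           b (tmap (fun i => sigma i) t) = ract (b t) sigma,
        forall f : {ffun 'S_n -> F}, exists s, allmono s /\ phi b s = f
      & forall s : fsum F 'I_n, allmono s -> ((forall g, phi b s g = 0) <-> inJ x s)].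

Definition regular_operad (x : 6.-tuple F) : Prop :=
  forall n, (0 < n)%N -> regular_at x n.

(* Operad endomorphism of the free operad T sending the generator
   a1 a2 to  al * a1a2 + be * a2a1. *)
Definition fmul T (s1 s2 : fsum F T) : fsum F T :=
  [seq (p.1 * q.1, Node p.2 q.2) | p <- s1, q <- s2].

Fixpoint substT (al be : F) T (t : tree T) : fsum F T :=
  match t with
  | Leaf i => [:: (1, Leaf i)]
  | Node l r =>
      scale al (fmul (substT al be l) (substT al be r)) ++
      scale be (fmul (substT al be r) (substT al be l))
  end.

Definition substS (al be : F) T (s : fsum F T) : fsum F T :=
  flatten [seq scale p.1 (substT al be p.2) | p <- s].

(* O_x and O_y are isomorphic symmetric operads: some morphism of operads
   O_x -> O_y (necessarily induced by a substitution of the generator, since O_x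
   is generated by the binary operation and O_y(2) = T(2)) is well defined and
   bijective in every arity. *)
Definition operad_iso (x y : 6.-tuple F) : Prop :=
  exists al be : F, forall n, (0 < n)%N ->
    [/\ forall s : fsum F 'I_n, allmono s -> inJ x s -> inJ y (substS al be s),
        forall s : fsum F 'I_n, allmono s -> inJ y (substS al be s) -> inJ x s
      & forall t : tree 'I_n, mono t ->
          exists s, allmono s /\ inJ y (substS al be s ++ [:: (-1, t)])].

Definition on_conic (u v : F) : Prop :=
  v ^+ 2 - v - (u - 1) ^+ 2 = 0 /\ (u, v) <> (1, 1) /\ (u, v) <> (3^-1, - 3^-1).

End Operad.

(* Main.v *)
Require Import Defs.
From HB Require Import structures.
From mathcomp Require Import all_boot all_order all_fingroup all_algebra.
From mathcomp Require Import ring zify.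
Set Implicit Arguments. Unset Strict Implicit. Unset Printing Implicit Defensive.
Import GRing.Theory.
Local Open Scope ring_scope.

(** The classification only uses regularity in arity 4.  A linear functional on
    O_x(4) is a functional on the bracketed monomials which kills the relations;
    O_x(4) is regular, so for the trivial, sign, two-dimensional and the two
    three-dimensional irreducible S_4-modules M the space of equivariant maps
    from O_x(4) to M has dimension dim M.  Such a map is a table of vectors, one
    for each of the five shapes of bracketings, subject to a linear system with
    coefficients polynomial in x, and its solution space having the right
    dimension is expressed by vanishing minors (upper bound) and by the existence
    of enough solutions (lower bound).

    With x_1 + x_3 = x_2 + x_4 these minors split into linear factors after few
    substitutions.  Otherwise one passes to the operations ab + ba and ab - ba:
    the relation then expresses the products with an anticommutative inner factor
    through those with a commutative one, by four coefficients a, b, c, d, next to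
    one coefficient for each of the trivial and the sign component of the relations,
    and the minors become short polynomials in these six parameters.

    For the second part, the substitution ab -> al ab + be ba of the generator
    induces an isomorphism as soon as al^2 <> be^2 and the substituted relations
    follow from each other, which is a finite list of polynomial identities in x,
    al and be. *)
(** * Functionals on the arity components *)

(** A map from the regular module to [M] is determined by the image of the identity, which is
    arbitrary; equivariant functionals can thus be counted without forming the quotient by [J_x] and
    without decomposing modules. Each [M] is cut out by hand from the functions on a finite set with
    an action of [S_4], possibly twisted by the sign. What separates the two cases is solvability.
    In arity three the relation sends right combs to left combs; on the two-dimensional component
    this is a two by two matrix, whose entry from anticommutative to commutative inner factors is
    [3 * (p - q)], where [2 * p = x_1 + x_3] and [2 * q = x_2 + x_4]. The passage to [a, b, c, d]
    divides by this entry. When it vanishes, the unknowns are instead the values on the shapes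
    [(ab)(cd)] and [a(b(cd))]. The long numerical expressions inside proofs are certificates:
    multipliers of earlier equations whose combination yields the goal, checked by [ring] or
    [field]. *)

Section Formal.
Variable F : fieldType.

Definition lin (T : Type) (f : tree T -> F) (s : fsum F T) : F :=
  \sum_(p <- s) p.1 * f p.2.

Lemma lin_cat T (f : tree T -> F) s1 s2 : lin f (s1 ++ s2) = lin f s1 + lin f s2.
Proof. by rewrite /lin big_cat. Qed.

Lemma lin_scale T (f : tree T -> F) a s : lin f (scale a s) = a * lin f s.
Proof. by rewrite /lin big_map mulr_sumr; apply: eq_bigr => p _; rewrite mulrA. Qed.

Lemma lin_flatten T (f : tree T -> F) ss :
  lin f (flatten ss) = \sum_(s <- ss) lin f s.
Proof.
elim: ss => [|s ss IH] /=; first by rewrite /lin !big_nil.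
by rewrite lin_cat IH big_cons.
Qed.

Lemma lin_coef (T : eqType) (f : tree T -> F) (s : fsum F T) (r : seq (tree T)) :
  uniq r -> {subset [seq p.2 | p <- s] <= r} ->
  lin f s = \sum_(t <- r) coef s t * f t.
Proof.
move=> ur; elim: s => [|p s IH] sub.
  rewrite /lin big_nil big1_seq // => t _; by rewrite /coef big_nil mul0r.
have pr : p.2 \in r by apply: sub; rewrite inE eqxx.
rewrite /lin big_cons -/(lin f s) IH; last by move=> t ts; apply: sub; rewrite inE ts orbT.
under [RHS]eq_bigr => t _ do rewrite /coef big_cons mulrDl -/(coef s t).
rewrite big_split /=; congr (_ + _).
rewrite (bigD1_seq p.2) //= eqxx big1 ?addr0 // => t /negbTE.
by rewrite eq_sym => ->; rewrite mul0r.
Qed.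

(** Membership in [J_x] is stated coefficientwise, so functionals have to be insensitive to the
    chosen representation of a formal sum. *)
Lemma eq_coef_lin (T : eqType) (f : tree T -> F) (s1 s2 : fsum F T) :
  coef s1 =1 coef s2 -> lin f s1 = lin f s2.
Proof.
move=> e; pose r := undup ([seq p.2 | p <- s1] ++ [seq p.2 | p <- s2]).
rewrite (@lin_coef _ f s1 r) ?undup_uniq //; last first.
  by move=> t ts; rewrite mem_undup mem_cat ts.
rewrite (@lin_coef _ f s2 r) ?undup_uniq //; last first.
  by move=> t ts; rewrite mem_undup mem_cat ts orbT.
by apply: eq_bigr => t _; rewrite e.
Qed.

Definition kills (x : 6.-tuple F) n (f : tree 'I_n -> F) :=
  forall (c : ctx 'I_n) (A B C : tree 'I_n),
    mono (plug c (Node (Node A B) C)) -> lin f (relgen x c A B C) = 0.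

Lemma kills_inJ (x : 6.-tuple F) n (f : tree 'I_n -> F) s :
  kills x f -> inJ x s -> lin f s = 0.
Proof.
move=> kf [g [gm e]]; rewrite (eq_coef_lin _ e) lin_flatten big_map.
elim: g gm {e} => [|q g IH]; first by rewrite big_nil.
by case/andP => mq gm; rewrite big_cons lin_scale kf // mulr0 add0r IH.
Qed.

Lemma inJ_relgen (x : 6.-tuple F) n c (A B C : tree 'I_n) :
  mono (plug c (Node (Node A B) C)) -> inJ x (relgen x c A B C).
Proof.
move=> m; exists [:: (1, (c, A, B, C))]; split; first by rewrite /= m.
move=> t; congr coef => /=.
by rewrite !mul1r.
Qed.

(** * Functionals on a regular component *)

Section Regular.
Variables (x : 6.-tuple F) (n : nat) (b : tree 'I_n -> {ffun 'S_n -> F}).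
Hypothesis b_equiv : forall (t : tree 'I_n) (sigma : 'S_n), mono t ->
  b (tmap (fun i => sigma i) t) = Defs.ract (b t) sigma.
Hypothesis b_onto : forall f : {ffun 'S_n -> F}, exists s, allmono s /\ phi b s = f.
Hypothesis b_ker : forall s : fsum F 'I_n, allmono s ->
  ((forall g, phi b s g = 0) <-> inJ x s).

(** The functional on the group algebra with weights [H], pulled back along [b]. On multilinear
    monomials these turn out to be exactly the functionals that kill the relations. *)
Definition fun_of (H : 'S_n -> F) (t : tree 'I_n) : F := \sum_g H g * b t g.

Lemma lin_fun_of H s : lin (fun_of H) s = \sum_g H g * phi b s g.
Proof.
rewrite /lin /fun_of; under eq_bigr do rewrite mulr_sumr.
rewrite exchange_big; apply: eq_bigr => g _.
by rewrite ffunE mulr_sumr; apply: eq_bigr => p _; rewrite mulrCA.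
Qed.

Lemma fun_of_kills H : kills x (fun_of H).
Proof.
move=> c A B C m; rewrite lin_fun_of.
(* All seven monomials of a relation have the same multiset of leaves, so they are multilinear
   together. *)
have al : allmono (relgen x c A B C).
  have pl : forall A' B' C' : tree 'I_n,
     perm_eq (leaves A' ++ leaves B' ++ leaves C') (leaves A ++ leaves B ++ leaves C) ->
     mono (plug c (Node A' (Node B' C'))).
    move=> A' B' C' p; move: m; rewrite /mono => m; apply: perm_trans m.
    elim: c => [|c IH r|l c IH] /=; first by rewrite -catA.
      by rewrite perm_cat2r.
    by rewrite perm_cat2l.
  rewrite /allmono /= m !pl //; apply/seq.permP => a; rewrite !count_cat; lia.
rewrite big1 // => g _.
by have /(b_ker al) -> := inJ_relgen x m; rewrite mulr0.
Qed.

(** Surjectivity of [b] supplies a formal sum sent to the indicator of [g], and the functional takes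
    the value [H g] on it. *)
Lemma fun_of_eq0 H : (forall t, mono t -> fun_of H t = 0) -> forall g, H g = 0.
Proof.
move=> H0 g; have [s [sm es]] := b_onto [ffun h => (h == g)%:R].
have : lin (fun_of H) s = 0.
  rewrite /lin big1_seq // => p /andP[_ ps]; rewrite H0 ?mulr0 //.
  exact: (allP sm).
rewrite lin_fun_of es (bigD1 g) //= ffunE eqxx mulr1 big1 ?addr0 // => h /negbTE hg.
by rewrite ffunE hg mulr0.
Qed.

(** Modulo [J_x] a monomial is a combination, with coefficients [b t g], of fixed preimages [S g] of
    the group elements. A functional that kills the relations is therefore determined by its values
    on the [S g], which serve as weights. *)
Lemma fun_of_surj (f : tree 'I_n -> F) : kills x f ->
  exists H, forall t, mono t -> f t = fun_of H t.
Proof.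
move=> kf.
have /fin_all_exists [S hS] : forall g : 'S_n, exists s, allmono s /\
    phi b s = [ffun h => (h == g)%:R] by move=> g; apply: b_onto.
exists (fun g => lin f (S g)) => t mt.
(* The difference between [t] and its expansion in the [S g]; it lies in the kernel of [phi b],
   hence in [J_x]. *)
pose s : fsum F 'I_n := (1, t) :: flatten [seq scale (- b t g) (S g) | g <- enum 'S_n].
have sm : allmono s.
  rewrite /allmono /= mt /=; apply/allP => p /flattenP [w /mapP [g _ ->]].
  by case/mapP => q qs ->; have [/allP /(_ _ qs)] := hS g.
have lins h : lin h s = h t - \sum_g b t g * lin h (S g).
  rewrite {1}/lin big_cons mul1r -/(lin h _) lin_flatten big_map /= -sumrN big_enum /=.
  by congr (_ + _); apply: eq_bigr => g _; rewrite lin_scale mulNr.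
have : inJ x s.
  apply/(b_ker sm) => g; have -> : phi b s g = lin (fun u => b u g) s by rewrite ffunE.
  rewrite lins (bigD1 g) //= big1 => [|h /negbTE hg].
    have -> : lin (fun u => b u g) (S g) = phi b (S g) g by rewrite ffunE.
    by have [_ ->] := hS g; rewrite ffunE eqxx mulr1 addr0 subrr.
  have -> : lin (fun u => b u g) (S h) = phi b (S h) g by rewrite ffunE.
  by have [_ ->] := hS h; rewrite ffunE eq_sym hg mulr0.
move/(kills_inJ kf); rewrite lins => /eqP; rewrite subr_eq0 => /eqP ->.
by rewrite /fun_of; apply: eq_bigr => g _; rewrite mulrC.
Qed.

Lemma fun_of_tmap H t (s : 'S_n) : mono t ->
  fun_of H (tmap (fun i => s i) t) = fun_of (fun g => H (g * s)%g) t.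
Proof.
move=> mt; rewrite /fun_of b_equiv // (reindex_inj (mulIg s)) /=.
by apply: eq_bigr => g _; rewrite ffunE mulgK.
Qed.

End Regular.
End Formal.

(** * Arity four: shapes and relations *)

Lemma leaves_tmap T U (f : T -> U) t : leaves (tmap f t) = [seq f i | i <- leaves t].
Proof. by elim: t => //= l -> r ->; rewrite map_cat. Qed.

Lemma size_leaves_gt0 T (t : tree T) : (0 < size (leaves t))%N.
Proof. by elim: t => //= l Hl r Hr; rewrite size_cat addn_gt0 Hl. Qed.

Lemma eq_tmap T U (f g : T -> U) : f =1 g -> tmap f =1 tmap g.
Proof. by move=> e; elim=> [a|l IHl r IHr] /=; rewrite ?e ?IHl ?IHr. Qed.

Lemma tmap_id T (f : T -> T) : (forall i, f i = i) -> forall t, tmap f t = t.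
Proof. by move=> e; elim=> [a|l IHl r IHr] /=; rewrite ?e ?IHl ?IHr. Qed.

Lemma tmap_comp T U V (f : T -> U) (g : U -> V) t :
  tmap g (tmap f t) = tmap (fun i => g (f i)) t.
Proof. by elim: t => //= l -> r ->. Qed.

Lemma mono_tmap n (s : 'S_n) t : mono (tmap (fun i => s i) t) = mono t.
Proof.
rewrite /mono leaves_tmap.
have e : perm_eq (enum 'I_n) [seq s i | i <- enum 'I_n].
  apply: uniq_perm; rewrite ?(map_inj_uniq (@perm_inj _ s)) ?enum_uniq // => i.
  rewrite mem_enum inE; apply/esym/mapP; exists (s^-1 i)%g; first by rewrite mem_enum.
  by rewrite permKV.
rewrite (permPr e); apply/idP/idP => [/perm_map_inj|]; last exact: perm_map.
by apply; apply: perm_inj.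
Qed.

Definition o0 : 'I_4 := @Ordinal 4 0 isT.
Definition o1 : 'I_4 := @Ordinal 4 1 isT.
Definition o2 : 'I_4 := @Ordinal 4 2 isT.
Definition o3 : 'I_4 := @Ordinal 4 3 isT.

Lemma ord4P (P : 'I_4 -> Prop) : P o0 -> P o1 -> P o2 -> P o3 -> forall i, P i.
Proof.
move=> h0 h1 h2 h3 [[|[|[|[|m]]]] lt] //.
- by rewrite (_ : Ordinal lt = o0) //; apply: val_inj.
- by rewrite (_ : Ordinal lt = o1) //; apply: val_inj.
- by rewrite (_ : Ordinal lt = o2) //; apply: val_inj.
by rewrite (_ : Ordinal lt = o3) //; apply: val_inj.
Qed.

Definition gen (i : nat) : 'S_4 :=
  match i with 0 => tperm o0 o1 | 1 => tperm o1 o2 | _ => tperm o2 o3 end.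

Lemma genE : ((gen 0 o0 = o1) * (gen 0 o1 = o0) * (gen 0 o2 = o2) * (gen 0 o3 = o3) *
  (gen 1 o0 = o0) * (gen 1 o1 = o2) * (gen 1 o2 = o1) * (gen 1 o3 = o3) *
  (gen 2 o0 = o0) * (gen 2 o1 = o1) * (gen 2 o2 = o3) * (gen 2 o3 = o2))%type.
Proof. by do !split; rewrite permE. Qed.

Lemma genV i : (gen i)^-1%g = gen i.
Proof. by case: i => [|[|i]]; apply: tpermV. Qed.

(** Words in adjacent transpositions, the leftmost letter acting first. They are used because the
    length of the word records the sign of the product. *)
Definition gprod (l : seq nat) : 'S_4 := foldr (fun i s => gen i * s)%g 1%g l.

Definition shape (s : nat) : tree 'I_4 :=
  match s with
  | 0 => Node (Node (Node (Leaf o0) (Leaf o1)) (Leaf o2)) (Leaf o3)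
  | 1 => Node (Node (Leaf o0) (Node (Leaf o1) (Leaf o2))) (Leaf o3)
  | 2 => Node (Node (Leaf o0) (Leaf o1)) (Node (Leaf o2) (Leaf o3))
  | 3 => Node (Leaf o0) (Node (Node (Leaf o1) (Leaf o2)) (Leaf o3))
  | _ => Node (Leaf o0) (Node (Leaf o1) (Node (Leaf o2) (Leaf o3)))
  end.

Definition tree_of (p : nat * seq nat) : tree 'I_4 := tmap (gprod p.2) (shape p.1).

(** Up to relabelling, the five positions of a relation among four letters: inside the left factor,
    at the root with one of its three arguments a product, inside the right factor. The leading
    monomials have shapes 0, 0, 1, 2, 3; the double hit on shape 0 is an overlap, and shape 4 never
    leads. *)
Definition ctx_of (k : nat) : ctx 'I_4 * tree 'I_4 * tree 'I_4 * tree 'I_4 :=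
  match k with
  | 0 => (CL (Hole _) (Leaf o3), Leaf o0, Leaf o1, Leaf o2)
  | 1 => (Hole _, Node (Leaf o0) (Leaf o1), Leaf o2, Leaf o3)
  | 2 => (Hole _, Leaf o0, Node (Leaf o1) (Leaf o2), Leaf o3)
  | 3 => (Hole _, Leaf o0, Leaf o1, Node (Leaf o2) (Leaf o3))
  | _ => (CR (Leaf o0) (Hole _), Leaf o1, Leaf o2, Leaf o3)
  end.

(* The seven monomials of the relation placed in [ctx_of k]: [(s, l)] stands for
   [shape s] with its letters permuted by the product of the transpositions in [l]. *)
Definition terms (k : nat) : seq (nat * seq nat) :=
  match k with
  | 0 => [:: (0, [::]); (1, [::]); (1, [:: 1]); (1, [:: 0]); (1, [:: 1; 0]);
             (1, [:: 0; 1]); (1, [:: 0; 1; 0])]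
  | 1 => [:: (0, [::]); (2, [::]); (2, [:: 2]); (3, [:: 0; 1]); (4, [:: 1; 0; 2; 1]);
             (3, [:: 0; 1; 2]); (4, [:: 0; 1; 0; 2; 1])]
  | 2 => [:: (1, [::]); (3, [::]); (4, [:: 1; 2]); (2, [:: 1; 0]); (2, [:: 2; 1; 0]);
             (4, [:: 0; 1; 2]); (3, [:: 0; 1; 2; 1; 0])]
  | 3 => [:: (2, [::]); (4, [::]); (3, [:: 2; 1]); (4, [:: 0]); (3, [:: 2; 1; 0]);
             (2, [:: 1; 0; 2; 1]); (2, [:: 1; 0; 2; 1; 0])]
  | _ => [:: (3, [::]); (4, [::]); (4, [:: 2]); (4, [:: 1]); (4, [:: 2; 1]);
             (4, [:: 1; 2]); (4, [:: 1; 2; 1])]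
  end%N.

Lemma tree1P T (t : tree T) : size (leaves t) = 1%N -> exists a, t = Leaf a.
Proof.
case: t => [a|l r] /=; first by exists a.
by rewrite size_cat; have := size_leaves_gt0 l; have := size_leaves_gt0 r; lia.
Qed.

Lemma tree2P T (t : tree T) : size (leaves t) = 2%N ->
  exists a b, t = Node (Leaf a) (Leaf b).
Proof.
case: t => [a|l r] //=; rewrite size_cat => e.
have hl := size_leaves_gt0 l; have hr := size_leaves_gt0 r.
have [a ->] := @tree1P _ l ltac:(lia); have [b ->] := @tree1P _ r ltac:(lia).
by exists a, b.
Qed.

Lemma tree3P T (t : tree T) : size (leaves t) = 3%N ->
  exists a b c, t = Node (Node (Leaf a) (Leaf b)) (Leaf c) \/
                t = Node (Leaf a) (Node (Leaf b) (Leaf c)).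
Proof.
case: t => [a|l r] //=; rewrite size_cat => e.
have hl := size_leaves_gt0 l; have hr := size_leaves_gt0 r.
have [e1|e1] : size (leaves l) = 1%N \/ size (leaves l) = 2%N by lia.
  have [a ->] := tree1P e1; have [b [c ->]] := @tree2P _ r ltac:(lia).
  by exists a, b, c; right.
have [a [b ->]] := tree2P e1; have [c ->] := @tree1P _ r ltac:(lia).
by exists a, b, c; left.
Qed.

Lemma word_perm (a b c d : 'I_4) : uniq [:: a; b; c; d] ->
  exists s : 'S_4, [/\ s o0 = a, s o1 = b, s o2 = c & s o3 = d].
Proof.
move=> u; have inj : injective (fun i : 'I_4 => nth a [:: a; b; c; d] i).
  move=> i j /eqP; rewrite nth_uniq ?ltn_ord // => /eqP; exact: val_inj.
by exists (perm inj); split; rewrite permE.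
Qed.

Lemma mono4 (t : tree 'I_4) : mono t ->
  uniq (leaves t) /\ size (leaves t) = 4%N.
Proof.
by move=> m; rewrite (perm_uniq m) (perm_size m) enum_uniq size_enum_ord.
Qed.

(** Together with [shape_inj] this says that [T(4)] is a free [S_4]-module on the five shapes, so
    that an equivariant map is the same as a table of its values on shapes. *)
Lemma mono_shape (t : tree 'I_4) : mono t ->
  exists (s : 'I_5) (g : 'S_4), t = tmap g (shape s).
Proof.
move=> /mono4[]; case: t => [a|l r] //=; rewrite size_cat => u e.
have hl := size_leaves_gt0 l; have hr := size_leaves_gt0 r.
have [e1|[e1|e1]] : size (leaves l) = 1%N \/ size (leaves l) = 2%N \/
  size (leaves l) = 3%N by lia.
- have [a E] := tree1P e1; have [b [c [d E2]]] := @tree3P _ r ltac:(lia).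
  case: E2 => E2; move: u; rewrite E E2 /= => /word_perm [g [ga gb gc gd]].
    by exists (@Ordinal 5 3 isT), g; rewrite /= ga gb gc gd.
  by exists (@Ordinal 5 4 isT), g; rewrite /= ga gb gc gd.
- have [a [b E]] := tree2P e1; have [c [d E2]] := @tree2P _ r ltac:(lia).
  move: u; rewrite E E2 /= => /word_perm [g [ga gb gc gd]].
  by exists (@Ordinal 5 2 isT), g; rewrite /= ga gb gc gd.
have [a [b [c E]]] := tree3P e1; have [d E2] := @tree1P _ r ltac:(lia).
case: E => E; move: u; rewrite E E2 /= => /word_perm [g [ga gb gc gd]].
  by exists (@Ordinal 5 0 isT), g; rewrite /= ga gb gc gd.
by exists (@Ordinal 5 1 isT), g; rewrite /= ga gb gc gd.
Qed.

Lemma mono_shape4 s : mono (shape s).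
Proof.
have -> : mono (shape s) = mono (shape 0) by rewrite /mono; case: s => [|[|[|[|s]]]].
apply: uniq_perm; rewrite ?enum_uniq // => i; rewrite mem_enum.
by elim/ord4P: i.
Qed.

Lemma shape_inj (s1 s2 : 'I_5) (g1 g2 : 'S_4) :
  tmap g1 (shape s1) = tmap g2 (shape s2) -> s1 = s2 /\ g1 = g2.
Proof.
move=> e; have e1 : s1 = s2.
  move: s1 s2 e => [[|[|[|[|[|?]]]]] l1] [[|[|[|[|[|?]]]]] l2] //= _; exact: val_inj.
split=> //; apply/permP; move: e; rewrite e1 => e.
have /= : leaves (tmap g1 (shape s2)) = leaves (tmap g2 (shape s2)) by rewrite e.
rewrite !leaves_tmap.
have -> : leaves (shape s2) = [:: o0; o1; o2; o3] by case: s2 {e e1} => [[|[|[|[|[|?]]]]] l2].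
by case=> *; elim/ord4P.
Qed.

Section Tables.
Variable F : fieldType.
Variable x : 6.-tuple F.

Definition coefs : seq F := [:: 1; - x`_0; - x`_1; - x`_2; - x`_3; - x`_4; - x`_5].

Lemma relgen_base k :
  let: (c, A, B, C) := ctx_of k in
  relgen x c A B C = [seq (p.1, tree_of p.2) | p <- zip coefs (terms k)].
Proof.
by case: k => [|[|[|[|k]]]]; rewrite /relgen /= /tree_of /gprod /= !permM !perm1 !genE.
Qed.

Fixpoint cmap (f : 'I_4 -> 'I_4) (c : ctx 'I_4) : ctx 'I_4 :=
  match c with
  | Hole => Hole _
  | CL c r => CL (cmap f c) (tmap f r)
  | CR l c => CR (tmap f l) (cmap f c)
  end.

Lemma tmap_plug f c u : tmap f (plug c u) = plug (cmap f c) (tmap f u).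
Proof. by elim: c => //= [c -> r|l c ->]. Qed.

Lemma relgen_tmap f c A B C :
  relgen x (cmap f c) (tmap f A) (tmap f B) (tmap f C) =
  [seq (p.1, tmap f p.2) | p <- relgen x c A B C].
Proof. by rewrite /relgen /= !tmap_plug. Qed.

(** A relation involves at least three leaves, so with four letters its context has depth at most
    one, and counting leaves gives the five positions. An equivariant functional thus has only the
    five base relations to satisfy. *)
Lemma mono_ctx c A B C : mono (plug c (Node (Node A B) C)) ->
  exists k (g : 'S_4), (k < 5)%N /\
   relgen x c A B C = [seq (p.1, tmap g (tree_of p.2)) | p <- zip coefs (terms k)].
Proof.
move=> m.
suff [k [g [lt E]]] : exists k (g : 'S_4), (k < 5)%N /\
   (c, A, B, C) = let: (c', A', B', C') := ctx_of k in
                  (cmap g c', tmap g A', tmap g B', tmap g C').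
  exists k, g; split=> //; move: E (relgen_base k).
  case: (ctx_of k) => [[[c' A'] B'] C'] [-> -> -> ->] e; rewrite relgen_tmap e -map_comp.
  by apply: eq_map.
have [u e] := mono4 m; move: u e.
have := (size_leaves_gt0 A, size_leaves_gt0 B, size_leaves_gt0 C) => -[[hA hB] hC].
have plug_gt c' v : (size (leaves v) <= size (leaves (@plug 'I_4 c' v)))%N.
  by elim: c' => //= [c' IH r|l c' IH]; rewrite size_cat; lia.
case: c {m} => [|c r|l c] /=; rewrite ?size_cat => u e.
- have [e1|[e1|e1]] : (size (leaves A) = 2 /\ size (leaves B) = 1 /\ size (leaves C) = 1)%N \/
    (size (leaves A) = 1 /\ size (leaves B) = 2 /\ size (leaves C) = 1)%N \/
    (size (leaves A) = 1 /\ size (leaves B) = 1 /\ size (leaves C) = 2)%N by lia.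
  + case: e1 => /tree2P[a [b EA]] [/tree1P[c EB] /tree1P[d EC]].
    move: u; rewrite EA EB EC /= => /word_perm [g [ga gb gc gd]].
    by exists 1%N, g; split=> //=; rewrite ga gb gc gd.
  + case: e1 => /tree1P[a EA] [/tree2P[b [c EB]] /tree1P[d EC]].
    move: u; rewrite EA EB EC /= => /word_perm [g [ga gb gc gd]].
    by exists 2%N, g; split=> //=; rewrite ga gb gc gd.
  + case: e1 => /tree1P[a EA] [/tree1P[b EB] /tree2P[c [d EC]]].
    move: u; rewrite EA EB EC /= => /word_perm [g [ga gb gc gd]].
    by exists 3%N, g; split=> //=; rewrite ga gb gc gd.
- have hr := size_leaves_gt0 r; have := plug_gt c (Node (Node A B) C).
  rewrite /= !size_cat => hp.
  have [d E] := @tree1P _ r ltac:(lia).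
  have Ec : c = Hole _.
    case: c {u} e hp => //= [c r'|l c]; rewrite ?size_cat => e hp.
      have h1 := size_leaves_gt0 r'; have h2 := plug_gt c (Node (Node A B) C).
      by move: h2; rewrite /= !size_cat; lia.
    have h1 := size_leaves_gt0 l; have h2 := plug_gt c (Node (Node A B) C).
    by move: h2; rewrite /= !size_cat; lia.
  move: u e hp; rewrite Ec E /= !size_cat => u e _.
  have [a EA] := @tree1P _ A ltac:(lia); have [b EB] := @tree1P _ B ltac:(lia).
  have [c' EC] := @tree1P _ C ltac:(lia).
  move: u; rewrite EA EB EC /= => /word_perm [g [ga gb gc gd]].
  by exists 0%N, g; split=> //=; rewrite ga gb gc gd.
have hl := size_leaves_gt0 l; have := plug_gt c (Node (Node A B) C).
rewrite /= !size_cat => hp.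
have [d E] := @tree1P _ l ltac:(lia).
have Ec : c = Hole _.
  case: c {u} e hp => //= [c r'|l' c]; rewrite ?size_cat => e hp.
    have h1 := size_leaves_gt0 r'; have h2 := plug_gt c (Node (Node A B) C).
    by move: h2; rewrite /= !size_cat; lia.
  have h1 := size_leaves_gt0 l'; have h2 := plug_gt c (Node (Node A B) C).
  by move: h2; rewrite /= !size_cat; lia.
move: u e hp; rewrite Ec E /= !size_cat => u e _.
have [a EA] := @tree1P _ A ltac:(lia); have [b EB] := @tree1P _ B ltac:(lia).
have [c' EC] := @tree1P _ C ltac:(lia).
move: u; rewrite EA EB EC /= => /word_perm [g [ga gb gc gd]].
by exists 4%N, g; split=> //=; rewrite ga gb gc gd.
Qed.

(** * Equivariant functionals with values in twisted permutation modules *)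

Section Rep.
Variables (J : finType) (act : 'S_4 -> J -> J) (chi : 'S_4 -> F).
Hypothesis act1 : forall j, act 1%g j = j.
Hypothesis actM : forall g h j, act (g * h)%g j = act h (act g j).
Hypothesis chi1 : chi 1%g = 1.
Hypothesis chiM : forall g h, chi (g * h)%g = chi g * chi h.
Variable eps : F.
Hypothesis chi_gen : forall i, chi (gen i) = eps.

(* Value at [j] of an equivariant functional given by its table [U] of values on shapes. *)
Definition twval (U : nat -> J -> F) (p : nat * seq nat) (j : J) : F :=
  eps ^+ size p.2 * U p.1 (foldr (fun i => act (gen i)) j p.2).

Definition relval (U : nat -> J -> F) k j : F :=
  \sum_(p <- zip coefs (terms k)) p.1 * twval U p.2 j.

Lemma act_gprodV l j : act (gprod l)^-1%g j = foldr (fun i => act (gen i)) j l.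
Proof.
elim: l j => [|i l IH] j /=; first by rewrite invg1 act1.
by rewrite invMg actM IH genV.
Qed.

Lemma chi_gprod l : chi (gprod l) = eps ^+ size l.
Proof. by elim: l => [|i l IH] /=; rewrite ?chi1 // chiM chi_gen IH exprS. Qed.

(** Equivariant maps from [O_x(4)] to the functions on [J] twisted by [chi] correspond to arbitrary
    functions [h], since a map out of a free module of rank one is its value at the generator. [B]
    is the table of [b] itself, twisted by [chi]; the three clauses say that [h] gives a solution,
    that it is determined by it, and that every solution arises. *)
Theorem regular_tables : regular_at x 4 -> exists B : nat -> 'S_4 -> F,
  let tb (h : J -> F) s j := \sum_g h (act g^-1%g j) * B s g in
  [/\ forall h k j, (k < 5)%N -> relval (tb h) k j = 0,
      forall h, (forall s j, (s < 5)%N -> tb h s j = 0) -> forall j, h j = 0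
    & forall U, (forall k j, (k < 5)%N -> relval U k j = 0) ->
       exists h, forall s j, (s < 5)%N -> U s j = tb h s j].
Proof.
case=> b [b_equiv b_onto b_ker].
pose H h j g := chi g * h (act g^-1%g j).
exists (fun s g => chi g * b (shape s) g) => tb.
have tbE h s j : tb h s j = fun_of b (H h j) (shape s).
  by apply: eq_bigr => g _; rewrite /H; ring.
have fH h j t (g : 'S_4) : mono t ->
    fun_of b (H h j) (tmap (fun i => g i) t) = chi g * fun_of b (H h (act g^-1%g j)) t.
  move=> mt; rewrite (fun_of_tmap b_equiv) // /fun_of mulr_sumr; apply: eq_bigr => g' _.
  by rewrite /H invMg actM chiM; ring.
split=> [h k j lt|h h0|U hU].
- have mk : mono (plug (ctx_of k).1.1.1
      (Node (Node (ctx_of k).1.1.2 (ctx_of k).1.2) (ctx_of k).2)).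
    have -> : plug (ctx_of k).1.1.1 (Node (Node (ctx_of k).1.1.2 (ctx_of k).1.2) (ctx_of k).2) =
       shape (nth 0%N [:: 0; 0; 1; 2; 3]%N k) by case: k lt => [|[|[|[|[|k]]]]].
    exact: mono_shape4.
  rewrite -(fun_of_kills b_ker (H h j) mk).
  have := relgen_base k; case: (ctx_of k) => [[[c A] B] C] /= ->.
  rewrite /relval /lin big_map; apply: eq_bigr => p _ /=; congr (_ * _).
  by rewrite fH ?mono_shape4 // chi_gprod act_gprodV /twval tbE.
- move=> j; have := @fun_of_eq0 _ _ _ b_onto (H h j) _ 1%g.
  rewrite /H chi1 mul1r invg1 act1 => -> // t /mono_shape [s [g ->]].
  by rewrite fH ?mono_shape4 // -tbE h0 ?mulr0.
(* The equivariant extension of the table [U] to all monomials. The value 0 on trees that are not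
   multilinear is a mere default. *)
pose f j t : F := if [pick p : 'I_5 * 'S_4 | t == tmap p.2 (shape p.1)] is Some p
  then chi p.2 * U p.1 (act p.2^-1%g j) else 0.
have fE j (s : 'I_5) (g : 'S_4) : f j (tmap g (shape s)) = chi g * U s (act g^-1%g j).
  rewrite /f; case: pickP => [[s' g'] /= /eqP /shape_inj [-> ->] //|/(_ (s, g))].
  by rewrite eqxx.
have kf j : kills x (f j).
  move=> c A B C /mono_ctx [k [g [lt ->]]].
  transitivity (chi g * relval U k (act g^-1%g j)); last by rewrite hU // mulr0.
  rewrite /lin big_map /relval mulr_sumr.
  apply: eq_big_seq => p pin /=; rewrite mulrCA; congr (_ * _).
  have ps : (p.2.1 < 5)%N.
    have : all (fun q : F * (nat * seq nat) => q.2.1 < 5)%N (zip coefs (terms k)).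
      by case: k {lt pin} => [|[|[|[|k]]]].
    by move/allP/(_ _ pin).
  rewrite /tree_of tmap_comp (_ : tmap _ _ = tmap (gprod p.2.2 * g)%g (shape (Ordinal ps))).
    by rewrite fE chiM invMg actM act_gprodV chi_gprod /twval /=; ring.
  by apply: eq_tmap => i; rewrite permM.
have /fin_all_exists [H' fH'] : forall j, exists H', forall t, mono t -> f j t = fun_of b H' t.
  by move=> j; apply: fun_of_surj b_onto b_ker _ (kf j).
have fT j s (g : 'S_4) : mono s -> f j (tmap (fun i => g i) s) = chi g * f (act g^-1%g j) s.
  case/mono_shape => s' [g' ->]; rewrite tmap_comp.
  rewrite (_ : tmap _ _ = tmap (g' * g)%g (shape s')); last by apply: eq_tmap => i; rewrite permM.
  by rewrite !fE chiM invMg actM; ring.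
(* Equivariance of [f] carries over to its weights by injectivity of [fun_of]; hence the values at
   the identity determine them and give the function [h]. *)
have H'E j g : H' j g = chi g * H' (act g^-1%g j) 1%g.
  apply/eqP; rewrite -subr_eq0; apply/eqP.
  rewrite -[X in H' j X](mul1g g).
  have := @fun_of_eq0 _ _ _ b_onto (fun g' => H' j (g' * g)%g - chi g * H' (act g^-1%g j) g') _ 1%g.
  apply=> t mt.
  rewrite (_ : fun_of _ _ _ = fun_of b (fun g' => H' j (g' * g)%g) t -
     chi g * fun_of b (H' (act g^-1%g j)) t).
    by rewrite -(fun_of_tmap b_equiv) // -!fH' ?mono_tmap // fT // subrr.
  by rewrite /fun_of mulr_sumr -sumrB; apply: eq_bigr => g' _; ring.
exists (fun j => H' j 1%g) => s j lt.
have -> : U s j = f j (shape s).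
  have := fE j (Ordinal lt) 1%g; rewrite chi1 mul1r invg1 act1 => <- /=.
  by rewrite (@tmap_id _ (fun i => fun_of_perm 1%g i)) // => i; rewrite perm1.
rewrite fH' ?mono_shape4 //; apply: eq_bigr => g _; rewrite H'E; ring.
Qed.

End Rep.
End Tables.

(** * The relations of arity four on irreducible modules *)

(** The mechanism of [lc]: the term [pf] proves a linear combination of known equations, assembled
    with [eqD] and [eqZ], and [ring] checks that its difference of sides is that of the goal. *)
Lemma eq_lc (R : zmodType) (a b c d : R) : a = b -> c - d = a - b -> c = d.
Proof. by move=> -> /eqP; rewrite subrr subr_eq0 => /eqP. Qed.

Lemma eqD (R : zmodType) (a b c d : R) : a = b -> c = d -> a + c = b + d.
Proof. by move=> -> ->. Qed.

Lemma eqZ (R : pzRingType) (k a b : R) : a = b -> k * a = k * b.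
Proof. by move=> ->. Qed.

Ltac lc pf := apply: (eq_lc pf); ring.

(** The pairs containing [o0] represent the three splittings of four points into two pairs; the
    two-dimensional irreducible consists of the functions of sum zero on these splittings. *)
Definition c01 : 'I_4 * 'I_4 := (o0, o1).
Definition c02 : 'I_4 * 'I_4 := (o0, o2).
Definition c03 : 'I_4 * 'I_4 := (o0, o3).

Section Base.
Variable F : fieldType.
Variable x : 6.-tuple F.

Definition ppact (g : 'S_4) (j : 'I_4 * 'I_4) : 'I_4 * 'I_4 := (g j.1, g j.2).
Definition pact (g : 'S_4) (j : 'I_4) : 'I_4 := g j.
Definition uact (g : 'S_4) (j : unit) : unit := j.

(** The base relations in the order of [ctx_of], each solved for its leading shape; [e] is the value
    of the character on transpositions. *)
Definition base1 (e : F) (U : nat -> unit -> F) : Prop :=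
  [/\ (U 0 tt = x`_0 * (U 1 tt) + x`_1 * (e * U 1 tt) + x`_2 * (e * U 1 tt) + x`_3 * (U 1 tt) + x`_4 * (U 1 tt) + x`_5 * (e * U 1 tt)),
   (U 0 tt = x`_0 * (U 2 tt) + x`_1 * (e * U 2 tt) + x`_2 * (U 3 tt) + x`_3 * (U 4 tt) + x`_4 * (e * U 3 tt) + x`_5 * (e * U 4 tt)),
   (U 1 tt = x`_0 * (U 3 tt) + x`_1 * (U 4 tt) + x`_2 * (U 2 tt) + x`_3 * (e * U 2 tt) + x`_4 * (e * U 4 tt) + x`_5 * (e * U 3 tt)),
   (U 2 tt = x`_0 * (U 4 tt) + x`_1 * (U 3 tt) + x`_2 * (e * U 4 tt) + x`_3 * (e * U 3 tt) + x`_4 * (U 2 tt) + x`_5 * (e * U 2 tt))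
   & (U 3 tt = x`_0 * (U 4 tt) + x`_1 * (e * U 4 tt) + x`_2 * (e * U 4 tt) + x`_3 * (U 4 tt) + x`_4 * (U 4 tt) + x`_5 * (e * U 4 tt))].

Definition base2 (U : nat -> 'I_4 * 'I_4 -> F) : Prop :=
  [/\ (U 0 c01 = x`_0 * (U 1 c01) + x`_1 * (U 1 c02) + x`_2 * (U 1 c01) + x`_3 * (U 1 c02) + x`_4 * (U 1 c03) + x`_5 * (U 1 c03) /\
    U 0 c02 = x`_0 * (U 1 c02) + x`_1 * (U 1 c01) + x`_2 * (U 1 c03) + x`_3 * (U 1 c03) + x`_4 * (U 1 c01) + x`_5 * (U 1 c02) /\
    U 0 c03 = x`_0 * (U 1 c03) + x`_1 * (U 1 c03) + x`_2 * (U 1 c02) + x`_3 * (U 1 c01) + x`_4 * (U 1 c02) + x`_5 * (U 1 c01)),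
   (U 0 c01 = x`_0 * (U 2 c01) + x`_1 * (U 2 c01) + x`_2 * (U 3 c03) + x`_3 * (U 4 c01) + x`_4 * (U 3 c03) + x`_5 * (U 4 c01) /\
    U 0 c02 = x`_0 * (U 2 c02) + x`_1 * (U 2 c03) + x`_2 * (U 3 c01) + x`_3 * (U 4 c02) + x`_4 * (U 3 c02) + x`_5 * (U 4 c03) /\
    U 0 c03 = x`_0 * (U 2 c03) + x`_1 * (U 2 c02) + x`_2 * (U 3 c02) + x`_3 * (U 4 c03) + x`_4 * (U 3 c01) + x`_5 * (U 4 c02)),
   (U 1 c01 = x`_0 * (U 3 c01) + x`_1 * (U 4 c02) + x`_2 * (U 2 c02) + x`_3 * (U 2 c03) + x`_4 * (U 4 c03) + x`_5 * (U 3 c02) /\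
    U 1 c02 = x`_0 * (U 3 c02) + x`_1 * (U 4 c03) + x`_2 * (U 2 c03) + x`_3 * (U 2 c02) + x`_4 * (U 4 c02) + x`_5 * (U 3 c01) /\
    U 1 c03 = x`_0 * (U 3 c03) + x`_1 * (U 4 c01) + x`_2 * (U 2 c01) + x`_3 * (U 2 c01) + x`_4 * (U 4 c01) + x`_5 * (U 3 c03)),
   (U 2 c01 = x`_0 * (U 4 c01) + x`_1 * (U 3 c03) + x`_2 * (U 4 c01) + x`_3 * (U 3 c03) + x`_4 * (U 2 c01) + x`_5 * (U 2 c01) /\
    U 2 c02 = x`_0 * (U 4 c02) + x`_1 * (U 3 c01) + x`_2 * (U 4 c03) + x`_3 * (U 3 c02) + x`_4 * (U 2 c02) + x`_5 * (U 2 c03) /\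
    U 2 c03 = x`_0 * (U 4 c03) + x`_1 * (U 3 c02) + x`_2 * (U 4 c02) + x`_3 * (U 3 c01) + x`_4 * (U 2 c03) + x`_5 * (U 2 c02))
   & (U 3 c01 = x`_0 * (U 4 c01) + x`_1 * (U 4 c01) + x`_2 * (U 4 c02) + x`_3 * (U 4 c03) + x`_4 * (U 4 c02) + x`_5 * (U 4 c03) /\
    U 3 c02 = x`_0 * (U 4 c02) + x`_1 * (U 4 c03) + x`_2 * (U 4 c01) + x`_3 * (U 4 c01) + x`_4 * (U 4 c03) + x`_5 * (U 4 c02) /\
    U 3 c03 = x`_0 * (U 4 c03) + x`_1 * (U 4 c02) + x`_2 * (U 4 c03) + x`_3 * (U 4 c02) + x`_4 * (U 4 c01) + x`_5 * (U 4 c01))].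

(** Equations for the functions on four points twisted by [e]. The condition of sum zero, which
    isolates the three-dimensional irreducible, is imposed separately. *)
Definition base4 (e : F) (U : nat -> 'I_4 -> F) : Prop :=
  [/\ (U 0 o0 = x`_0 * (U 1 o0) + x`_1 * (e * U 1 o0) + x`_2 * (e * U 1 o1) + x`_3 * (U 1 o2) + x`_4 * (U 1 o1) + x`_5 * (e * U 1 o2) /\
    U 0 o1 = x`_0 * (U 1 o1) + x`_1 * (e * U 1 o2) + x`_2 * (e * U 1 o0) + x`_3 * (U 1 o0) + x`_4 * (U 1 o2) + x`_5 * (e * U 1 o1) /\
    U 0 o2 = x`_0 * (U 1 o2) + x`_1 * (e * U 1 o1) + x`_2 * (e * U 1 o2) + x`_3 * (U 1 o1) + x`_4 * (U 1 o0) + x`_5 * (e * U 1 o0) /\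
    U 0 o3 = x`_0 * (U 1 o3) + x`_1 * (e * U 1 o3) + x`_2 * (e * U 1 o3) + x`_3 * (U 1 o3) + x`_4 * (U 1 o3) + x`_5 * (e * U 1 o3)),
   (U 0 o0 = x`_0 * (U 2 o0) + x`_1 * (e * U 2 o0) + x`_2 * (U 3 o1) + x`_3 * (U 4 o2) + x`_4 * (e * U 3 o1) + x`_5 * (e * U 4 o2) /\
    U 0 o1 = x`_0 * (U 2 o1) + x`_1 * (e * U 2 o1) + x`_2 * (U 3 o2) + x`_3 * (U 4 o3) + x`_4 * (e * U 3 o2) + x`_5 * (e * U 4 o3) /\
    U 0 o2 = x`_0 * (U 2 o2) + x`_1 * (e * U 2 o3) + x`_2 * (U 3 o0) + x`_3 * (U 4 o0) + x`_4 * (e * U 3 o3) + x`_5 * (e * U 4 o1) /\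
    U 0 o3 = x`_0 * (U 2 o3) + x`_1 * (e * U 2 o2) + x`_2 * (U 3 o3) + x`_3 * (U 4 o1) + x`_4 * (e * U 3 o0) + x`_5 * (e * U 4 o0)),
   (U 1 o0 = x`_0 * (U 3 o0) + x`_1 * (U 4 o0) + x`_2 * (U 2 o2) + x`_3 * (e * U 2 o3) + x`_4 * (e * U 4 o1) + x`_5 * (e * U 3 o3) /\
    U 1 o1 = x`_0 * (U 3 o1) + x`_1 * (U 4 o2) + x`_2 * (U 2 o0) + x`_3 * (e * U 2 o0) + x`_4 * (e * U 4 o2) + x`_5 * (e * U 3 o1) /\
    U 1 o2 = x`_0 * (U 3 o2) + x`_1 * (U 4 o3) + x`_2 * (U 2 o1) + x`_3 * (e * U 2 o1) + x`_4 * (e * U 4 o3) + x`_5 * (e * U 3 o2) /\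
    U 1 o3 = x`_0 * (U 3 o3) + x`_1 * (U 4 o1) + x`_2 * (U 2 o3) + x`_3 * (e * U 2 o2) + x`_4 * (e * U 4 o0) + x`_5 * (e * U 3 o0)),
   (U 2 o0 = x`_0 * (U 4 o0) + x`_1 * (U 3 o0) + x`_2 * (e * U 4 o1) + x`_3 * (e * U 3 o3) + x`_4 * (U 2 o2) + x`_5 * (e * U 2 o3) /\
    U 2 o1 = x`_0 * (U 4 o1) + x`_1 * (U 3 o3) + x`_2 * (e * U 4 o0) + x`_3 * (e * U 3 o0) + x`_4 * (U 2 o3) + x`_5 * (e * U 2 o2) /\
    U 2 o2 = x`_0 * (U 4 o2) + x`_1 * (U 3 o1) + x`_2 * (e * U 4 o2) + x`_3 * (e * U 3 o1) + x`_4 * (U 2 o0) + x`_5 * (e * U 2 o0) /\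
    U 2 o3 = x`_0 * (U 4 o3) + x`_1 * (U 3 o2) + x`_2 * (e * U 4 o3) + x`_3 * (e * U 3 o2) + x`_4 * (U 2 o1) + x`_5 * (e * U 2 o1))
   & (U 3 o0 = x`_0 * (U 4 o0) + x`_1 * (e * U 4 o0) + x`_2 * (e * U 4 o0) + x`_3 * (U 4 o0) + x`_4 * (U 4 o0) + x`_5 * (e * U 4 o0) /\
    U 3 o1 = x`_0 * (U 4 o1) + x`_1 * (e * U 4 o1) + x`_2 * (e * U 4 o2) + x`_3 * (U 4 o3) + x`_4 * (U 4 o2) + x`_5 * (e * U 4 o3) /\
    U 3 o2 = x`_0 * (U 4 o2) + x`_1 * (e * U 4 o3) + x`_2 * (e * U 4 o1) + x`_3 * (U 4 o1) + x`_4 * (U 4 o3) + x`_5 * (e * U 4 o2) /\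
    U 3 o3 = x`_0 * (U 4 o3) + x`_1 * (e * U 4 o2) + x`_2 * (e * U 4 o3) + x`_3 * (U 4 o2) + x`_4 * (U 4 o1) + x`_5 * (e * U 4 o1))].

Ltac unfold_rel := rewrite /relval /coefs /twval /= !big_cons big_nil /= /pact /ppact /uact /= ?genE /=.

Lemma sqr1P (e : F) : e ^+ 2 = 1 -> e = 1 \/ e = -1.
Proof. by move/eqP; rewrite sqrf_eq1 => /orP[] /eqP ->; [left|right]. Qed.

Lemma base1P e U : e ^+ 2 = 1 ->
  (forall k j, (k < 5)%N -> relval x uact e U k j = 0) <-> base1 e U.
Proof.
case/sqr1P => ->; (split=> [H|[E0 E1 E2 E3 E4]];
 [split; [move: (H 0%N tt isT)|move: (H 1%N tt isT)|move: (H 2%N tt isT)|move: (H 3%N tt isT)|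
  move: (H 4%N tt isT)]; unfold_rel => Hk; lc Hk
 |case=> [|[|[|[|[|k]]]]] [] // _; unfold_rel; [lc E0|lc E1|lc E2|lc E3|lc E4]]).
Qed.

Lemma base4P e U : e ^+ 2 = 1 ->
  (forall k j, (k < 5)%N -> relval x pact e U k j = 0) <-> base4 e U.
Proof.
case/sqr1P => ->; (split=> [H|[[E00 [E01 [E02 E03]]] [E10 [E11 [E12 E13]]] [E20 [E21 [E22 E23]]]
    [E30 [E31 [E32 E33]]] [E40 [E41 [E42 E43]]]]];
 [split; (split; [|split; [|split]]);
  [ move: (H 0%N o0 isT) | move: (H 0%N o1 isT) | move: (H 0%N o2 isT) | move: (H 0%N o3 isT)
  | move: (H 1%N o0 isT) | move: (H 1%N o1 isT) | move: (H 1%N o2 isT) | move: (H 1%N o3 isT)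
  | move: (H 2%N o0 isT) | move: (H 2%N o1 isT) | move: (H 2%N o2 isT) | move: (H 2%N o3 isT)
  | move: (H 3%N o0 isT) | move: (H 3%N o1 isT) | move: (H 3%N o2 isT) | move: (H 3%N o3 isT)
  | move: (H 4%N o0 isT) | move: (H 4%N o1 isT) | move: (H 4%N o2 isT) | move: (H 4%N o3 isT) ];
  unfold_rel => Hk; lc Hk
 |case=> [|[|[|[|[|k]]]]] j // _; elim/ord4P: j; unfold_rel;
  [ lc E00 | lc E01 | lc E02 | lc E03 | lc E10 | lc E11 | lc E12 | lc E13
  | lc E20 | lc E21 | lc E22 | lc E23 | lc E30 | lc E31 | lc E32 | lc E33
  | lc E40 | lc E41 | lc E42 | lc E43 ]]).
Qed.

(* For the two-dimensional representation only the classes [c01], [c02], [c03] matter. *)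
Lemma base2P U :
  (forall s i k, U s (i, k) = U s (k, i)) ->
  (forall s, [/\ U s (o2, o3) = U s c01, U s (o1, o3) = U s c02 & U s (o1, o2) = U s c03]) ->
  (forall k j, (k < 5)%N -> relval x ppact 1 U k j = 0) -> base2 U.
Proof.
move=> sym com H.
have E s : ((U s (o0, o1) = U s c01) * (U s (o0, o2) = U s c02) * (U s (o0, o3) = U s c03) *
  (U s (o1, o0) = U s c01) * (U s (o2, o0) = U s c02) * (U s (o3, o0) = U s c03) *
  (U s (o2, o3) = U s c01) * (U s (o1, o3) = U s c02) * (U s (o1, o2) = U s c03) *
  (U s (o3, o2) = U s c01) * (U s (o3, o1) = U s c02) * (U s (o2, o1) = U s c03))%type.
  by case: (com s) => e1 e2 e3; do !split; rewrite // sym.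
split; (split; [|split]);
  [ move: (H 0%N c01 isT) | move: (H 0%N c02 isT) | move: (H 0%N c03 isT)
  | move: (H 1%N c01 isT) | move: (H 1%N c02 isT) | move: (H 1%N c03 isT)
  | move: (H 2%N c01 isT) | move: (H 2%N c02 isT) | move: (H 2%N c03 isT)
  | move: (H 3%N c01 isT) | move: (H 3%N c02 isT) | move: (H 3%N c03 isT)
  | move: (H 4%N c01 isT) | move: (H 4%N c02 isT) | move: (H 4%N c03 isT) ];
  unfold_rel; rewrite !E => Hk; lc Hk.
Qed.
End Base.

(** * Dimensions of the solution spaces *)

Lemma big4 (T : Type) (idx : T) (op : Monoid.law idx) (G : 'I_4 -> T) :
  \big[op/idx]_i G i = op (op (op (G o0) (G o1)) (G o2)) (G o3).
Proof.
rewrite !big_ord_recl big_ord0 Monoid.mulm1 !Monoid.mulmA.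
by congr (op (op (op (G _) (G _)) (G _)) (G _)); apply: val_inj.
Qed.

Section Solutions.
Variable F : fieldType.
Variable x : 6.-tuple F.
Hypothesis reg : regular_at x 4.

Lemma kernel_vector m n (L : 'M[F]_(m, n)) : (n < m)%N ->
  exists2 w : 'rV_m, w != 0 & w *m L = 0.
Proof.
move=> lt; have /rowV0Pn [w /sub_kermxP w0 nz] : kermx L != 0.
  by rewrite -mxrank_eq0 mxrank_ker subn_eq0 -ltnNge; apply: leq_ltn_trans (rank_leq_col L) lt.
by exists w.
Qed.

Definition chi (e : F) (g : 'S_4) : F := e ^+ odd_perm g.

Lemma chiM e : e ^+ 2 = 1 -> forall g h, chi e (g * h)%g = chi e g * chi e h.
Proof.
move=> e2 g h; rewrite /chi odd_permM.
by case: odd_perm; case: odd_perm; rewrite /= ?expr0 ?expr1 ?mulr1 ?mul1r // -expr2 e2.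
Qed.

Lemma chi_gen e i : chi e (gen i) = e.
Proof. by rewrite /chi; case: i => [|[|i]]; rewrite odd_tperm expr1. Qed.

Lemma chi1 e : chi e 1%g = 1. Proof. by rewrite /chi odd_perm1. Qed.

(** Functions on one point form a line; this gives a nonzero solution as well as its uniqueness up
    to scalars. *)
Lemma one_dim e : e ^+ 2 = 1 -> exists U, [/\ base1 x e U,
  exists2 s, (s < 5)%N & U s tt != 0
  & forall V, base1 x e V -> exists c, forall s, (s < 5)%N -> V s tt = c * U s tt].
Proof.
move=> e2.
have [B [H1 H2 H3]] := @regular_tables _ x unit uact (chi e) (fun _ => erefl)
  (fun _ _ _ => erefl) (chi1 e) (chiM e2) e (chi_gen e) reg.
pose T s (j : unit) := \sum_g (fun=> 1) (uact g^-1%g j) * B s g.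
exists T; split; first by apply/base1P => // k j; apply: H1.
  case: (pickP (fun s : 'I_5 => T s tt != 0)) => [s hs|T0]; first by exists s.
  have /eqP : (1 : F) = 0.
    by apply: (H2 (fun=> 1) _ tt) => s [] lt; apply/eqP/negPn/negbT/(T0 (Ordinal lt)).
  by rewrite oner_eq0.
move=> V /base1P-/(_ e2)/H3 [h hV]; exists (h tt) => s lt.
by rewrite hV // /T mulr_sumr; apply: eq_bigr => g _; rewrite /uact; ring.
Qed.

(** The functions of sum zero on four points form a space of dimension three, on which two linear
    conditions have a common nonzero zero. In use, [l1] and [l2] are the unknowns missing from a
    minor. *)
Lemma three_dim e (l1 l2 : (nat -> 'I_4 -> F) -> F) : e ^+ 2 = 1 ->
  (forall c1 c2 c3 U1 U2 U3, l1 (fun s j => c1 * U1 s j + c2 * U2 s j + c3 * U3 s j) =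
     c1 * l1 U1 + c2 * l1 U2 + c3 * l1 U3) ->
  (forall c1 c2 c3 U1 U2 U3, l2 (fun s j => c1 * U1 s j + c2 * U2 s j + c3 * U3 s j) =
     c1 * l2 U1 + c2 * l2 U2 + c3 * l2 U3) ->
  exists U, [/\ base4 x e U, forall s, U s o0 + U s o1 + U s o2 + U s o3 = 0,
    l1 U = 0 /\ l2 U = 0 & exists s j, (s < 5)%N /\ U s j != 0].
Proof.
move=> e2 lin1 lin2.
have [B [H1 H2 _]] := @regular_tables _ x _ pact (chi e) (fun j => perm1 j)
  (fun g h j => permM g h j) (chi1 e) (chiM e2) e (chi_gen e) reg.
pose tb (h : 'I_4 -> F) s j := \sum_g h (pact g^-1%g j) * B s g.
(* For [k] among [o0], [o1], [o2] these form a basis of the functions of sum zero. *)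
pose d (k j : 'I_4) : F := (j == k)%:R - (j == o3)%:R.
pose T k := tb (d k).
pose L : 'M[F]_(3, 2) := \matrix_(i < 3, j < 2)
  (if j == ord0 then l1 else l2) (T (widen_ord (isT : (3 <= 4)%N) i)).
have [w wn wL] := kernel_vector L isT.
pose i0 : 'I_3 := Ordinal (isT : (0 < 3)%N); pose i1 : 'I_3 := Ordinal (isT : (1 < 3)%N).
pose i2 : 'I_3 := Ordinal (isT : (2 < 3)%N).
have wi0 : widen_ord (isT : (3 <= 4)%N) i0 = o0 by apply: val_inj.
have wi1 : widen_ord (isT : (3 <= 4)%N) i1 = o1 by apply: val_inj.
have wi2 : widen_ord (isT : (3 <= 4)%N) i2 = o2 by apply: val_inj.
have S3 (G : 'I_3 -> F) : \sum_i G i = G i0 + G i1 + G i2.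
  rewrite !big_ord_recl big_ord0 addr0 addrA.
  by congr (G _ + G _ + G _); apply: val_inj.
pose h j := w 0 i0 * d o0 j + w 0 i1 * d o1 j + w 0 i2 * d o2 j.
pose U s j := w 0 i0 * T o0 s j + w 0 i1 * T o1 s j + w 0 i2 * T o2 s j.
have UE s j : U s j = tb h s j.
  by rewrite /U /T /tb !mulr_sumr -!big_split; apply: eq_bigr => g _; rewrite /h /=; ring.
exists U; split.
- apply/base4P => // k j lt; rewrite -(H1 h k j lt) /relval.
  by apply: eq_bigr => p _; rewrite /twval UE.
- move=> s; rewrite !UE /tb -!big_split big1 // => g _ /=; rewrite -!mulrDl.
  suff -> : h (pact g^-1%g o0) + h (pact g^-1%g o1) + h (pact g^-1%g o2) + h (pact g^-1%g o3) = 0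
    by rewrite mul0r.
  transitivity (\sum_j h (g^-1%g j)).
    by rewrite big4.
  rewrite -(reindex_inj (@perm_inj _ g^-1%g) (P := xpredT) (F := h)) big4 /=.
  rewrite /h /d /= -?(inj_eq val_inj) /=; ring.
- split; [rewrite lin1 | rewrite lin2].
    have /matrixP/(_ 0 0) := wL; rewrite !mxE S3 !mxE /= wi0 wi1 wi2 => <-; ring.
  have /matrixP/(_ 0 1) := wL; rewrite !mxE S3 !mxE /= wi0 wi1 wi2 => <-; ring.
case: (pickP (fun p : 'I_5 * 'I_4 => U p.1 p.2 != 0)) => [[s j] /= hs|U0]; first by exists s, j.
have h0 : forall j, h j = 0.
  apply: H2 => s j lt; apply/eqP/negPn/negbT; have := U0 (Ordinal lt, j); by rewrite UE.
case/eqP: wn; apply/rowP => -[[|[|[|m]]] lt] //; rewrite !mxE.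
- rewrite (_ : Ordinal lt = i0); last exact: val_inj.
  by have := h0 o0; rewrite /h /d -?(inj_eq val_inj) /= => <-; ring.
- rewrite (_ : Ordinal lt = i1); last exact: val_inj.
  by have := h0 o1; rewrite /h /d -?(inj_eq val_inj) /= => <-; ring.
rewrite (_ : Ordinal lt = i2); last exact: val_inj.
by have := h0 o2; rewrite /h /d -?(inj_eq val_inj) /= => <-; ring.
Qed.

(** The opposite bound: four solutions of sum zero come from four functions [h] in a space of
    dimension three, and a linear relation between those passes to the tables. *)
Lemma three_dim_max e (V : 'I_4 -> nat -> 'I_4 -> F) : e ^+ 2 = 1 ->
  (forall i, base4 x e (V i)) ->
  (forall i s, V i s o0 + V i s o1 + V i s o2 + V i s o3 = 0) ->
  exists c : 'I_4 -> F, (exists i, c i != 0) /\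
    forall s j, (s < 5)%N -> \sum_i c i * V i s j = 0.
Proof.
move=> e2 Vb Vs.
have [B [H1 H2 H3]] := @regular_tables _ x _ pact (chi e) (fun j => perm1 j)
  (fun g h j => permM g h j) (chi1 e) (chiM e2) e (chi_gen e) reg.
have /fin_all_exists [h hV] : forall i, exists h, forall s j, (s < 5)%N ->
    V i s j = \sum_g h (pact g^-1%g j) * B s g.
  by move=> i; apply: H3; apply/base4P.
have S4 (G : 'I_4 -> F) : \sum_i G i = G o0 + G o1 + G o2 + G o3 by rewrite big4.
(* The sum of [h i], viewed as a constant function, has the zero table, so injectivity makes it
   vanish. *)
have hs i : \sum_j h i j = 0.
  apply: (H2 (fun=> \sum_j h i j) _ o0) => s j lt.
  rewrite -[RHS](Vs i s) !hV // -!big_split; apply: eq_bigr => g _ /=.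
  rewrite -!mulrDl; congr (_ * _); rewrite (reindex_inj (@perm_inj _ g^-1%g)) S4 //.
(* Only three of the four coordinates are recorded; the last one follows from sum zero. *)
pose L : 'M[F]_(4, 3) := \matrix_(i, j) h i (widen_ord (isT : (3 <= 4)%N) j).
have [w wn wL] := kernel_vector L isT.
exists (w 0); split.
  case: (pickP (fun i => w 0 i != 0)) => [i hi|w0]; first by exists i.
  case/eqP: wn; apply/rowP => i; rewrite mxE; exact/eqP/negPn/negbT/w0.
have wk (k : 'I_3) : \sum_i w 0 i * h i (widen_ord (isT : (3 <= 4)%N) k) = 0.
  have /matrixP/(_ 0 k) := wL; rewrite !mxE => {2}<-.
  by apply: eq_bigr => i _; rewrite mxE.
have w0 : \sum_i w 0 i * h i o0 = 0.
  by rewrite -[RHS](wk ord0); apply: eq_bigr => i _; congr (_ * h _ _); apply: val_inj.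
have w1 : \sum_i w 0 i * h i o1 = 0.
  by rewrite -[RHS](wk (lift ord0 ord0)); apply: eq_bigr => i _; congr (_ * h _ _); apply: val_inj.
have w2 : \sum_i w 0 i * h i o2 = 0.
  by rewrite -[RHS](wk ord_max); apply: eq_bigr => i _; congr (_ * h _ _); apply: val_inj.
have w3 : \sum_i w 0 i * h i o3 = 0.
  transitivity (\sum_i (w 0 i * \sum_j h i j - w 0 i * h i o0 - w 0 i * h i o1 - w 0 i * h i o2)).
    by apply: eq_bigr => i _; rewrite S4; ring.
  rewrite !sumrB w0 w1 w2 !subr0; apply: big1 => i _; by rewrite hs mulr0.
move=> s j lt; under eq_bigr do rewrite hV // mulr_sumr.
rewrite exchange_big big1 // => g _ /=.
under eq_bigr do rewrite mulrA.
rewrite -mulr_suml; elim/ord4P: (pact _ _); by rewrite ?w0 ?w1 ?w2 ?w3 mul0r.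
Qed.

(** The same count for functions of sum zero on the three splittings, realized as functions of
    ordered pairs: the dimension is two, so one linear condition leaves a nonzero solution. *)
Lemma two_dim (l : (nat -> 'I_4 * 'I_4 -> F) -> F) :
  (forall c1 c2 U1 U2, l (fun s j => c1 * U1 s j + c2 * U2 s j) = c1 * l U1 + c2 * l U2) ->
  exists U, [/\ base2 x U, forall s, U s c01 + U s c02 + U s c03 = 0,
    l U = 0 & exists s, (s < 5)%N /\ (U s c01 != 0) || (U s c02 != 0)].
Proof.
move=> linl.
have [B [H1 H2 _]] := @regular_tables _ x _ ppact (chi 1)
  (fun j => let: (a, b) as j := j return ppact 1%g j = j in
     f_equal2 pair (perm1 a) (perm1 b))
  (fun g h j => f_equal2 pair (permM g h j.1) (permM g h j.2))
  (chi1 1) (chiM (expr1n F 2)) 1 (chi_gen 1) reg.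
pose tb (h : 'I_4 * 'I_4 -> F) s j := \sum_g h (ppact g^-1%g j) * B s g.
(* the three pairings of four points are recognised by the sum of two paired labels *)
pose pr (k : nat) (j : 'I_4 * 'I_4) : F :=
  if j.1 == j.2 then 0 else ((j.1 + j.2 == k) || (j.1 + j.2 == 6 - k))%N%:R.
pose d k j := pr k j - pr 3 j.
pose T k := tb (d k).
(* The shift is due to the numbering of the splittings from 1; [d 1] and [d 2] span the functions of
   sum zero. *)
pose L : 'M[F]_(2, 1) := \matrix_(i < 2, j < 1) l (T i.+1).
have [w wn wL] := kernel_vector L isT.
pose i0 : 'I_2 := Ordinal (isT : (0 < 2)%N); pose i1 : 'I_2 := Ordinal (isT : (1 < 2)%N).
have S2 (G : 'I_2 -> F) : \sum_i G i = G i0 + G i1.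
  by rewrite !big_ord_recl big_ord0 addr0; congr (G _ + G _); apply: val_inj.
pose h j := w 0 i0 * d 1%N j + w 0 i1 * d 2%N j.
pose U s j := w 0 i0 * T 1%N s j + w 0 i1 * T 2%N s j.
have UE s j : U s j = tb h s j.
  by rewrite /U /T /tb !mulr_sumr -!big_split; apply: eq_bigr => g _; rewrite /h /=; ring.
have prsym k a b : pr k (a, b) = pr k (b, a) by rewrite /pr /= eq_sym addnC.
have hsym a b : h (a, b) = h (b, a) by rewrite /h /d !(prsym _ a).
(* Permutations preserve the total 6 of the labels, so the numerical test in [pr] treats a pair and
   its complement alike after any relabelling. *)
have comp g : (pact g o0 + pact g o1 + pact g o2 + pact g o3 = 6)%N.
  transitivity (\sum_(i < 4) g i)%N.
    by rewrite big4.
  by rewrite -(reindex_inj (@perm_inj _ g) (P := xpredT) (F := fun i : 'I_4 => i : nat)) big4.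
have prc k (a b c e : 'I_4) : (k <= 6)%N -> a != b -> c != e -> (a + b + c + e = 6)%N ->
    pr k (a, b) = pr k (c, e).
  move=> k6 ab ce s; rewrite /pr /= (negbTE ab) (negbTE ce); congr (nat_of_bool _)%:R; lia.
have hc (a b c e : 'I_4) : a != b -> c != e -> (a + b + c + e = 6)%N -> h (a, b) = h (c, e).
  by move=> ab ce s; rewrite /h /d !(prc _ a b c e).
have gn g (a b : 'I_4) : a != b -> pact g a != pact g b by rewrite (inj_eq perm_inj).
have h3 (a b c e : 'I_4) : uniq [:: a; b; c; e] -> h (a, b) + h (a, c) + h (a, e) = 0.
  move=> u; rewrite /h /d /pr /=.
  have [ab ac ae] : [/\ a != b, a != c & a != e].
    by move: u; rewrite /= !inE !negb_or => /andP[/and3P[]].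
  have [bc be ce] : [/\ b != c, b != e & c != e].
    by move: u; rewrite /= !inE !negb_or => /and4P[_ /andP[] ? ? ? _].
  rewrite (negbTE ab) (negbTE ac) (negbTE ae).
  move: ab ac ae bc be ce; rewrite -?(inj_eq val_inj) {u}.
  by elim/ord4P: a; elim/ord4P: b; elim/ord4P: c; elim/ord4P: e => //= _ _ _ _ _ _; ring.
have Us s a b : U s (a, b) = U s (b, a).
  by rewrite !UE; apply: eq_bigr => g _; rewrite /ppact /= hsym.
have Uc s (a b c e : 'I_4) : uniq [:: a; b; c; e] -> U s (a, b) = U s (c, e).
  move=> u; have /word_perm [p [p0 p1 p2 p3]] := u.
  rewrite !UE; apply: eq_bigr => g _; congr (_ * _); rewrite /ppact /=.
  have := comp (p * g^-1)%g; rewrite /pact !permM p0 p1 p2 p3 => cg.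
  apply: hc => //; rewrite (inj_eq perm_inj);
  by move: u; rewrite /= !inE !negb_or => /and4P[/and3P[? ? ?] /andP[? ?] ? _].
exists U; split.
- apply: base2P => [s a b|s|k j lt]; first exact: Us.
    by split; rewrite /c01 /c02 /c03 ?(Uc s o2 o3 o0 o1) ?(Uc s o1 o3 o0 o2) ?(Uc s o1 o2 o0 o3).
  rewrite -(H1 h k j lt) /relval.
  by apply: eq_bigr => p _; rewrite /twval UE.
- move=> s; rewrite !UE /tb -!big_split big1 // => g _ /=; rewrite -!mulrDl /ppact /=.
  by rewrite h3 ?mul0r //= !inE !(inj_eq perm_inj).
- rewrite linl; have /matrixP/(_ 0 0) := wL; rewrite !mxE S2 !mxE /= => <-; ring.
case: (pickP (fun p : 'I_5 => (U p c01 != 0) || (U p c02 != 0))) => [s hs|U0].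
  by exists s; rewrite ltn_ord.
have Uz s : (s < 5)%N -> U s c01 = 0 /\ U s c02 = 0.
  by move=> lt; have := U0 (Ordinal lt) => /= /norP[/negPn/eqP -> /negPn/eqP ->].
have h0 : forall j, h j = 0.
  apply: H2 => s -[a b] lt; rewrite -/(tb h s (a, b)) -UE.
  have [z1 z2] := Uz s lt.
  have z3 : U s c03 = 0.
    have : U s c01 + U s c02 + U s c03 = 0; last by rewrite z1 z2 !add0r.
    rewrite !UE /tb -!big_split big1 // => g _ /=; rewrite -!mulrDl /ppact /=.
    by rewrite h3 ?mul0r //= !inE !(inj_eq perm_inj).
  have Uaa c : U s (c, c) = 0.
    by rewrite UE /tb big1 // => g _; rewrite /h /d /pr /ppact /= eqxx; ring.
  have z32 : U s (o3, o2) = 0 by rewrite Us (Uc s o2 o3 o0 o1).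
  have z31 : U s (o3, o1) = 0 by rewrite Us (Uc s o1 o3 o0 o2).
  have z21 : U s (o2, o1) = 0 by rewrite Us (Uc s o1 o2 o0 o3).
  by elim/ord4P: a; elim/ord4P: b; rewrite ?Uaa ?z1 ?z2 ?z3 ?z32 ?z31 ?z21 // Us
    ?Uaa ?z1 ?z2 ?z3 ?z32 ?z31 ?z21.
case/eqP: wn; apply/rowP => -[[|[|m]] lt] //; rewrite !mxE.
- rewrite (_ : Ordinal lt = i0); last exact: val_inj.
  by have := h0 c01; rewrite /h /d /pr /= => <-; ring.
rewrite (_ : Ordinal lt = i1); last exact: val_inj.
by have := h0 c02; rewrite /h /d /pr /= => <-; ring.
Qed.

End Solutions.

(** * The case x_1 + x_3 = x_2 + x_4: equations *)

Section CaseB.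
Variable F : fieldType.
Hypothesis char0 : [pchar F] =i pred0.

Lemma natF_neq0 n : n.+1%:R != 0 :> F.
Proof. by move/pcharf0P: char0 => ->. Qed.

Lemma nat_mul0 n (a : F) : n.+1%:R * a = 0 -> a = 0.
Proof. by move/eqP; rewrite mulf_eq0 (negbTE (natF_neq0 n)) => /eqP. Qed.

Lemma mul0 (a b : F) : a * b = 0 -> a = 0 \/ b = 0.
Proof. by move/eqP; rewrite mulf_eq0 => /orP[] /eqP; [left | right]. Qed.

Lemma cramer2 (a b c d u v : F) : a * u + b * v = 0 -> c * u + d * v = 0 ->
  (u != 0) || (v != 0) -> a * d - b * c = 0.
Proof.
move=> e1 e2 /orP[] nz.
  have : (a * d - b * c) * u = 0 by lc (eqD (eqZ d e1) (eqZ (- b) e2)).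
  by move/mul0 => [] // u0; rewrite u0 eqxx in nz.
have : (a * d - b * c) * v = 0 by lc (eqD (eqZ (- c) e1) (eqZ a e2)).
by move/mul0 => [] // u0; rewrite u0 eqxx in nz.
Qed.

Definition det3 (a b c d e f g h i : F) : F :=
  a * (e * i - f * h) - b * (d * i - f * g) + c * (d * h - e * g).

Lemma cramer3 (a b c d e f g h i u v w : F) :
  a * u + b * v + c * w = 0 -> d * u + e * v + f * w = 0 -> g * u + h * v + i * w = 0 ->
  [|| u != 0, v != 0 | w != 0] -> det3 a b c d e f g h i = 0.
Proof.
move=> e1 e2 e3 nz; rewrite /det3; set D := (X in X = 0).
have [Du Dv Dw] : [/\ D * u = 0, D * v = 0 & D * w = 0].
  rewrite /D; split.
  - lc (eqD (eqZ (e * i - f * h) e1) (eqD (eqZ (c * h - b * i) e2) (eqZ (b * f - c * e) e3))).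
  - lc (eqD (eqZ (f * g - d * i) e1) (eqD (eqZ (a * i - c * g) e2) (eqZ (c * d - a * f) e3))).
  lc (eqD (eqZ (d * h - e * g) e1) (eqD (eqZ (b * g - a * h) e2) (eqZ (a * e - b * d) e3))).
by case/or3P: nz => nz; [case/mul0: Du | case/mul0: Dv | case/mul0: Dw] => // z;
  rewrite z eqxx in nz.
Qed.

(** Half sums and half differences of [x_1, x_3], of [x_2, x_4] and of [x_5, x_6]; that the first
    two half sums are both [p] is the assumption of this case. *)
Variables (x : 6.-tuple F) (p r P Q R : F).
Hypothesis reg : regular_at x 4.
Hypothesis xE : x = [:: p + P; p + Q; p - P; p - Q; r + R; r - R] :> seq F.

(** The system left after eliminating the values on shapes 0, 1 and 3; the unknowns are those on
    shapes 2 and 4. Row 0 is the relation leading with shape 2, row 1 the overlap of the two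
    relations leading with shape 0. *)
Definition mtriv (i j : nat) : F :=
  match i, j with
  | 0, 0 => -2 * r + 1
  | 0, 1 => -8 * p ^+ 2 - 4 * p * r - 2 * p
  | 1, 0 => -8 * p ^+ 2 - 4 * p * r + 4 * p * P + 4 * p * Q + 2 * r * P + 2 * r * Q + 2 * p + P + Q
  | _, _ => -16 * p ^+ 3 - 32 * p ^+ 2 * r - 16 * p ^+ 2 * P + 16 * p ^+ 2 * R - 20 * p * r ^+ 2 - 16 * p * r * P + 16 * p * r * R - 4 * r ^+ 3 - 4 * r ^+ 2 * P + 4 * r ^+ 2 * R - 4 * p * P - 4 * p * Q - 2 * r * P - 2 * r * Q + p + r - Q - R
  end.

Lemma mtriv_rows U : base1 x 1 U -> forall i, (i < 2)%N ->
  mtriv i 0 * U 2%N tt + mtriv i 1 * U 4%N tt = 0.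
Proof.
move=> [E0 E1 E2 E3 E4]; rewrite xE /= in E0 E1 E2 E3 E4.
rewrite E2 E4 in E0; rewrite E4 in E1; rewrite E4 in E3.
case=> [|[|i]] // _; rewrite /mtriv.
  lc (eqZ 1 E3).
lc (eqZ (-1) (eqD E1 (eqZ (-1) E0))).
Qed.

Lemma mtriv_det : mtriv 0 0 * mtriv 1 1 - mtriv 0 1 * mtriv 1 0 = 0.
Proof.
have e2 : (1 : F) ^+ 2 = 1 by ring.
have [U [Ub [s lt nz] _]] := one_dim reg e2; have H := mtriv_rows Ub.
apply: (cramer2 (H 0%N isT) (H 1%N isT)); apply/norP => -[/negPn/eqP u2 /negPn/eqP u4].
case/eqP: nz; move: Ub => [E0 E1 E2 E3 E4].
rewrite u4 in E4; have u3 : U 3%N tt = 0 by rewrite E4; ring.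
rewrite u2 u3 u4 in E2 E1; have u1 : U 1%N tt = 0 by rewrite E2; ring.
have u0 : U 0%N tt = 0 by rewrite E1; ring.
by case: s lt => [|[|[|[|[|s]]]]].
Qed.

(** A zero matrix would leave the values on shapes 2 and 4 free, giving two independent solutions
    where only a line is allowed. *)
Lemma mtriv_neq0 : ~ [/\ mtriv 0 0 = 0, mtriv 0 1 = 0, mtriv 1 0 = 0 & mtriv 1 1 = 0].
Proof.
move=> [z00 z01 z10 z11]; rewrite /mtriv in z00 z01 z10 z11.
have e2 : (1 : F) ^+ 2 = 1 by ring.
have [U [_ _ H]] := one_dim reg e2.
pose V (a b : F) (s : nat) (j : unit) : F :=
  let u3 := (x`_0 + 1 * x`_1 + 1 * x`_2 + x`_3 + x`_4 + 1 * x`_5) * b in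
  let u1 := x`_0 * u3 + x`_1 * b + x`_2 * a + x`_3 * (1 * a) + x`_4 * (1 * b) + x`_5 * (1 * u3) in
  let u0 := x`_0 * a + x`_1 * (1 * a) + x`_2 * u3 + x`_3 * b + x`_4 * (1 * u3) + x`_5 * (1 * b) in
  nth 0 [:: u0; u1; a; u3; b] s.
have Vb a b : base1 x 1 (V a b).
  rewrite /V /base1 /= xE /=; split; [|ring|ring| |ring].
    lc (eqD (eqZ a z10) (eqZ b z11)).
  lc (eqD (eqZ a z00) (eqZ b z01)).
have [c1 h1] := H _ (Vb 1 0); have [c2 h2] := H _ (Vb 0 1).
have := (h1 2%N isT, h1 4%N isT, h2 2%N isT, h2 4%N isT); rewrite /V /= => -[[[a1 a2] a3] a4].
(* The vectors [(1, 0)] and [(0, 1)] are both multiples of the pair of values of [U], so their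
   determinant, which is 1, vanishes. *)
have : (1 : F) = 0.
  rewrite [LHS](_ : 1 = 1 * 1); last by rewrite mul1r.
  rewrite {1}a1 a4 mulrACA (mulrC (U 2%N tt)) -mulrACA -a2 mul0r //.
by move/eqP; rewrite oner_eq0.
Qed.

Definition msign (i j : nat) : F :=
  match i, j with
  | 0, 0 => -2 * R + 1
  | 0, 1 => -4 * P * Q + 4 * Q ^+ 2 - 4 * Q * R - 2 * P
  | 1, 0 => 2 * P ^+ 2 - 4 * P * Q + 2 * P * R + 2 * Q ^+ 2 - 2 * Q * R + P - Q
  | _, _ => -4 * p * P ^+ 2 + 8 * p * P * Q - 8 * p * P * R - 4 * p * Q ^+ 2 + 8 * p * Q * R - 4 * p * R ^+ 2 + 4 * r * P ^+ 2 - 8 * r * P * Q + 8 * r * P * R + 4 * r * Q ^+ 2 - 8 * r * Q * R + 4 * r * R ^+ 2 - 4 * P ^+ 3 + 8 * P ^+ 2 * Q - 12 * P ^+ 2 * R - 4 * P * Q ^+ 2 + 16 * P * Q * R - 12 * P * R ^+ 2 - 4 * Q ^+ 2 * R + 8 * Q * R ^+ 2 - 4 * R ^+ 3 - 2 * P ^+ 2 - 2 * P * R + 2 * Q ^+ 2 - 2 * Q * R + p - r - Q + R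
  end.

Lemma msign_rows U : base1 x (-1) U -> forall i, (i < 2)%N ->
  msign i 0 * U 2%N tt + msign i 1 * U 4%N tt = 0.
Proof.
move=> [E0 E1 E2 E3 E4]; rewrite xE /= in E0 E1 E2 E3 E4.
rewrite E2 E4 in E0; rewrite E4 in E1; rewrite E4 in E3.
case=> [|[|i]] // _; rewrite /msign.
  lc (eqZ 1 E3).
lc (eqZ (-1) (eqD E1 (eqZ (-1) E0))).
Qed.

Lemma msign_det : msign 0 0 * msign 1 1 - msign 0 1 * msign 1 0 = 0.
Proof.
have e2 : ((-1) : F) ^+ 2 = 1 by ring.
have [U [Ub [s lt nz] _]] := one_dim reg e2; have H := msign_rows Ub.
apply: (cramer2 (H 0%N isT) (H 1%N isT)); apply/norP => -[/negPn/eqP u2 /negPn/eqP u4].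
case/eqP: nz; move: Ub => [E0 E1 E2 E3 E4].
rewrite u4 in E4; have u3 : U 3%N tt = 0 by rewrite E4; ring.
rewrite u2 u3 u4 in E2 E1; have u1 : U 1%N tt = 0 by rewrite E2; ring.
have u0 : U 0%N tt = 0 by rewrite E1; ring.
by case: s lt => [|[|[|[|[|s]]]]].
Qed.

Lemma msign_neq0 : ~ [/\ msign 0 0 = 0, msign 0 1 = 0, msign 1 0 = 0 & msign 1 1 = 0].
Proof.
move=> [z00 z01 z10 z11]; rewrite /msign in z00 z01 z10 z11.
have e2 : ((-1) : F) ^+ 2 = 1 by ring.
have [U [_ _ H]] := one_dim reg e2.
pose V (a b : F) (s : nat) (j : unit) : F :=
  let u3 := (x`_0 + (-1) * x`_1 + (-1) * x`_2 + x`_3 + x`_4 + (-1) * x`_5) * b in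
  let u1 := x`_0 * u3 + x`_1 * b + x`_2 * a + x`_3 * ((-1) * a) + x`_4 * ((-1) * b) + x`_5 * ((-1) * u3) in
  let u0 := x`_0 * a + x`_1 * ((-1) * a) + x`_2 * u3 + x`_3 * b + x`_4 * ((-1) * u3) + x`_5 * ((-1) * b) in
  nth 0 [:: u0; u1; a; u3; b] s.
have Vb a b : base1 x (-1) (V a b).
  rewrite /V /base1 /= xE /=; split; [|ring|ring| |ring].
    lc (eqD (eqZ a z10) (eqZ b z11)).
  lc (eqD (eqZ a z00) (eqZ b z01)).
have [c1 h1] := H _ (Vb 1 0); have [c2 h2] := H _ (Vb 0 1).
have := (h1 2%N isT, h1 4%N isT, h2 2%N isT, h2 4%N isT); rewrite /V /= => -[[[a1 a2] a3] a4].
have : (1 : F) = 0.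
  rewrite [LHS](_ : 1 = 1 * 1); last by rewrite mul1r.
  rewrite {1}a1 a4 mulrACA (mulrC (U 2%N tt)) -mulrACA -a2 mul0r //.
by move/eqP; rewrite oner_eq0.
Qed.

(** Four unknowns and a solution space of dimension two: the rank must be at most two, so all three
    by three minors vanish. Sums and differences are taken as coordinates to make the matrix
    sparse. *)
Definition mtwo (i j : nat) : F :=
  match i, j with
  | 0, 0 => -2 * r + 1
  | 0, 1 => 0
  | 0, 2 => 4 * p ^+ 2 - 4 * p * r - 2 * p
  | 0, 3 => 0
  | 1, 0 => 0
  | 1, 1 => -2 * R + 1
  | 1, 2 => -6 * P * Q - 6 * Q ^+ 2
  | 1, 3 => 2 * P * Q - 2 * Q ^+ 2 - 4 * Q * R - 2 * P
  | 2, 0 => 4 * p ^+ 2 - 4 * p * r - 2 * p * P - 2 * p * Q + 2 * r * P + 2 * r * Q + 2 * p + P + Q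
  | 2, 1 => 0
  | 2, 2 => -4 * p ^+ 3 + 4 * p ^+ 2 * r - 4 * p ^+ 2 * P + 4 * p ^+ 2 * R + 4 * p * r ^+ 2 + 8 * p * r * P - 8 * p * r * R - 4 * r ^+ 3 - 4 * r ^+ 2 * P + 4 * r ^+ 2 * R + 2 * p * P + 2 * p * Q - 2 * r * P - 2 * r * Q + p + r - Q - R
  | 2, 3 => 0
  | 3, 0 => 6 * p * P + 6 * p * Q - 3 * P ^+ 2 - 6 * P * Q - 3 * Q ^+ 2
  | 3, 1 => -P ^+ 2 + 2 * P * Q + 2 * P * R - Q ^+ 2 - 2 * Q * R + P - Q
  | 3, 2 => -6 * p ^+ 2 * P - 6 * p ^+ 2 * Q - 3 * p * P ^+ 2 - 6 * p * P * Q - 3 * p * Q ^+ 2 + 6 * r ^+ 2 * P + 6 * r ^+ 2 * Q + 3 * r * P ^+ 2 + 6 * r * P * Q + 3 * r * Q ^+ 2 + 3 * P ^+ 3 - 3 * P ^+ 2 * R - 3 * P * Q ^+ 2 - 6 * P * Q * R - 6 * P * R ^+ 2 - 3 * Q ^+ 2 * R - 6 * Q * R ^+ 2 + 6 * p * P + 6 * p * Q - 3 * P ^+ 2 + 3 * Q ^+ 2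
  | _, _ => -p * P ^+ 2 + 2 * p * P * Q + 4 * p * P * R - p * Q ^+ 2 - 4 * p * Q * R - 4 * p * R ^+ 2 + r * P ^+ 2 - 2 * r * P * Q - 4 * r * P * R + r * Q ^+ 2 + 4 * r * Q * R + 4 * r * R ^+ 2 - P ^+ 3 + 2 * P ^+ 2 * Q + 3 * P ^+ 2 * R - P * Q ^+ 2 - 2 * P * Q * R - Q ^+ 2 * R - 4 * Q * R ^+ 2 - 4 * R ^+ 3 + P ^+ 2 - 2 * P * R - Q ^+ 2 - 2 * Q * R + p - r - Q + R
  end.

Definition v2 (U : nat -> 'I_4 * 'I_4 -> F) (j : nat) : F :=
  match j with
  | 0 => U 2%N c01 | 1 => U 2%N c02 - U 2%N c03 | 2 => U 4%N c01 | _ => U 4%N c02 - U 4%N c03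
  end.

Lemma mtwo_rows U : base2 x U -> (forall s, U s c01 + U s c02 + U s c03 = 0) ->
  forall i, (i < 4)%N ->
  mtwo i 0 * v2 U 0 + mtwo i 1 * v2 U 1 + mtwo i 2 * v2 U 2 + mtwo i 3 * v2 U 3 = 0.
Proof.
move=> [[E01 [E02 E03]] [E11 [E12 E13]] [E21 [E22 E23]] [E31 [E32 E33]] [E41 [E42 E43]]] H.
have D3 : U 2%N c03 = - (U 2%N c01 + U 2%N c02) by lc (H 2%N).
have R3 : U 4%N c03 = - (U 4%N c01 + U 4%N c02) by lc (H 4%N).
rewrite !xE /= in E01 E02 E03 E11 E12 E13 E21 E22 E23 E31 E32 E33 E41 E42 E43.
rewrite ?E21 ?E22 ?E23 ?E41 ?E42 ?E43 D3 R3 in E01 E02 E03 E11 E12 E13 E31 E32 E33.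
rewrite /v2 D3 R3; case=> [|[|[|[|i]]]] // _; rewrite /mtwo.
- lc (eqZ 1 E31).
- lc (eqZ 1 (eqD E32 (eqZ (-1) E33))).
- lc (eqZ (-1) (eqD E11 (eqZ (-1) E01))).
lc (eqZ (-1) (eqD (eqD E12 (eqZ (-1) E02)) (eqZ (-1) (eqD E13 (eqZ (-1) E03))))).
Qed.

(** A solution with vanishing unknown number [j4] is nonzero in the other three, which are therefore
    killed by the minor's matrix. *)
Lemma mtwo_minor i1 i2 i3 j1 j2 j3 j4 : (i1 < 4)%N -> (i2 < 4)%N -> (i3 < 4)%N ->
  perm_eq [:: j1; j2; j3; j4] (iota 0 4) ->
  det3 (mtwo i1 j1) (mtwo i1 j2) (mtwo i1 j3) (mtwo i2 j1) (mtwo i2 j2) (mtwo i2 j3)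
       (mtwo i3 j1) (mtwo i3 j2) (mtwo i3 j3) = 0.
Proof.
move=> l1 l2 l3 pj.
have [|U [Ub Us Ul [s [lt nz]]]] := @two_dim _ _ reg (fun U => v2 U j4).
  by move=> c1 c2 U1 U2; case: j4 {pj} => [|[|[|j4]]]; rewrite /v2; ring.
have H := mtwo_rows Ub Us.
have sumE i : mtwo i 0 * v2 U 0 + mtwo i 1 * v2 U 1 + mtwo i 2 * v2 U 2 + mtwo i 3 * v2 U 3 =
    mtwo i j1 * v2 U j1 + mtwo i j2 * v2 U j2 + mtwo i j3 * v2 U j3.
  transitivity (\sum_(j <- iota 0 4) mtwo i j * v2 U j).
    by rewrite !big_cons big_nil; ring.
  by rewrite -(perm_big _ pj) !big_cons big_nil /= Ul; ring.
apply: (cramer3 (u := v2 U j1) (v := v2 U j2) (w := v2 U j3)); rewrite -?sumE ?H //.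
apply/negPn/negP => /norP[/negPn/eqP z1 /norP[/negPn/eqP z2 /negPn/eqP z3]].
have z j : (j < 4)%N -> v2 U j = 0.
  move=> lj; have : j \in [:: j1; j2; j3; j4] by rewrite (perm_mem pj) mem_iota.
  by rewrite !inE => /or4P[] /eqP ->.
move: (z 0%N isT) (z 1%N isT) (z 2%N isT) (z 3%N isT); rewrite /v2 => d1 d2 r1 r2.
have d02 : U 2%N c02 = 0 by apply: (@nat_mul0 1); lc (eqD (eqD (Us 2%N) d2) (eqZ (-1) d1)).
have d03 : U 2%N c03 = 0 by rewrite d02 in d2; lc (eqZ (-1) d2).
have r02 : U 4%N c02 = 0 by apply: (@nat_mul0 1); lc (eqD (eqD (Us 4%N) r2) (eqZ (-1) r1)).
have r03 : U 4%N c03 = 0 by rewrite r02 in r2; lc (eqZ (-1) r2).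
move: Ub => [_ [E11 [E12 E13]] [E21 [E22 E23]] _ [E41 [E42 E43]]].
rewrite r1 r02 r03 in E41 E42 E43.
have u31 : U 3%N c01 = 0 by rewrite E41; ring.
have u32 : U 3%N c02 = 0 by rewrite E42; ring.
have u33 : U 3%N c03 = 0 by rewrite E43; ring.
rewrite r1 r02 r03 u31 u32 u33 d1 d02 d03 in E11 E12 E13 E21 E22 E23.
have u11 : U 1%N c01 = 0 by rewrite E21; ring.
have u12 : U 1%N c02 = 0 by rewrite E22; ring.
have u01 : U 0%N c01 = 0 by rewrite E11; ring.
have u02 : U 0%N c02 = 0 by rewrite E12; ring.
by case: s lt nz => [|[|[|[|[|s]]]]] //; rewrite ?u01 ?u02 ?u11 ?u12 ?d1 ?d02 ?u31 ?u32 ?r1 ?r02 eqxx.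
Qed.

(** Five coordinates out of six: the difference [U 2 o2 - U 2 o3] is absent because a relation
    expresses it through the others, as in [mstd_d3] and [mstds_d3]. *)
Definition v4 (U : nat -> 'I_4 -> F) (j : nat) : F :=
  match j with
  | 0 => U 2%N o0 + U 2%N o1 | 1 => U 2%N o0 - U 2%N o1
  | 2 => U 4%N o0 + U 4%N o1 | 3 => U 4%N o0 - U 4%N o1 | _ => U 4%N o2 - U 4%N o3
  end.

(** The relations express shape 3 through shape 4, then shapes 1 and 0 through shapes 2, 3 and 4; so
    the values on shapes 2 and 4 determine a solution. *)
Lemma sol4_eq0 U e : base4 x e U -> (forall s, U s o0 + U s o1 + U s o2 + U s o3 = 0) ->
  U 2%N o0 + U 2%N o1 = 0 -> U 2%N o0 - U 2%N o1 = 0 -> U 4%N o0 + U 4%N o1 = 0 -> U 4%N o0 - U 4%N o1 = 0 ->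
  U 4%N o2 - U 4%N o3 = 0 -> U 2%N o2 - U 2%N o3 = 0 ->
  forall s j, (s < 5)%N -> U s j != 0 -> False.
Proof.
move=> [_ [E10 [E11 [E12 E13]]] [E20 [E21 [E22 E23]]] _ [E40 [E41 [E42 E43]]]] H d1 d2 r1 r2 r3 d3.
have zD0 : U 2%N o0 = 0 by apply: (@nat_mul0 1); lc (eqD d1 d2).
have zD1 : U 2%N o1 = 0 by rewrite zD0 in d1; lc d1.
have zD2 : U 2%N o2 = 0.
  by apply: (@nat_mul0 1); have := H 2%N; rewrite zD0 zD1 => h; lc (eqD h d3).
have zD3 : U 2%N o3 = 0 by rewrite zD2 in d3; lc (eqZ (-1) d3).
have zR0 : U 4%N o0 = 0 by apply: (@nat_mul0 1); lc (eqD r1 r2).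
have zR1 : U 4%N o1 = 0 by rewrite zR0 in r1; lc r1.
have zR2 : U 4%N o2 = 0.
  by apply: (@nat_mul0 1); have := H 4%N; rewrite zR0 zR1 => h; lc (eqD h r3).
have zR3 : U 4%N o3 = 0 by rewrite zR2 in r3; lc (eqZ (-1) r3).
rewrite !(zR0, zR1, zR2, zR3) in E40 E41 E42 E43.
have z30 : U 3%N o0 = 0 by rewrite E40; ring.
have z31 : U 3%N o1 = 0 by rewrite E41; ring.
have z32 : U 3%N o2 = 0 by rewrite E42; ring.
have z33 : U 3%N o3 = 0 by rewrite E43; ring.
rewrite !(zR0, zR1, zR2, zR3, z30, z31, z32, z33, zD0, zD1, zD2, zD3) in E20 E21 E22 E23 E10 E11 E12 E13.
have z10 : U 1%N o0 = 0 by rewrite E20; ring.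
have z11 : U 1%N o1 = 0 by rewrite E21; ring.
have z12 : U 1%N o2 = 0 by rewrite E22; ring.
have z13 : U 1%N o3 = 0 by rewrite E23; ring.
have z00 : U 0%N o0 = 0 by rewrite E10; ring.
have z01 : U 0%N o1 = 0 by rewrite E11; ring.
have z02 : U 0%N o2 = 0 by rewrite E12; ring.
have z03 : U 0%N o3 = 0 by rewrite E13; ring.
move=> s j lt; elim/ord4P: j; case: s lt => [|[|[|[|[|s]]]]] // _; apply/negP/negPn;
by rewrite ?(zR0, zR1, zR2, zR3, z30, z31, z32, z33, zD0, zD1, zD2, zD3, z10, z11, z12, z13,
  z00, z01, z02, z03) eqxx.
Qed.

Definition mstd (i j : nat) : F :=
  match i, j with
  | 0, 0 => 2 * r + 1
  | 0, 1 => 0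
  | 0, 2 => -4 * p * r - 2 * p
  | 0, 3 => -4 * p ^+ 2
  | 0, 4 => 0
  | 1, 0 => 0
  | 1, 1 => -4 * r * R + 1
  | 1, 2 => -8 * p * P * R - 8 * p * Q * R - 8 * p * Q
  | 1, 3 => 4 * p * P * R + 4 * p * Q * R - 4 * p * Q - 4 * r * Q - 2 * P
  | 1, 4 => 4 * p * P * R - 4 * p * Q * R - 8 * p * R ^+ 2 - 4 * p * R
  | 2, 0 => -4 * p * r + 2 * r * P + 2 * r * Q + 2 * p + P + Q
  | 2, 1 => 4 * p * r * P - 4 * p * r * Q
  | 2, 2 => 8 * p ^+ 2 * P ^+ 2 - 8 * p ^+ 2 * Q ^+ 2 - 8 * p ^+ 3 + 8 * p ^+ 2 * r - 8 * p ^+ 2 * P - 8 * p ^+ 2 * R + 4 * p * r ^+ 2 + 4 * r ^+ 3 + 4 * r ^+ 2 * P - 4 * r ^+ 2 * R + 2 * r * P + 2 * r * Q - p - r + Q + R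
  | 2, 3 => -4 * p ^+ 2 * P ^+ 2 + 4 * p ^+ 2 * Q ^+ 2 - 4 * p ^+ 3 + 4 * p ^+ 2 * r - 4 * p ^+ 2 * P - 4 * p ^+ 2 * R + 8 * p * r ^+ 2 - 8 * p * r * R - 4 * p ^+ 2 + 2 * p * P - 2 * p * Q
  | 2, 4 => -4 * p ^+ 2 * P ^+ 2 + 8 * p ^+ 2 * P * Q + 8 * p ^+ 2 * P * R - 4 * p ^+ 2 * Q ^+ 2 - 8 * p ^+ 2 * Q * R + 4 * p ^+ 2 * P - 4 * p ^+ 2 * Q
  | 3, 0 => 4 * p * P + 4 * p * Q - 2 * P ^+ 2 - 4 * P * Q - 2 * Q ^+ 2
  | 3, 1 => 2 * r * P ^+ 2 - 2 * r * Q ^+ 2 + 2 * p * P - 2 * p * Q - 4 * p * R - P ^+ 2 + 2 * P * R + Q ^+ 2 + 2 * Q * R + 2 * p + P + Q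
  | 3, 2 => 4 * p * P ^+ 3 + 4 * p * P ^+ 2 * Q - 4 * p * P * Q ^+ 2 - 4 * p * Q ^+ 3 - 4 * p ^+ 2 * P - 4 * p ^+ 2 * Q - 2 * p * P ^+ 2 - 4 * p * P * Q - 8 * p * P * R - 2 * p * Q ^+ 2 - 8 * p * Q * R - 4 * r ^+ 2 * P - 4 * r ^+ 2 * Q - 2 * r * P ^+ 2 - 4 * r * P * Q - 2 * r * Q ^+ 2 + 2 * P ^+ 3 - 6 * P ^+ 2 * R - 2 * P * Q ^+ 2 - 4 * P * Q * R + 4 * P * R ^+ 2 + 2 * Q ^+ 2 * R + 4 * Q * R ^+ 2 - 2 * P ^+ 2 - 4 * P * Q - 2 * Q ^+ 2
  | 3, 3 => -2 * p * P ^+ 3 - 2 * p * P ^+ 2 * Q + 2 * p * P * Q ^+ 2 + 2 * p * Q ^+ 3 - 6 * p ^+ 2 * P - 6 * p ^+ 2 * Q - 4 * p * r * P - 4 * p * r * Q - 7 * p * P ^+ 2 - 6 * p * P * Q + 4 * p * P * R + p * Q ^+ 2 + 4 * p * Q * R + 2 * r ^+ 2 * P + 2 * r ^+ 2 * Q - 3 * r * P ^+ 2 - 2 * r * P * Q + r * Q ^+ 2 - P ^+ 3 + 3 * P ^+ 2 * R + P * Q ^+ 2 + 2 * P * Q * R - 2 * P * R ^+ 2 - Q ^+ 2 * R - 2 * Q * R ^+ 2 - 2 * p * P - 2 * p * Q + P ^+ 2 - Q ^+ 2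
  | 3, 4 => -2 * p * P ^+ 3 + 2 * p * P ^+ 2 * Q + 4 * p * P ^+ 2 * R + 2 * p * P * Q ^+ 2 - 2 * p * Q ^+ 3 - 4 * p * Q ^+ 2 * R + p * P ^+ 2 + 2 * p * P * Q + 4 * p * P * R - 3 * p * Q ^+ 2 - 4 * p * Q * R - 4 * p * R ^+ 2 - r * P ^+ 2 + 2 * r * P * Q + 4 * r * P * R - r * Q ^+ 2 - 4 * r * Q * R - 4 * r * R ^+ 2 - P ^+ 3 + 2 * P ^+ 2 * Q + 5 * P ^+ 2 * R - P * Q ^+ 2 - 6 * P * Q * R - 8 * P * R ^+ 2 + Q ^+ 2 * R + 4 * Q * R ^+ 2 + 4 * R ^+ 3 + P ^+ 2 - 2 * P * R - Q ^+ 2 - 2 * Q * R + p + r - Q - R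
  | 4, 0 => -8 * p ^+ 2 + 4 * p * P + 4 * p * Q
  | 4, 1 => 4 * p * r * P - 4 * p * r * Q + 4 * r ^+ 2 * P - 4 * r ^+ 2 * Q + 2 * r * P - 2 * r * Q
  | 4, 2 => 8 * p ^+ 2 * P ^+ 2 - 8 * p ^+ 2 * Q ^+ 2 + 8 * p * r * P ^+ 2 - 8 * p * r * Q ^+ 2 - 8 * p ^+ 3 + 8 * p ^+ 2 * r - 8 * p ^+ 2 * P - 8 * p ^+ 2 * R + 16 * p * r ^+ 2 - 16 * p * r * R + 4 * p * P ^+ 2 - 4 * p * Q ^+ 2 + 8 * p ^+ 2 - 4 * p * P + 4 * p * Q
  | 4, 3 => -4 * p ^+ 2 * P ^+ 2 + 4 * p ^+ 2 * Q ^+ 2 - 4 * p * r * P ^+ 2 + 4 * p * r * Q ^+ 2 + 4 * p ^+ 3 + 4 * p ^+ 2 * r + 4 * p ^+ 2 * P - 12 * p ^+ 2 * R + 4 * p * r ^+ 2 - 8 * p * r * P - 8 * p * r * R - 2 * p * P ^+ 2 + 2 * p * Q ^+ 2 + 4 * r ^+ 3 - 4 * r ^+ 2 * P - 4 * r ^+ 2 * R - 2 * p * P - 2 * p * Q - 2 * r * P - 2 * r * Q + p - r - Q + R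
  | _, _ => -4 * p ^+ 2 * P ^+ 2 + 8 * p ^+ 2 * P * Q + 8 * p ^+ 2 * P * R - 4 * p ^+ 2 * Q ^+ 2 - 8 * p ^+ 2 * Q * R - 4 * p * r * P ^+ 2 + 8 * p * r * P * Q + 8 * p * r * P * R - 4 * p * r * Q ^+ 2 - 8 * p * r * Q * R + 4 * p ^+ 2 * P - 4 * p ^+ 2 * Q + 4 * p * r * P - 4 * p * r * Q - 2 * p * P ^+ 2 + 4 * p * P * Q + 4 * p * P * R - 2 * p * Q ^+ 2 - 4 * p * Q * R + 2 * p * P - 2 * p * Q
  end.

Lemma mstd_d3 U : base4 x 1 U -> (forall s, U s o0 + U s o1 + U s o2 + U s o3 = 0) ->
  U 2%N o2 - U 2%N o3 = - ((-2 * r) * v4 U 1 + (-4 * p * P - 4 * p * Q) * v4 U 2 + (2 * p * P + 2 * p * Q) * v4 U 3 + (2 * p * P - 2 * p * Q - 4 * p * R - 2 * p) * v4 U 4).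
Proof.
move=> [_ _ _ [E30 [E31 [E32 E33]]] [E40 [E41 [E42 E43]]]] H.
have D3 : U 2%N o3 = - (U 2%N o0 + U 2%N o1 + U 2%N o2) by lc (H 2%N).
have R3 : U 4%N o3 = - (U 4%N o0 + U 4%N o1 + U 4%N o2) by lc (H 4%N).
rewrite !xE /= in E32 E33 E40 E41 E42 E43.
rewrite ?E40 ?E41 ?E42 ?E43 D3 R3 in E32 E33.
by rewrite /v4 D3 R3; lc (eqD E32 (eqZ (-1) E33)).
Qed.

(** In each certificate the multiple of [d3E] removes the sixth coordinate, which [v4] omits. *)
Lemma mstd_rows U : base4 x 1 U -> (forall s, U s o0 + U s o1 + U s o2 + U s o3 = 0) ->
  forall i, (i < 5)%N ->
  mstd i 0 * v4 U 0 + mstd i 1 * v4 U 1 + mstd i 2 * v4 U 2 + mstd i 3 * v4 U 3 + mstd i 4 * v4 U 4 = 0.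
Proof.
move=> Ub H; have d3E := mstd_d3 Ub H; move: Ub.
move=> [[E00 [E01 [E02 E03]]] [E10 [E11 [E12 E13]]] [E20 [E21 [E22 E23]]]
    [E30 [E31 [E32 E33]]] [E40 [E41 [E42 E43]]]].
have D3 : U 2%N o3 = - (U 2%N o0 + U 2%N o1 + U 2%N o2) by lc (H 2%N).
have R3 : U 4%N o3 = - (U 4%N o0 + U 4%N o1 + U 4%N o2) by lc (H 4%N).
rewrite !xE /= in E00 E01 E02 E03 E10 E11 E12 E13 E20 E21 E22 E23 E30 E31 E40 E41 E42 E43.
rewrite ?E20 ?E21 ?E22 ?E23 ?E40 ?E41 ?E42 ?E43 D3 R3 in E00 E01 E02 E03 E10 E11 E12 E13 E30 E31.
move: d3E; rewrite /v4 D3 R3 => d3E; case=> [|[|[|[|[|i]]]]] // _; rewrite /mstd.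
- lc (eqD (eqZ 1 (eqD E30 E31)) (eqZ (- (0)) d3E)).
- lc (eqD (eqZ 1 (eqD E30 (eqZ (-1) E31))) (eqZ (- (-2 * R)) d3E)).
- lc (eqD (eqZ (-1) (eqD (eqD E10 (eqZ (-1) E00)) (eqD E11 (eqZ (-1) E01)))) (eqZ (- (2 * p * P - 2 * p * Q)) d3E)).
- lc (eqD (eqZ (-1) (eqD (eqD E10 (eqZ (-1) E00)) (eqZ (-1) (eqD E11 (eqZ (-1) E01))))) (eqZ (- (P ^+ 2 - Q ^+ 2)) d3E)).
lc (eqD (eqZ (-1) (eqD (eqD E12 (eqZ (-1) E02)) (eqZ (-1) (eqD E13 (eqZ (-1) E03))))) (eqZ (- (2 * p * P - 2 * p * Q + 2 * r * P - 2 * r * Q + P - Q)) d3E)).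
Qed.

(** Five unknowns against three dimensions of solutions give rank at most two; the two columns left
    out are made harmless by the two conditions in [three_dim]. *)
Lemma mstd_minor i1 i2 i3 j1 j2 j3 j4 j5 : (i1 < 5)%N -> (i2 < 5)%N -> (i3 < 5)%N ->
  perm_eq [:: j1; j2; j3; j4; j5] (iota 0 5) ->
  det3 (mstd i1 j1) (mstd i1 j2) (mstd i1 j3) (mstd i2 j1) (mstd i2 j2) (mstd i2 j3)
       (mstd i3 j1) (mstd i3 j2) (mstd i3 j3) = 0.
Proof.
move=> l1 l2 l3 pj; have e2 : (1 : F) ^+ 2 = 1 by ring.
have [|| U [Ub Us [Ul1 Ul2] [s [j [lt nz]]]]] :=
    @three_dim _ _ reg _ (fun U => v4 U j4) (fun U => v4 U j5) e2.
- by move=> c1 c2 c3 U1 U2 U3; case: j4 {pj} => [|[|[|[|j4]]]]; rewrite /v4; ring.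
- by move=> c1 c2 c3 U1 U2 U3; case: j5 {pj} => [|[|[|[|j5]]]]; rewrite /v4; ring.
have H := mstd_rows Ub Us.
have sumE i : mstd i 0 * v4 U 0 + mstd i 1 * v4 U 1 + mstd i 2 * v4 U 2 + mstd i 3 * v4 U 3 +
    mstd i 4 * v4 U 4 = mstd i j1 * v4 U j1 + mstd i j2 * v4 U j2 + mstd i j3 * v4 U j3.
  transitivity (\sum_(j <- iota 0 5) mstd i j * v4 U j).
    by rewrite !big_cons big_nil; ring.
  by rewrite -(perm_big _ pj) !big_cons big_nil /= Ul1 Ul2; ring.
apply: (cramer3 (u := v4 U j1) (v := v4 U j2) (w := v4 U j3)); rewrite -?sumE ?H //.
apply/negPn/negP => /norP[/negPn/eqP z1 /norP[/negPn/eqP z2 /negPn/eqP z3]].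
have z k : (k < 5)%N -> v4 U k = 0.
  move=> lk; have : k \in [:: j1; j2; j3; j4; j5] by rewrite (perm_mem pj) mem_iota.
  by rewrite !inE => /or4P[/eqP->|/eqP->|/eqP->|/orP[] /eqP->].
have d3E : U 2%N o2 - U 2%N o3 = 0 by rewrite (mstd_d3 Ub Us) !z //; ring.
exact: (@sol4_eq0 U 1 Ub Us (z 0%N isT) (z 1%N isT) (z 2%N isT) (z 3%N isT) (z 4%N isT) d3E _ _ lt nz).
Qed.

Definition mstds (i j : nat) : F :=
  match i, j with
  | 0, 0 => 2 * R + 1
  | 0, 1 => 0
  | 0, 2 => -4 * Q * R - 2 * P
  | 0, 3 => -2 * P * Q + 2 * Q ^+ 2
  | 0, 4 => 2 * P * Q + 2 * Q ^+ 2
  | 1, 0 => 0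
  | 1, 1 => -4 * r * R + 1
  | 1, 2 => -4 * p * P + 4 * p * Q
  | 1, 3 => -2 * p * P + 2 * p * Q - 4 * p * R - 2 * p
  | 1, 4 => 8 * p * r * Q - 8 * r ^+ 2 * Q - 2 * p * P - 2 * p * Q - 4 * r * P
  | 2, 0 => 2 * P * R - 2 * Q * R + P - Q
  | 2, 1 => -4 * p * P * R + 4 * p * Q * R + 2 * P ^+ 2 * R - 2 * Q ^+ 2 * R + P ^+ 2 - Q ^+ 2
  | 2, 2 => -2 * p * P ^+ 2 + 4 * p * P * Q - 2 * p * Q ^+ 2 + 4 * p * R ^+ 2 - 2 * r * P ^+ 2 + 4 * r * P * Q - 2 * r * Q ^+ 2 - 4 * r * R ^+ 2 - 2 * P ^+ 3 + 4 * P ^+ 2 * Q + 2 * P ^+ 2 * R - 2 * P * Q ^+ 2 - 4 * P * Q * R + 4 * P * R ^+ 2 + 2 * Q ^+ 2 * R + 4 * R ^+ 3 + 2 * P * R + 2 * Q * R - p + r + Q - R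
  | 2, 3 => -p * P ^+ 2 + 2 * p * P * Q - p * Q ^+ 2 - r * P ^+ 2 + 2 * r * P * Q - 4 * r * P * R - r * Q ^+ 2 + 4 * r * Q * R - P ^+ 3 + 2 * P ^+ 2 * Q + P ^+ 2 * R - P * Q ^+ 2 - 2 * P * Q * R + 4 * P * R ^+ 2 + Q ^+ 2 * R - 4 * Q * R ^+ 2 - 2 * p * P + 2 * p * Q + P ^+ 2 - 2 * P * Q + Q ^+ 2
  | 2, 4 => 8 * p ^+ 2 * P * Q - 8 * p ^+ 2 * Q ^+ 2 - 8 * p * r * P * Q + 8 * p * r * Q ^+ 2 - 4 * p * P ^+ 2 * Q + 4 * p * Q ^+ 3 + 4 * r * P ^+ 2 * Q - 4 * r * Q ^+ 3 + 2 * p ^+ 2 * P + 2 * p ^+ 2 * Q - 4 * p * r * P - 4 * p * r * Q - 3 * p * P ^+ 2 + 6 * p * P * Q + p * Q ^+ 2 + 2 * r ^+ 2 * P + 2 * r ^+ 2 * Q - 3 * r * P ^+ 2 - 2 * r * P * Q + r * Q ^+ 2 + P ^+ 3 - P ^+ 2 * R - P * Q ^+ 2 - 2 * P * Q * R - 2 * P * R ^+ 2 - Q ^+ 2 * R - 2 * Q * R ^+ 2 - P ^+ 2 - 2 * P * Q - Q ^+ 2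
  | 3, 0 => 0
  | 3, 1 => -2 * p * P + 2 * p * Q + 2 * r * P - 2 * r * Q + P - Q
  | 3, 2 => 0
  | 3, 3 => 0
  | 3, 4 => -4 * p ^+ 3 + 12 * p ^+ 2 * r - 4 * p ^+ 2 * P - 4 * p ^+ 2 * R - 12 * p * r ^+ 2 + 8 * p * r * P + 8 * p * r * R + 4 * r ^+ 3 - 4 * r ^+ 2 * P - 4 * r ^+ 2 * R + 2 * p * P + 2 * p * Q - 2 * r * P - 2 * r * Q + p - r - Q + R
  | 4, 0 => 2 * P ^+ 2 - 4 * P * Q + 2 * Q ^+ 2
  | 4, 1 => -4 * p * P * R + 4 * p * Q * R - 8 * p * R ^+ 2 + 2 * P ^+ 2 * R + 4 * P * R ^+ 2 - 2 * Q ^+ 2 * R + 4 * Q * R ^+ 2 + 4 * p * R - P ^+ 2 + 2 * P * R + Q ^+ 2 + 2 * Q * R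
  | 4, 2 => -2 * p * P ^+ 2 + 4 * p * P * Q - 2 * p * Q ^+ 2 - 2 * r * P ^+ 2 + 4 * r * P * Q - 8 * r * P * R - 2 * r * Q ^+ 2 + 8 * r * Q * R - 2 * P ^+ 3 + 4 * P ^+ 2 * Q + 2 * P ^+ 2 * R - 2 * P * Q ^+ 2 - 4 * P * Q * R + 8 * P * R ^+ 2 + 2 * Q ^+ 2 * R - 8 * Q * R ^+ 2 + 4 * p * P - 4 * p * Q - 2 * P ^+ 2 + 4 * P * Q - 2 * Q ^+ 2
  | 4, 3 => p * P ^+ 2 - 2 * p * P * Q - 4 * p * P * R + p * Q ^+ 2 + 4 * p * Q * R - 4 * p * R ^+ 2 - 3 * r * P ^+ 2 + 6 * r * P * Q - 4 * r * P * R - 3 * r * Q ^+ 2 + 4 * r * Q * R - 4 * r * R ^+ 2 + P ^+ 3 - 2 * P ^+ 2 * Q - P ^+ 2 * R + P * Q ^+ 2 - 2 * P * Q * R + 3 * Q ^+ 2 * R - 4 * Q * R ^+ 2 + 4 * R ^+ 3 - P ^+ 2 - 2 * P * R + Q ^+ 2 - 2 * Q * R + p + r - Q - R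
  | _, _ => 8 * p ^+ 2 * P * Q - 8 * p ^+ 2 * Q ^+ 2 + 16 * p ^+ 2 * Q * R - 8 * p * r * P * Q + 8 * p * r * Q ^+ 2 - 16 * p * r * Q * R - 4 * p * P ^+ 2 * Q - 8 * p * P * Q * R + 4 * p * Q ^+ 3 - 8 * p * Q ^+ 2 * R + 4 * r * P ^+ 2 * Q + 8 * r * P * Q * R - 4 * r * Q ^+ 3 + 8 * r * Q ^+ 2 * R - 2 * p ^+ 2 * P - 10 * p ^+ 2 * Q + 4 * p * r * P + 12 * p * r * Q - 9 * p * P ^+ 2 - 2 * p * P * Q - 12 * p * P * R - p * Q ^+ 2 - 4 * p * Q * R - 2 * r ^+ 2 * P - 2 * r ^+ 2 * Q + 3 * r * P ^+ 2 + 6 * r * P * Q + 3 * r * Q ^+ 2 - P ^+ 3 + P ^+ 2 * R + P * Q ^+ 2 + 2 * P * Q * R + 2 * P * R ^+ 2 + Q ^+ 2 * R + 2 * Q * R ^+ 2 + 6 * p * P + 2 * p * Q + P ^+ 2 + 2 * P * Q + Q ^+ 2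
  end.

Lemma mstds_d3 U : base4 x (-1) U -> (forall s, U s o0 + U s o1 + U s o2 + U s o3 = 0) ->
  U 2%N o2 - U 2%N o3 = - ((-2 * R) * v4 U 1 + (4 * p * Q - 4 * r * Q - 2 * P) * v4 U 4).
Proof.
move=> [_ _ _ [E30 [E31 [E32 E33]]] [E40 [E41 [E42 E43]]]] H.
have D3 : U 2%N o3 = - (U 2%N o0 + U 2%N o1 + U 2%N o2) by lc (H 2%N).
have R3 : U 4%N o3 = - (U 4%N o0 + U 4%N o1 + U 4%N o2) by lc (H 4%N).
rewrite !xE /= in E32 E33 E40 E41 E42 E43.
rewrite ?E40 ?E41 ?E42 ?E43 D3 R3 in E32 E33.
by rewrite /v4 D3 R3; lc (eqD E32 (eqZ (-1) E33)).
Qed.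

Lemma mstds_rows U : base4 x (-1) U -> (forall s, U s o0 + U s o1 + U s o2 + U s o3 = 0) ->
  forall i, (i < 5)%N ->
  mstds i 0 * v4 U 0 + mstds i 1 * v4 U 1 + mstds i 2 * v4 U 2 + mstds i 3 * v4 U 3 + mstds i 4 * v4 U 4 = 0.
Proof.
move=> Ub H; have d3E := mstds_d3 Ub H; move: Ub.
move=> [[E00 [E01 [E02 E03]]] [E10 [E11 [E12 E13]]] [E20 [E21 [E22 E23]]]
    [E30 [E31 [E32 E33]]] [E40 [E41 [E42 E43]]]].
have D3 : U 2%N o3 = - (U 2%N o0 + U 2%N o1 + U 2%N o2) by lc (H 2%N).
have R3 : U 4%N o3 = - (U 4%N o0 + U 4%N o1 + U 4%N o2) by lc (H 4%N).
rewrite !xE /= in E00 E01 E02 E03 E10 E11 E12 E13 E20 E21 E22 E23 E30 E31 E40 E41 E42 E43.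
rewrite ?E20 ?E21 ?E22 ?E23 ?E40 ?E41 ?E42 ?E43 D3 R3 in E00 E01 E02 E03 E10 E11 E12 E13 E30 E31.
move: d3E; rewrite /v4 D3 R3 => d3E; case=> [|[|[|[|[|i]]]]] // _; rewrite /mstds.
- lc (eqD (eqZ 1 (eqD E30 E31)) (eqZ (- (0)) d3E)).
- lc (eqD (eqZ 1 (eqD E30 (eqZ (-1) E31))) (eqZ (- (-2 * r)) d3E)).
- lc (eqD (eqZ (-1) (eqD (eqD E10 (eqZ (-1) E00)) (eqD E11 (eqZ (-1) E01)))) (eqZ (- (-2 * p * P + 2 * p * Q + P ^+ 2 - Q ^+ 2)) d3E)).
- lc (eqD (eqZ (-1) (eqD (eqD E10 (eqZ (-1) E00)) (eqZ (-1) (eqD E11 (eqZ (-1) E01))))) (eqZ (- (0)) d3E)).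
lc (eqD (eqZ (-1) (eqD (eqD E12 (eqZ (-1) E02)) (eqZ (-1) (eqD E13 (eqZ (-1) E03))))) (eqZ (- (-2 * p * P + 2 * p * Q - 4 * p * R + P ^+ 2 + 2 * P * R - Q ^+ 2 + 2 * Q * R + 2 * p + P + Q)) d3E)).
Qed.

Lemma mstds_minor i1 i2 i3 j1 j2 j3 j4 j5 : (i1 < 5)%N -> (i2 < 5)%N -> (i3 < 5)%N ->
  perm_eq [:: j1; j2; j3; j4; j5] (iota 0 5) ->
  det3 (mstds i1 j1) (mstds i1 j2) (mstds i1 j3) (mstds i2 j1) (mstds i2 j2) (mstds i2 j3)
       (mstds i3 j1) (mstds i3 j2) (mstds i3 j3) = 0.
Proof.
move=> l1 l2 l3 pj; have e2 : ((-1) : F) ^+ 2 = 1 by ring.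
have [|| U [Ub Us [Ul1 Ul2] [s [j [lt nz]]]]] :=
    @three_dim _ _ reg _ (fun U => v4 U j4) (fun U => v4 U j5) e2.
- by move=> c1 c2 c3 U1 U2 U3; case: j4 {pj} => [|[|[|[|j4]]]]; rewrite /v4; ring.
- by move=> c1 c2 c3 U1 U2 U3; case: j5 {pj} => [|[|[|[|j5]]]]; rewrite /v4; ring.
have H := mstds_rows Ub Us.
have sumE i : mstds i 0 * v4 U 0 + mstds i 1 * v4 U 1 + mstds i 2 * v4 U 2 + mstds i 3 * v4 U 3 +
    mstds i 4 * v4 U 4 = mstds i j1 * v4 U j1 + mstds i j2 * v4 U j2 + mstds i j3 * v4 U j3.
  transitivity (\sum_(j <- iota 0 5) mstds i j * v4 U j).
    by rewrite !big_cons big_nil; ring.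
  by rewrite -(perm_big _ pj) !big_cons big_nil /= Ul1 Ul2; ring.
apply: (cramer3 (u := v4 U j1) (v := v4 U j2) (w := v4 U j3)); rewrite -?sumE ?H //.
apply/negPn/negP => /norP[/negPn/eqP z1 /norP[/negPn/eqP z2 /negPn/eqP z3]].
have z k : (k < 5)%N -> v4 U k = 0.
  move=> lk; have : k \in [:: j1; j2; j3; j4; j5] by rewrite (perm_mem pj) mem_iota.
  by rewrite !inE => /or4P[/eqP->|/eqP->|/eqP->|/orP[] /eqP->].
have d3E : U 2%N o2 - U 2%N o3 = 0 by rewrite (mstds_d3 Ub Us) !z //; ring.
exact: (@sol4_eq0 U (-1) Ub Us (z 0%N isT) (z 1%N isT) (z 2%N isT) (z 3%N isT) (z 4%N isT) d3E _ _ lt nz).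
Qed.

End CaseB.

(** * The case x_1 + x_3 = x_2 + x_4: solutions *)

Definition in_families (F : fieldType) (x : 6.-tuple F) : Prop :=
  (exists s : F, [/\ s != 1, s != -1 & (x : seq F) = [:: 0; 0; 0; 0; s; 0]]) \/
  (exists s : F, s != -1 /\ (x : seq F) = [:: 1; s; - s; s; - s; 0]) \/
  (exists u v : F, on_conic u v /\ (x : seq F) = [:: u; u; - v; - v; - v; u - 1]) \/
  (exists u v : F, on_conic u v /\ (x : seq F) = [:: u; v; - u; - v; - v; 1 - u]).

Ltac nzs char0 := repeat (apply/andP; split); exact: (natF_neq0 char0 _).
Ltac fld char0 := first [ring | by field; nzs char0].
Ltac lcf char0 pf := apply: (eq_lc pf); fld char0.
Ltac nonzero :=
  repeat first [assumption | apply: expf_neq0 | apply: mulf_neq0 | apply: oner_neq0].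
(** The goal is a factored form of the minor [pf]; [k] is the rational scalar between the two. *)
Ltac minor char0 pf k :=
  let h := fresh in have h := pf;
  cbv beta iota delta [det3 mtriv msign mtwo mstd mstds] in h; lcf char0 (eqZ k h).

(** * Points with too many solutions *)

Section Rank.
Variable F : fieldType.
Hypothesis char0 : [pchar F] =i pred0.
Variable x : 6.-tuple F.

Definition sel (a b c d : F) (j : 'I_4) : F :=
  match nat_of_ord j with 0 => a | 1 => b | 2 => c | _ => d end.

(* The table of a solution of the equations of [base4] whose values on the
   shapes (ab)(cd) and a(b(cd)) are [d] and [r]. *)
Definition tab4 (e : F) (d r : 'I_4 -> F) (s : nat) (j : 'I_4) : F :=
  let u3 : 'I_4 -> F := sel
    (x`_0 * r o0 + x`_1 * (e * r o0) + x`_2 * (e * r o0) + x`_3 * r o0 + x`_4 * r o0 + x`_5 * (e * r o0))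
    (x`_0 * r o1 + x`_1 * (e * r o1) + x`_2 * (e * r o2) + x`_3 * r o3 + x`_4 * r o2 + x`_5 * (e * r o3))
    (x`_0 * r o2 + x`_1 * (e * r o3) + x`_2 * (e * r o1) + x`_3 * r o1 + x`_4 * r o3 + x`_5 * (e * r o2))
    (x`_0 * r o3 + x`_1 * (e * r o2) + x`_2 * (e * r o3) + x`_3 * r o2 + x`_4 * r o1 + x`_5 * (e * r o1)) in
  let u1 : 'I_4 -> F := sel
    (x`_0 * u3 o0 + x`_1 * r o0 + x`_2 * d o2 + x`_3 * (e * d o3) + x`_4 * (e * r o1) + x`_5 * (e * u3 o3))
    (x`_0 * u3 o1 + x`_1 * r o2 + x`_2 * d o0 + x`_3 * (e * d o0) + x`_4 * (e * r o2) + x`_5 * (e * u3 o1))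
    (x`_0 * u3 o2 + x`_1 * r o3 + x`_2 * d o1 + x`_3 * (e * d o1) + x`_4 * (e * r o3) + x`_5 * (e * u3 o2))
    (x`_0 * u3 o3 + x`_1 * r o1 + x`_2 * d o3 + x`_3 * (e * d o2) + x`_4 * (e * r o0) + x`_5 * (e * u3 o0)) in
  let u0 : 'I_4 -> F := sel
    (x`_0 * d o0 + x`_1 * (e * d o0) + x`_2 * u3 o1 + x`_3 * r o2 + x`_4 * (e * u3 o1) + x`_5 * (e * r o2))
    (x`_0 * d o1 + x`_1 * (e * d o1) + x`_2 * u3 o2 + x`_3 * r o3 + x`_4 * (e * u3 o2) + x`_5 * (e * r o3))
    (x`_0 * d o2 + x`_1 * (e * d o3) + x`_2 * u3 o0 + x`_3 * r o0 + x`_4 * (e * u3 o3) + x`_5 * (e * r o1))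
    (x`_0 * d o3 + x`_1 * (e * d o2) + x`_2 * u3 o3 + x`_3 * r o1 + x`_4 * (e * u3 o0) + x`_5 * (e * r o0)) in
  match s with 0 => u0 j | 1 => u1 j | 2 => d j | 3 => u3 j | 4 => r j | _ => 0 end.

Lemma base4_tab4 (e : F) (d r : 'I_4 -> F) (U := tab4 e d r) :
  U 0%N o0 = x`_0 * (U 1%N o0) + x`_1 * (e * U 1%N o0) + x`_2 * (e * U 1%N o1) + x`_3 * (U 1%N o2) + x`_4 * (U 1%N o1) + x`_5 * (e * U 1%N o2) ->
  U 0%N o1 = x`_0 * (U 1%N o1) + x`_1 * (e * U 1%N o2) + x`_2 * (e * U 1%N o0) + x`_3 * (U 1%N o0) + x`_4 * (U 1%N o2) + x`_5 * (e * U 1%N o1) ->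
  U 0%N o2 = x`_0 * (U 1%N o2) + x`_1 * (e * U 1%N o1) + x`_2 * (e * U 1%N o2) + x`_3 * (U 1%N o1) + x`_4 * (U 1%N o0) + x`_5 * (e * U 1%N o0) ->
  U 0%N o3 = x`_0 * (U 1%N o3) + x`_1 * (e * U 1%N o3) + x`_2 * (e * U 1%N o3) + x`_3 * (U 1%N o3) + x`_4 * (U 1%N o3) + x`_5 * (e * U 1%N o3) ->
  U 2%N o0 = x`_0 * (U 4%N o0) + x`_1 * (U 3%N o0) + x`_2 * (e * U 4%N o1) + x`_3 * (e * U 3%N o3) + x`_4 * (U 2%N o2) + x`_5 * (e * U 2%N o3) ->
  U 2%N o1 = x`_0 * (U 4%N o1) + x`_1 * (U 3%N o3) + x`_2 * (e * U 4%N o0) + x`_3 * (e * U 3%N o0) + x`_4 * (U 2%N o3) + x`_5 * (e * U 2%N o2) ->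
  U 2%N o2 = x`_0 * (U 4%N o2) + x`_1 * (U 3%N o1) + x`_2 * (e * U 4%N o2) + x`_3 * (e * U 3%N o1) + x`_4 * (U 2%N o0) + x`_5 * (e * U 2%N o0) ->
  U 2%N o3 = x`_0 * (U 4%N o3) + x`_1 * (U 3%N o2) + x`_2 * (e * U 4%N o3) + x`_3 * (e * U 3%N o2) + x`_4 * (U 2%N o1) + x`_5 * (e * U 2%N o1) ->
  base4 x e U.
Proof.
by move=> E00 E01 E02 E03 E30 E31 E32 E33; split; repeat match goal with |- _ /\ _ => split end.
Qed.

(* A four-parameter family of solutions contradicts [three_dim_max]: [k] is the
   slope of the one linear condition cutting it out. *)
Lemma four_params (e k l : F) : regular_at x 4 -> e ^+ 2 = 1 ->
  (forall a r0 r1 r2 : F,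
    let d0 := a + k * (r0 - r1) in let d1 := l * a - k * (r0 - r1) in
    let d := sel d0 d1 (- d0) (- d1) in
    let r := sel r0 r1 r2 (- (r0 + r1 + r2)) in
    base4 x e (tab4 e d r) /\
    forall s, tab4 e d r s o0 + tab4 e d r s o1 + tab4 e d r s o2 + tab4 e d r s o3 = 0) ->
  False.
Proof.
move=> reg e2 H.
pose pr (i : 'I_4) (n : nat) : F := ((i : nat) == n)%:R.
have [c [[i ci] cV]] := three_dim_max reg e2
  (fun i => proj1 (H (pr i 0) (pr i 1) (pr i 2) (pr i 3)))
  (fun i => proj2 (H (pr i 0) (pr i 1) (pr i 2) (pr i 3))).
have := (cV 4%N o0 isT, cV 4%N o1 isT, cV 4%N o2 isT, cV 2%N o0 isT).
rewrite !big4 /tab4 /sel /pr /= => -[[[c1 c2] c3] c0].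
have {}c1 : c o1 = 0 by lc c1.
have {}c2 : c o2 = 0 by lc c2.
have {}c3 : c o3 = 0 by lc c3.
rewrite c1 c2 c3 in c0; have {}c0 : c o0 = 0 by lc c0.
by case/eqP: ci; elim/ord4P: i.
Qed.

Lemma coords (a b c d e f : F) : x = [:: a; b; c; d; e; f] :> seq F ->
  [/\ x`_0 = a, x`_1 = b & x`_2 = c] /\ [/\ x`_3 = d, x`_4 = e & x`_5 = f].
Proof. by move=> ->. Qed.

Ltac four_params_tac xE :=
  move=> a r0 r1 r2; cbv zeta; split;
  [ apply: base4_tab4
  | move=> [|[|[|[|[|s]]]]] ];
  cbv beta iota zeta delta [tab4 sel nat_of_ord o0 o1 o2 o3]; rewrite ?xE; fld char0.

(** A line on which the three-dimensional module has a four-parameter family of solutions. [P = 0]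
    is family (a) at [s = -1], and [P = 1] is the point [(1, 1)] excluded from both conics. *)
Lemma not_regular_e (P : F) : regular_at x 4 -> x = [:: P; P; - P; - P; -1; 0] :> seq F -> False.
Proof.
move=> reg /coords[[x0 x1 x2] [x3 x4 x5]]; apply: (@four_params 1 0 (-1) reg (expr1n _ _)); four_params_tac (x0, x1, x2, x3, x4, x5).
Qed.

(** An isolated point that survives the minors used when [p = 0]; [not_regular_g] is its counterpart
    for [P = Q], with the module twisted by the sign. *)
Lemma not_regular_g' : regular_at x 4 ->
  x = [:: 1 / 3; - (1 / 3); - (1 / 3); 1 / 3; - (2 / 3); - (1 / 3)] :> seq F -> False.
Proof.
move=> reg /coords[[x0 x1 x2] [x3 x4 x5]]; apply: (@four_params 1 1 1 reg (expr1n _ _)); four_params_tac (x0, x1, x2, x3, x4, x5).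
Qed.

Lemma not_regular_g : regular_at x 4 ->
  x = [:: 1 / 3; 1 / 3; 1 / 3; 1 / 3; - (2 / 3); 1 / 3] :> seq F -> False.
Proof.
have e2 : (-1 : F) ^+ 2 = 1 by ring.
move=> reg /coords[[x0 x1 x2] [x3 x4 x5]]; apply: (@four_params (-1) 0 1 reg e2); four_params_tac (x0, x1, x2, x3, x4, x5).
Qed.

Lemma last_factor (a b : F) n : a * b ^+ n = 0 -> a != 0 -> b = 0.
Proof. by case/mul0 => [->|/eqP]; rewrite ?eqxx // expf_eq0 => /andP[_ /eqP]. Qed.
End Rank.

Section CaseB.
Variable F : fieldType.
Hypothesis char0 : [pchar F] =i pred0.
Local Ltac lcfB pf := lcf char0 pf.
Local Ltac minorB pf k := minor char0 pf k.
Local Ltac fldB := fld char0.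

(** This case yields families (a) and (d). At each node a minor is chosen that factors into linear
    forms. All but one of these are known to be nonzero, by case distinctions made beforehand for
    this purpose; the remaining form then eliminates a variable, or nothing remains and the branch
    is contradictory. *)
Lemma caseB_p0 (x : 6.-tuple F) (r P Q R : F) : regular_at x 4 ->
  x = [:: 0 + P; 0 + Q; 0 - P; 0 - Q; r + R; r - R] :> seq F ->
  in_families x.
Proof.
move=> reg xE.
have [h|n1] := eqVneq (P + Q) 0.
{
  have {}h : Q = -P by lcfB (eqZ 1 h).
  subst Q.
  have [h|n2] := eqVneq (r + P - R) 0.
  {
    have {}h : R = r + P by lcfB (eqZ (- (1)) h).
    subst R.
    have [h|n3] := eqVneq (P) 0.
    {
      have {}h : P = 0 by lcfB (eqZ 1 h).
      subst P.
      (* Family (a) with [s = 2 * r]: at [s = 1] the matrix of the trivial module vanishes, and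
         [s = -1] lies on the line of [not_regular_e]. *)
      have [h|n] := eqVneq (2 * r) 1.
        { have {}h : r = 1 / 2 by lcfB (eqZ (1 / 2) h).
          subst r; by case: (mtriv_neq0 reg xE); cbv beta iota delta [mtriv]; split; fldB. }
      have [h|n'] := eqVneq (2 * r) (-1).
        { have {}h : r = - (1 / 2) by lcfB (eqZ (1 / 2) h).
          subst r; have {}xE : x = [:: 0; 0; - 0; - 0; -1; 0] :> seq F by rewrite xE; congr [:: _; _; _; _; _; _]; fldB.
          by case: (not_regular_e reg xE). }
      by left; exists (2 * r); split=> //; rewrite xE; congr [:: _; _; _; _; _; _]; ring.
    }
    have h : ((P) ^+ 4) * (2 * r + 1) ^+ 2 = 0 by minorB (@mstds_minor _ char0 _ _ _ _ _ _ reg xE 0%N 3%N 4%N 0%N 1%N 3%N 2%N 4%N isT isT isT isT) ((1 / 32) : F).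
    have k0 : P != 0 by apply: contra_neq n3 => hh; lcfB (eqZ 1 hh).
    have {}h : 2 * r + 1 = 0 by apply: (last_factor h); nonzero.
    move=> {k0}.
    have {}h : r = -1 / 2 by lcfB (eqZ (1 / 2) h).
    subst r.
    have h : ((P) ^+ 2) * (3 * P - 1) ^+ 1 = 0 by minorB (msign_det reg xE) ((- (1 / 48)) : F).
    have k0 : P != 0 by apply: contra_neq n3 => hh; lcfB (eqZ 1 hh).
    have {}h : 3 * P - 1 = 0 by apply: (last_factor h); nonzero.
    move=> {k0}.
    have {}h : P = 1 / 3 by lcfB (eqZ (1 / 3) h).
    subst P.
    have {}xE : x = [:: 1 / 3; - (1 / 3); - (1 / 3); 1 / 3; - (2 / 3); - (1 / 3)] :> seq F by rewrite xE; congr [:: _; _; _; _; _; _]; fldB.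
    by case: (not_regular_g' char0 reg xE).
  }
  have [h|n4] := eqVneq (2 * r - 1) 0.
  {
    have {}h : r = 1 / 2 by lcfB (eqZ (1 / 2) h).
    subst r.
    have [h|n5] := eqVneq (P) 0.
    {
      have {}h : P = 0 by lcfB (eqZ 1 h).
      subst P.
      have h : ((-R + 1 / 2) ^+ 3) * (2 * R + 1) ^+ 1 = 0 by minorB (msign_det reg xE) ((- (1 / 4)) : F).
      have k0 : -R + 1 / 2 != 0 by apply: contra_neq n2 => hh; lcfB (eqZ 1 hh).
      have {}h : 2 * R + 1 = 0 by apply: (last_factor h); nonzero.
      move=> {k0}.
      have {}h : R = -1 / 2 by lcfB (eqZ (1 / 2) h).
      subst R.
      by case: (mtriv_neq0 reg xE); cbv beta iota delta [mtriv]; split; fldB.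
    }
    have h : ((P - R + 1 / 2) ^+ 2 * (P) ^+ 1) * (2 * P - 2 * R - 1) ^+ 1 = 0 by minorB (@mstd_minor _ char0 _ _ _ _ _ _ reg xE 0%N 3%N 4%N 0%N 1%N 4%N 2%N 3%N isT isT isT isT) ((1 / 16) : F).
    have k0 : P - R + 1 / 2 != 0 by apply: contra_neq n2 => hh; lcfB (eqZ 1 hh).
    have k1 : P != 0 by apply: contra_neq n5 => hh; lcfB (eqZ 1 hh).
    have {}h : 2 * P - 2 * R - 1 = 0 by apply: (last_factor h); nonzero.
    move=> {k0 k1}.
    have {}h : R = P - 1 / 2 by lcfB (eqZ (- (1 / 2)) h).
    subst R.
    have h : ((P) ^+ 1) * (3 * P - 1) ^+ 2 = 0 by minorB (msign_det reg xE) ((- (1 / 24)) : F).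
    have k0 : P != 0 by apply: contra_neq n5 => hh; lcfB (eqZ 1 hh).
    have {}h : 3 * P - 1 = 0 by apply: (last_factor h); nonzero.
    move=> {k0}.
    have {}h : P = 1 / 3 by lcfB (eqZ (1 / 3) h).
    subst P.
    by case: (mtriv_neq0 reg xE); cbv beta iota delta [mtriv]; split; fldB.
  }
  have h : ((r + P - R) ^+ 1 * (2 * r - 1) ^+ 2) * (2 * r + 1) ^+ 1 = 0 by minorB (mtriv_det reg xE) ((1) : F).
  have k0 : r + P - R != 0 by apply: contra_neq n2 => hh; lcfB (eqZ 1 hh).
  have k1 : 2 * r - 1 != 0 by apply: contra_neq n4 => hh; lcfB (eqZ 1 hh).
  have {}h : 2 * r + 1 = 0 by apply: (last_factor h); nonzero.
  move=> {k0 k1}.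
  have {}h : r = -1 / 2 by lcfB (eqZ (1 / 2) h).
  subst r.
  have [h|n6] := eqVneq (P) 0.
  {
    have {}h : P = 0 by lcfB (eqZ 1 h).
    subst P.
    have h : ((-R - 1 / 2) ^+ 2) * (2 * R - 1) ^+ 2 = 0 by minorB (msign_det reg xE) ((1 / 2) : F).
    have k0 : -R - 1 / 2 != 0 by apply: contra_neq n2 => hh; lcfB (eqZ 1 hh).
    have {}h : 2 * R - 1 = 0 by apply: (last_factor h); nonzero.
    move=> {k0}.
    have {}h : R = 1 / 2 by lcfB (eqZ (1 / 2) h).
    subst R.
    by case: (msign_neq0 reg xE); cbv beta iota delta [msign]; split; fldB.
  }
  have [h|n7] := eqVneq (2 * R + 1) 0.
  {
    have {}h : R = -1 / 2 by lcfB (eqZ (1 / 2) h).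
    subst R.
    have h : ((P) ^+ 4) = 0 by minorB (@mstds_minor _ char0 _ _ _ _ _ _ reg xE 0%N 1%N 4%N 0%N 2%N 4%N 1%N 3%N isT isT isT isT) ((- (1 / 128)) : F).
    have k0 : P != 0 by apply: contra_neq n2 => hh; lcfB (eqZ 1 hh).
    by exfalso; move/eqP: h; apply/negP; nonzero.
  }
  have h : ((P - R - 1 / 2) ^+ 1 * (P) ^+ 2 * (2 * R + 1) ^+ 1) * (3 * P + 2 * R) ^+ 1 = 0 by minorB (@mstds_minor _ char0 _ _ _ _ _ _ reg xE 0%N 1%N 2%N 0%N 3%N 4%N 1%N 2%N isT isT isT isT) ((1 / 16) : F).
  have k0 : P - R - 1 / 2 != 0 by apply: contra_neq n2 => hh; lcfB (eqZ 1 hh).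
  have k1 : P != 0 by apply: contra_neq n6 => hh; lcfB (eqZ 1 hh).
  have k2 : 2 * R + 1 != 0 by apply: contra_neq n7 => hh; lcfB (eqZ 1 hh).
  have {}h : 3 * P + 2 * R = 0 by apply: (last_factor h); nonzero.
  move=> {k0 k1 k2}.
  have {}h : R = -3 / 2 * P by lcfB (eqZ (1 / 2) h).
  subst R.
  have h : ((5 / 2 * P - 1 / 2) ^+ 1 * (P) ^+ 2 * (-3 * P + 1) ^+ 1) = 0 by minorB (@mstds_minor _ char0 _ _ _ _ _ _ reg xE 0%N 1%N 4%N 0%N 1%N 2%N 3%N 4%N isT isT isT isT) ((1 / 32) : F).
  have k0 : 5 / 2 * P - 1 / 2 != 0 by apply: contra_neq n2 => hh; lcfB (eqZ 1 hh).
  have k1 : P != 0 by apply: contra_neq n6 => hh; lcfB (eqZ 1 hh).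
  have k2 : -3 * P + 1 != 0 by apply: contra_neq n7 => hh; lcfB (eqZ 1 hh).
  by exfalso; move/eqP: h; apply/negP; nonzero.
}
have [h|n8] := eqVneq (2 * r + 1) 0.
{
  have {}h : r = -1 / 2 by lcfB (eqZ (1 / 2) h).
  subst r.
  have [h|n9] := eqVneq (2 * Q + 2 * R - 1) 0.
  {
    have {}h : R = -Q + 1 / 2 by lcfB (eqZ (1 / 2) h).
    subst R.
    have [h|n10] := eqVneq (P - Q) 0.
    {
      have {}h : Q = P by lcfB (eqZ (- (1)) h).
      subst Q.
      have h : ((2 * P) ^+ 2) * (P - 1) ^+ 3 = 0 by minorB (@mstds_minor _ char0 _ _ _ _ _ _ reg xE 0%N 1%N 4%N 0%N 1%N 4%N 2%N 3%N isT isT isT isT) ((1 / 8) : F).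
      have k0 : 2 * P != 0 by apply: contra_neq n1 => hh; lcfB (eqZ 1 hh).
      have {}h : P - 1 = 0 by apply: (last_factor h); nonzero.
      move=> {k0}.
      have {}h : P = 1 by lcfB (eqZ 1 h).
      subst P.
      have {}xE : x = [:: 1; 1; -1; -1; -1; 0] :> seq F by rewrite xE; congr [:: _; _; _; _; _; _]; fldB.
      by case: (not_regular_e reg xE).
    }
    have h : ((P + Q) ^+ 1 * (P - Q) ^+ 1) * (P + Q - 2) ^+ 1 = 0 by minorB (@mtwo_minor _ char0 _ _ _ _ _ _ reg xE 0%N 1%N 3%N 0%N 1%N 3%N 2%N isT isT isT isT) ((- (1 / 4)) : F).
    have k0 : P + Q != 0 by apply: contra_neq n1 => hh; lcfB (eqZ 1 hh).
    have k1 : P - Q != 0 by apply: contra_neq n10 => hh; lcfB (eqZ 1 hh).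
    have {}h : P + Q - 2 = 0 by apply: (last_factor h); nonzero.
    move=> {k0 k1}.
    have {}h : Q = -P + 2 by lcfB (eqZ 1 h).
    subst Q.
    have h : ((2 * P - 2) ^+ 4) = 0 by minorB (@mstds_minor _ char0 _ _ _ _ _ _ reg xE 0%N 1%N 2%N 0%N 1%N 2%N 3%N 4%N isT isT isT isT) ((1) : F).
    have k0 : 2 * P - 2 != 0 by apply: contra_neq n10 => hh; lcfB (eqZ 1 hh).
    by exfalso; move/eqP: h; apply/negP; nonzero.
  }
  have [h|n11] := eqVneq (P - Q - 2 * R - 1) 0.
  {
    have {}h : Q = P - 2 * R - 1 by lcfB (eqZ (- (1)) h).
    subst Q.
    have h : ((2 * P - 2 * R - 1) ^+ 1) * (2 * R + 1) ^+ 4 = 0 by minorB (@mstds_minor _ char0 _ _ _ _ _ _ reg xE 0%N 1%N 2%N 0%N 1%N 2%N 3%N 4%N isT isT isT isT) ((2) : F).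
    have k0 : 2 * P - 2 * R - 1 != 0 by apply: contra_neq n1 => hh; lcfB (eqZ 1 hh).
    have {}h : 2 * R + 1 = 0 by apply: (last_factor h); nonzero.
    move=> {k0}.
    have {}h : R = -1 / 2 by lcfB (eqZ (1 / 2) h).
    subst R.
    have {}xE : x = [:: P; P; - P; - P; -1; 0] :> seq F by rewrite xE; congr [:: _; _; _; _; _; _]; fldB.
    by case: (not_regular_e reg xE).
  }
  have h : ((P + Q) ^+ 1 * (2 * Q + 2 * R - 1) ^+ 1 * (P - Q - 2 * R - 1) ^+ 1) * (2 * P - 2 * Q + 2 * R - 1) ^+ 1 = 0 by minorB (@mtwo_minor _ char0 _ _ _ _ _ _ reg xE 0%N 1%N 3%N 0%N 1%N 2%N 3%N isT isT isT isT) ((- (1 / 3)) : F).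
  have k0 : P + Q != 0 by apply: contra_neq n1 => hh; lcfB (eqZ 1 hh).
  have k1 : 2 * Q + 2 * R - 1 != 0 by apply: contra_neq n9 => hh; lcfB (eqZ 1 hh).
  have k2 : P - Q - 2 * R - 1 != 0 by apply: contra_neq n11 => hh; lcfB (eqZ 1 hh).
  have {}h : 2 * P - 2 * Q + 2 * R - 1 = 0 by apply: (last_factor h); nonzero.
  move=> {k0 k1 k2}.
  have {}h : R = -P + Q + 1 / 2 by lcfB (eqZ (1 / 2) h).
  subst R.
  have h : ((3 * P - 3 * Q - 2) ^+ 1) * (P - Q) ^+ 2 = 0 by minorB (@mtwo_minor _ char0 _ _ _ _ _ _ reg xE 0%N 1%N 3%N 0%N 1%N 3%N 2%N isT isT isT isT) ((- (1 / 12)) : F).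
  have k0 : 3 * P - 3 * Q - 2 != 0 by apply: contra_neq n11 => hh; lcfB (eqZ 1 hh).
  have {}h : P - Q = 0 by apply: (last_factor h); nonzero.
  move=> {k0}.
  have {}h : Q = P by lcfB (eqZ (- (1)) h).
  subst Q.
  have h : ((2 * P) ^+ 1) = 0 by minorB (@mstds_minor _ char0 _ _ _ _ _ _ reg xE 0%N 1%N 2%N 0%N 1%N 2%N 3%N 4%N isT isT isT isT) ((1 / 8) : F).
  have k0 : 2 * P != 0 by apply: contra_neq n1 => hh; lcfB (eqZ 1 hh).
  by exfalso; move/eqP: h; apply/negP; nonzero.
}
have [h|n12] := eqVneq (r - P + Q - R) 0.
{
  have {}h : R = r - P + Q by lcfB (eqZ (- (1)) h).
  subst R.
  have [h|n13] := eqVneq (Q) 0.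
  {
    have {}h : Q = 0 by lcfB (eqZ 1 h).
    subst Q.
    have h : ((P) ^+ 1 * (2 * r + 1) ^+ 1) * (2 * r - 1) ^+ 1 = 0 by minorB (msign_det reg xE) ((1) : F).
    have k0 : P != 0 by apply: contra_neq n1 => hh; lcfB (eqZ 1 hh).
    have k1 : 2 * r + 1 != 0 by apply: contra_neq n8 => hh; lcfB (eqZ 1 hh).
    have {}h : 2 * r - 1 = 0 by apply: (last_factor h); nonzero.
    move=> {k0 k1}.
    have {}h : r = 1 / 2 by lcfB (eqZ (1 / 2) h).
    subst r.
    have h : ((P) ^+ 2) = 0 by minorB (@mstd_minor _ char0 _ _ _ _ _ _ reg xE 0%N 1%N 2%N 0%N 1%N 2%N 3%N 4%N isT isT isT isT) ((1 / 8) : F).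
    have k0 : P != 0 by apply: contra_neq n1 => hh; lcfB (eqZ 1 hh).
    by exfalso; move/eqP: h; apply/negP; nonzero.
  }
  have [h|n14] := eqVneq (2 * r - 1) 0.
  {
    have {}h : r = 1 / 2 by lcfB (eqZ (1 / 2) h).
    subst r.
    have h : ((P + Q) ^+ 1) * (P - Q) ^+ 1 = 0 by minorB (@mstd_minor _ char0 _ _ _ _ _ _ reg xE 0%N 1%N 2%N 0%N 1%N 2%N 3%N 4%N isT isT isT isT) ((1 / 8) : F).
    have k0 : P + Q != 0 by apply: contra_neq n1 => hh; lcfB (eqZ 1 hh).
    have {}h : P - Q = 0 by apply: (last_factor h); nonzero.
    move=> {k0}.
    have {}h : Q = P by lcfB (eqZ (- (1)) h).
    subst Q.
    have h : ((2 * P) ^+ 2) = 0 by minorB (@mstd_minor _ char0 _ _ _ _ _ _ reg xE 0%N 1%N 2%N 0%N 2%N 3%N 1%N 4%N isT isT isT isT) ((1 / 8) : F).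
    have k0 : 2 * P != 0 by apply: contra_neq n1 => hh; lcfB (eqZ 1 hh).
    by exfalso; move/eqP: h; apply/negP; nonzero.
  }
  have h : ((P + Q) ^+ 2 * (2 * r + 1) ^+ 1 * (Q) ^+ 1 * (2 * r - 1) ^+ 1) * (2 * r - 3 * P + 3 * Q + 1) ^+ 1 = 0 by minorB (@mtwo_minor _ char0 _ _ _ _ _ _ reg xE 1%N 2%N 3%N 0%N 1%N 2%N 3%N isT isT isT isT) ((- (1 / 3)) : F).
  have k0 : P + Q != 0 by apply: contra_neq n1 => hh; lcfB (eqZ 1 hh).
  have k1 : 2 * r + 1 != 0 by apply: contra_neq n8 => hh; lcfB (eqZ 1 hh).
  have k2 : Q != 0 by apply: contra_neq n13 => hh; lcfB (eqZ 1 hh).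
  have k3 : 2 * r - 1 != 0 by apply: contra_neq n14 => hh; lcfB (eqZ 1 hh).
  have {}h : 2 * r - 3 * P + 3 * Q + 1 = 0 by apply: (last_factor h); nonzero.
  move=> {k0 k1 k2 k3}.
  have {}h : r = 3 / 2 * P - 3 / 2 * Q - 1 / 2 by lcfB (eqZ (1 / 2) h).
  subst r.
  have h : ((3 * P - 3 * Q) ^+ 2 * (3 * P - 3 * Q - 2) ^+ 1) * (3 * Q + 1) ^+ 1 = 0 by minorB (msign_det reg xE) ((3) : F).
  have k0 : 3 * P - 3 * Q != 0 by apply: contra_neq n8 => hh; lcfB (eqZ 1 hh).
  have k1 : 3 * P - 3 * Q - 2 != 0 by apply: contra_neq n14 => hh; lcfB (eqZ 1 hh).
  have {}h : 3 * Q + 1 = 0 by apply: (last_factor h); nonzero.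
  move=> {k0 k1}.
  have {}h : Q = -1 / 3 by lcfB (eqZ (1 / 3) h).
  subst Q.
  have h : ((P - 1 / 3) ^+ 2 * (3 * P + 1) ^+ 2) = 0 by minorB (mtriv_det reg xE) ((1 / 6) : F).
  have k0 : P - 1 / 3 != 0 by apply: contra_neq n1 => hh; lcfB (eqZ 1 hh).
  have k1 : 3 * P + 1 != 0 by apply: contra_neq n8 => hh; lcfB (eqZ 1 hh).
  by exfalso; move/eqP: h; apply/negP; nonzero.
}
have h : ((P + Q) ^+ 3 * (2 * r + 1) ^+ 1 * (r - P + Q - R) ^+ 1) * (P - Q - 2 * R - 1) ^+ 1 = 0 by minorB (@mtwo_minor _ char0 _ _ _ _ _ _ reg xE 1%N 2%N 3%N 0%N 2%N 3%N 1%N isT isT isT isT) ((1 / 6) : F).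
have k0 : P + Q != 0 by apply: contra_neq n1 => hh; lcfB (eqZ 1 hh).
have k1 : 2 * r + 1 != 0 by apply: contra_neq n8 => hh; lcfB (eqZ 1 hh).
have k2 : r - P + Q - R != 0 by apply: contra_neq n12 => hh; lcfB (eqZ 1 hh).
have {}h : P - Q - 2 * R - 1 = 0 by apply: (last_factor h); nonzero.
move=> {k0 k1 k2}.
have {}h : Q = P - 2 * R - 1 by lcfB (eqZ (- (1)) h).
subst Q.
have [h|n15] := eqVneq (2 * r - 1) 0.
{
  have {}h : r = 1 / 2 by lcfB (eqZ (1 / 2) h).
  subst r.
  have h : ((2 * P - 2 * R - 1) ^+ 1) * (2 * R - 1) ^+ 1 = 0 by minorB (@mstd_minor _ char0 _ _ _ _ _ _ reg xE 0%N 1%N 2%N 0%N 1%N 2%N 3%N 4%N isT isT isT isT) ((- (1 / 4)) : F).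
  have k0 : 2 * P - 2 * R - 1 != 0 by apply: contra_neq n1 => hh; lcfB (eqZ 1 hh).
  have {}h : 2 * R - 1 = 0 by apply: (last_factor h); nonzero.
  move=> {k0}.
  have {}h : R = 1 / 2 by lcfB (eqZ (1 / 2) h).
  subst R.
  have h : ((2 * P - 2) ^+ 2) = 0 by minorB (@mstd_minor _ char0 _ _ _ _ _ _ reg xE 0%N 1%N 2%N 0%N 2%N 3%N 1%N 4%N isT isT isT isT) ((1 / 8) : F).
  have k0 : 2 * P - 2 != 0 by apply: contra_neq n1 => hh; lcfB (eqZ 1 hh).
  by exfalso; move/eqP: h; apply/negP; nonzero.
}
have h : ((2 * r + 1) ^+ 2 * (2 * r - 1) ^+ 1) * (r + P - R - 1) ^+ 1 = 0 by minorB (mtriv_det reg xE) ((1) : F).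
have k0 : 2 * r + 1 != 0 by apply: contra_neq n8 => hh; lcfB (eqZ 1 hh).
have k1 : 2 * r - 1 != 0 by apply: contra_neq n15 => hh; lcfB (eqZ 1 hh).
have {}h : r + P - R - 1 = 0 by apply: (last_factor h); nonzero.
move=> {k0 k1}.
have {}h : R = r + P - 1 by lcfB (eqZ (- (1)) h).
subst R.
(* Since [p = 0], the parameters of family (d) are read off as [x_1 = P] and [x_2 = Q]. *)
pose u := P; pose v := 1 - 2 * r - P.
have h : ((2 * r - 1) ^+ 2 * (2 * r + 1) ^+ 2) * (v ^+ 2 - v - (u - 1) ^+ 2) ^+ 1 = 0.
  by rewrite /u /v; minorB (@mstd_minor _ char0 _ _ _ _ _ _ reg xE 0%N 1%N 3%N 0%N 1%N 3%N 2%N 4%N isT isT isT isT) ((1 / 2) : F).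
right; right; right; exists u, v; split; last first.
  by rewrite xE /u /v; congr [:: _; _; _; _; _; _]; ring.
split; first by apply: (last_factor h); rewrite mulf_neq0 ?expf_neq0.
(* The two excluded points of the conic are [r = -1/2] and [r = 1/2], which were ruled out above. *)
split=> -[hu hv]; [case/eqP: n8 | case/eqP: n15]; rewrite /u /v in hu hv; subst P.
  lc (eqZ (-1) hv).
by lcfB (eqZ (-1) hv).
Qed.

(** The same elimination pattern, now ending in family (c). *)
Lemma caseB_PQ (x : 6.-tuple F) (p r P R : F) : regular_at x 4 ->
  x = [:: p + P; p + P; p - P; p - P; r + R; r - R] :> seq F ->
  p != 0 -> in_families x.
Proof.
move=> reg xE np.
have [h|n1] := eqVneq (P) 0.
{
  have {}h : P = 0 by lcfB (eqZ 1 h).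
  subst P.
  have [h|n2] := eqVneq (2 * R - 1) 0.
  {
    have {}h : R = 1 / 2 by lcfB (eqZ (1 / 2) h).
    subst R.
    have [h|n3] := eqVneq (2 * p - 2 * r - 1) 0.
    {
      have {}h : r = p - 1 / 2 by lcfB (eqZ (- (1 / 2)) h).
      subst r.
      have h : ((p) ^+ 1) * (3 * p - 1) ^+ 2 = 0 by minorB (mtriv_det reg xE) ((- (1 / 24)) : F).
      have k0 : p != 0 by apply: contra_neq np => hh; lcfB (eqZ 1 hh).
      have {}h : 3 * p - 1 = 0 by apply: (last_factor h); nonzero.
      move=> {k0}.
      have {}h : p = 1 / 3 by lcfB (eqZ (1 / 3) h).
      subst p.
      by case: (msign_neq0 reg xE); cbv beta iota delta [msign]; split; fldB.
    }
    have h : ((p) ^+ 1 * (2 * p - 2 * r - 1) ^+ 1) * (2 * p - 2 * r + 1) ^+ 2 = 0 by minorB (@mstds_minor _ char0 _ _ _ _ _ _ reg xE 0%N 1%N 3%N 0%N 3%N 4%N 1%N 2%N isT isT isT isT) ((1 / 4) : F).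
    have k0 : p != 0 by apply: contra_neq np => hh; lcfB (eqZ 1 hh).
    have k1 : 2 * p - 2 * r - 1 != 0 by apply: contra_neq n3 => hh; lcfB (eqZ 1 hh).
    have {}h : 2 * p - 2 * r + 1 = 0 by apply: (last_factor h); nonzero.
    move=> {k0 k1}.
    have {}h : r = p + 1 / 2 by lcfB (eqZ (- (1 / 2)) h).
    subst r.
    have h : ((p) ^+ 4) = 0 by minorB (@mstd_minor _ char0 _ _ _ _ _ _ reg xE 0%N 1%N 2%N 0%N 1%N 3%N 2%N 4%N isT isT isT isT) ((- (1 / 32)) : F).
    have k0 : p != 0 by apply: contra_neq np => hh; lcfB (eqZ 1 hh).
    by exfalso; move/eqP: h; apply/negP; nonzero.
  }
  have [h|n4] := eqVneq (2 * R + 1) 0.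
  {
    have {}h : R = -1 / 2 by lcfB (eqZ (1 / 2) h).
    subst R.
    have [h|n5] := eqVneq (2 * r + 1) 0.
    {
      have {}h : r = -1 / 2 by lcfB (eqZ (1 / 2) h).
      subst r.
      have h : ((p) ^+ 4) = 0 by minorB (@mstd_minor _ char0 _ _ _ _ _ _ reg xE 0%N 2%N 3%N 0%N 1%N 3%N 2%N 4%N isT isT isT isT) ((- (1 / 64)) : F).
      have k0 : p != 0 by apply: contra_neq np => hh; lcfB (eqZ 1 hh).
      by exfalso; move/eqP: h; apply/negP; nonzero.
    }
    have [h|n6] := eqVneq (2 * p - 2 * r - 1) 0.
    {
      have {}h : r = p - 1 / 2 by lcfB (eqZ (- (1 / 2)) h).
      subst r.
      have h : ((p) ^+ 2) * (3 * p - 1) ^+ 1 = 0 by minorB (mtriv_det reg xE) ((- (1 / 48)) : F).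
      have k0 : p != 0 by apply: contra_neq np => hh; lcfB (eqZ 1 hh).
      have {}h : 3 * p - 1 = 0 by apply: (last_factor h); nonzero.
      move=> {k0}.
      have {}h : p = 1 / 3 by lcfB (eqZ (1 / 3) h).
      subst p.
      have {}xE : x = [:: 1 / 3; 1 / 3; 1 / 3; 1 / 3; - (2 / 3); 1 / 3] :> seq F by rewrite xE; congr [:: _; _; _; _; _; _]; fldB.
      by case: (not_regular_g char0 reg xE).
    }
    have h : ((p) ^+ 2 * (2 * r + 1) ^+ 1 * (2 * p - 2 * r - 1) ^+ 1) * (3 * p + 2 * r) ^+ 1 = 0 by minorB (@mstd_minor _ char0 _ _ _ _ _ _ reg xE 0%N 3%N 4%N 0%N 1%N 2%N 3%N 4%N isT isT isT isT) ((- (1 / 16)) : F).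
    have k0 : p != 0 by apply: contra_neq np => hh; lcfB (eqZ 1 hh).
    have k1 : 2 * r + 1 != 0 by apply: contra_neq n5 => hh; lcfB (eqZ 1 hh).
    have k2 : 2 * p - 2 * r - 1 != 0 by apply: contra_neq n6 => hh; lcfB (eqZ 1 hh).
    have {}h : 3 * p + 2 * r = 0 by apply: (last_factor h); nonzero.
    move=> {k0 k1 k2}.
    have {}h : r = -3 / 2 * p by lcfB (eqZ (1 / 2) h).
    subst r.
    have h : ((p) ^+ 2 * (-3 * p + 1) ^+ 1 * (5 * p - 1) ^+ 1) = 0 by minorB (@mstd_minor _ char0 _ _ _ _ _ _ reg xE 0%N 1%N 2%N 0%N 1%N 3%N 2%N 4%N isT isT isT isT) ((1 / 8) : F).
    have k0 : p != 0 by apply: contra_neq np => hh; lcfB (eqZ 1 hh).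
    have k1 : -3 * p + 1 != 0 by apply: contra_neq n5 => hh; lcfB (eqZ 1 hh).
    have k2 : 5 * p - 1 != 0 by apply: contra_neq n6 => hh; lcfB (eqZ 1 hh).
    by exfalso; move/eqP: h; apply/negP; nonzero.
  }
  have h : ((2 * R - 1) ^+ 2 * (2 * R + 1) ^+ 1) * (p - r + R) ^+ 1 = 0 by minorB (msign_det reg xE) ((1) : F).
  have k0 : 2 * R - 1 != 0 by apply: contra_neq n2 => hh; lcfB (eqZ 1 hh).
  have k1 : 2 * R + 1 != 0 by apply: contra_neq n4 => hh; lcfB (eqZ 1 hh).
  have {}h : p - r + R = 0 by apply: (last_factor h); nonzero.
  move=> {k0 k1}.
  have {}h : R = -p + r by lcfB (eqZ 1 h).
  subst R.
  have h : ((p) ^+ 1 * (-2 * p + 2 * r - 1) ^+ 3 * (-2 * p + 2 * r + 1) ^+ 1) = 0 by minorB (@mtwo_minor _ char0 _ _ _ _ _ _ reg xE 0%N 1%N 2%N 0%N 1%N 2%N 3%N isT isT isT isT) ((- (1 / 2)) : F).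
  have k0 : p != 0 by apply: contra_neq np => hh; lcfB (eqZ 1 hh).
  have k1 : -2 * p + 2 * r - 1 != 0 by apply: contra_neq n2 => hh; lcfB (eqZ 1 hh).
  have k2 : -2 * p + 2 * r + 1 != 0 by apply: contra_neq n4 => hh; lcfB (eqZ 1 hh).
  by exfalso; move/eqP: h; apply/negP; nonzero.
}
have [h|n7] := eqVneq (2 * R + 1) 0.
{
  have {}h : R = -1 / 2 by lcfB (eqZ (1 / 2) h).
  subst R.
  have [h|n8] := eqVneq (p - r - 1 / 2) 0.
  {
    have {}h : r = p - 1 / 2 by lcfB (eqZ (- (1)) h).
    subst r.
    have h : ((p) ^+ 4 * (P) ^+ 1) = 0 by minorB (@mstd_minor _ char0 _ _ _ _ _ _ reg xE 0%N 1%N 2%N 0%N 1%N 2%N 3%N 4%N isT isT isT isT) ((1 / 16) : F).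
    have k0 : p != 0 by apply: contra_neq np => hh; lcfB (eqZ 1 hh).
    have k1 : P != 0 by apply: contra_neq n1 => hh; lcfB (eqZ 1 hh).
    by exfalso; move/eqP: h; apply/negP; nonzero.
  }
  have h : ((p) ^+ 1 * (P) ^+ 1 * (p - r - 1 / 2) ^+ 1) * (-96 * p + 96 * r + 288 * P - 48) ^+ 1 = 0 by minorB (@mtwo_minor _ char0 _ _ _ _ _ _ reg xE 1%N 2%N 3%N 0%N 1%N 2%N 3%N isT isT isT isT) ((1) : F).
  have k0 : p != 0 by apply: contra_neq np => hh; lcfB (eqZ 1 hh).
  have k1 : P != 0 by apply: contra_neq n1 => hh; lcfB (eqZ 1 hh).
  have k2 : p - r - 1 / 2 != 0 by apply: contra_neq n8 => hh; lcfB (eqZ 1 hh).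
  have {}h : -96 * p + 96 * r + 288 * P - 48 = 0 by apply: (last_factor h); nonzero.
  move=> {k0 k1 k2}.
  have {}h : r = p - 3 * P + 1 / 2 by lcfB (eqZ (1 / 96) h).
  subst r.
  have h : ((P) ^+ 2 * (3 * P - 1) ^+ 1) * (p - P) ^+ 1 = 0 by minorB (@mtwo_minor _ char0 _ _ _ _ _ _ reg xE 0%N 1%N 3%N 0%N 1%N 2%N 3%N isT isT isT isT) ((- (1 / 288)) : F).
  have k0 : P != 0 by apply: contra_neq n1 => hh; lcfB (eqZ 1 hh).
  have k1 : 3 * P - 1 != 0 by apply: contra_neq n8 => hh; lcfB (eqZ 1 hh).
  have {}h : p - P = 0 by apply: (last_factor h); nonzero.
  move=> {k0 k1}.
  have {}h : P = p by lcfB (eqZ (- (1)) h).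
  subst P.
  have h : ((p) ^+ 2 * (3 * p - 1) ^+ 1) = 0 by minorB (@mtwo_minor _ char0 _ _ _ _ _ _ reg xE 0%N 1%N 2%N 0%N 1%N 2%N 3%N isT isT isT isT) ((- (1 / 96)) : F).
  have k0 : p != 0 by apply: contra_neq np => hh; lcfB (eqZ 1 hh).
  have k1 : 3 * p - 1 != 0 by apply: contra_neq n8 => hh; lcfB (eqZ 1 hh).
  by exfalso; move/eqP: h; apply/negP; nonzero.
}
have [h|n9] := eqVneq (2 * p + r - R) 0.
{
  have {}h : R = 2 * p + r by lcfB (eqZ (- (1)) h).
  subst R.
  have [h|n10] := eqVneq (3 * p + P) 0.
  {
    have {}h : P = -3 * p by lcfB (eqZ 1 h).
    subst P.
    have h : ((p) ^+ 2 * (4 * p + 2 * r + 1) ^+ 3) = 0 by minorB (@mstds_minor _ char0 _ _ _ _ _ _ reg xE 0%N 1%N 2%N 0%N 2%N 3%N 1%N 4%N isT isT isT isT) ((- (1 / 12)) : F).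
    have k0 : p != 0 by apply: contra_neq np => hh; lcfB (eqZ 1 hh).
    have k1 : 4 * p + 2 * r + 1 != 0 by apply: contra_neq n7 => hh; lcfB (eqZ 1 hh).
    by exfalso; move/eqP: h; apply/negP; nonzero.
  }
  have h : ((p) ^+ 1 * (P) ^+ 2 * (4 * p + 2 * r + 1) ^+ 2 * (3 * p + P) ^+ 1) * (2 * p - 2 * r - 1) ^+ 1 = 0 by minorB (@mstds_minor _ char0 _ _ _ _ _ _ reg xE 0%N 1%N 2%N 2%N 3%N 4%N 0%N 1%N isT isT isT isT) ((1 / 8) : F).
  have k0 : p != 0 by apply: contra_neq np => hh; lcfB (eqZ 1 hh).
  have k1 : P != 0 by apply: contra_neq n1 => hh; lcfB (eqZ 1 hh).
  have k2 : 4 * p + 2 * r + 1 != 0 by apply: contra_neq n7 => hh; lcfB (eqZ 1 hh).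
  have k3 : 3 * p + P != 0 by apply: contra_neq n10 => hh; lcfB (eqZ 1 hh).
  have {}h : 2 * p - 2 * r - 1 = 0 by apply: (last_factor h); nonzero.
  move=> {k0 k1 k2 k3}.
  have {}h : r = p - 1 / 2 by lcfB (eqZ (- (1 / 2)) h).
  subst r.
  have h : ((p) ^+ 5) * (3 * p + P - 1) ^+ 1 = 0 by minorB (@mstds_minor _ char0 _ _ _ _ _ _ reg xE 0%N 1%N 2%N 0%N 2%N 3%N 1%N 4%N isT isT isT isT) ((1 / 2592) : F).
  have k0 : p != 0 by apply: contra_neq np => hh; lcfB (eqZ 1 hh).
  have {}h : 3 * p + P - 1 = 0 by apply: (last_factor h); nonzero.
  move=> {k0}.
  have {}h : P = -3 * p + 1 by lcfB (eqZ 1 h).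
  subst P.
  have h : ((p) ^+ 2 * (-3 * p + 1) ^+ 2) = 0 by minorB (mtriv_det reg xE) ((- (1 / 96)) : F).
  have k0 : p != 0 by apply: contra_neq np => hh; lcfB (eqZ 1 hh).
  have k1 : -3 * p + 1 != 0 by apply: contra_neq n1 => hh; lcfB (eqZ 1 hh).
  by exfalso; move/eqP: h; apply/negP; nonzero.
}
have h : ((P) ^+ 3 * (2 * R + 1) ^+ 1 * (2 * p + r - R) ^+ 1) * (2 * p - 2 * r - 1) ^+ 1 = 0 by minorB (@mtwo_minor _ char0 _ _ _ _ _ _ reg xE 1%N 2%N 3%N 0%N 2%N 3%N 1%N isT isT isT isT) ((1 / 48) : F).
have k0 : P != 0 by apply: contra_neq n1 => hh; lcfB (eqZ 1 hh).
have k1 : 2 * R + 1 != 0 by apply: contra_neq n7 => hh; lcfB (eqZ 1 hh).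
have k2 : 2 * p + r - R != 0 by apply: contra_neq n9 => hh; lcfB (eqZ 1 hh).
have {}h : 2 * p - 2 * r - 1 = 0 by apply: (last_factor h); nonzero.
move=> {k0 k1 k2}.
have {}h : r = p - 1 / 2 by lcfB (eqZ (- (1 / 2)) h).
subst r.
have h : ((p) ^+ 1 * (P) ^+ 1 * (2 * R + 1) ^+ 3) * (2 * P + 2 * R - 1) ^+ 1 = 0 by minorB (@mstds_minor _ char0 _ _ _ _ _ _ reg xE 0%N 1%N 2%N 0%N 2%N 4%N 1%N 3%N isT isT isT isT) ((1 / 2) : F).
have k0 : p != 0 by apply: contra_neq np => hh; lcfB (eqZ 1 hh).
have k1 : P != 0 by apply: contra_neq n1 => hh; lcfB (eqZ 1 hh).
have k2 : 2 * R + 1 != 0 by apply: contra_neq n7 => hh; lcfB (eqZ 1 hh).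
have {}h : 2 * P + 2 * R - 1 = 0 by apply: (last_factor h); nonzero.
move=> {k0 k1 k2}.
have {}h : R = -P + 1 / 2 by lcfB (eqZ (1 / 2) h).
subst R.
(* Read off from [x_1 = u] and [x_3 = - v]. *)
pose u := p + P; pose v := P - p.
have h : (P * p * (P - 1) ^+ 2) * (v ^+ 2 - v - (u - 1) ^+ 2) ^+ 1 = 0.
  by rewrite /u /v; minorB (@mstd_minor _ char0 _ _ _ _ _ _ reg xE 0%N 1%N 3%N 0%N 1%N 4%N 2%N 3%N isT isT isT isT) ((1 / 32) : F).
have k : P - 1 != 0 by apply: contra_neq n7 => hh; lcfB (eqZ (- (2)) hh).
right; right; left; exists u, v; split; last first.
  by rewrite xE /u /v; congr [:: _; _; _; _; _; _]; fldB.
split; first by apply: (last_factor h); rewrite !mulf_neq0 ?expf_neq0.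
(* Here [P] is the mean of [u] and [v], so the excluded points are [P = 1] and [P = 0]. *)
split=> -[hu hv]; rewrite /u /v in hu hv.
  by case/eqP: k; lcfB (eqD (eqZ (1 / 2) hu) (eqZ (1 / 2) hv)).
by case/eqP: n1; lcfB (eqD (eqZ (1 / 2) hu) (eqZ (1 / 2) hv)).
Qed.

(** Only the Poisson operad remains: two minors force [p = 1/3] and [R = -1/6]. It is the member
    [s = 1/3] of family (b), the one place where that family satisfies [x_1 + x_3 = x_2 + x_4]. *)
Lemma caseB_gen (x : 6.-tuple F) (p R : F) : regular_at x 4 ->
  x = [:: p + (R + 5 / 6); p + (- R - 1 / 6); p - (R + 5 / 6); p - (- R - 1 / 6); p - 1 / 2 + R; p - 1 / 2 - R] :> seq F ->
  p != 0 -> 2 * R + 1 != 0 -> in_families x.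
Proof.
move=> reg xE np nR.
have h : ((p) ^+ 2) * (3 * p - 1) ^+ 1 = 0 by minorB (mtriv_det reg xE) ((- (1 / 24)) : F).
have k0 : p != 0 by apply: contra_neq np => hh; lcfB (eqZ 1 hh).
have {}h : 3 * p - 1 = 0 by apply: (last_factor h); nonzero.
move=> {k0}.
have {}h : p = 1 / 3 by lcfB (eqZ (1 / 3) h).
subst p.
have h : (1) * (-16 / 81 * R - 8 / 243) ^+ 1 = 0 by minorB (@mstd_minor _ char0 _ _ _ _ _ _ reg xE 0%N 1%N 2%N 0%N 1%N 2%N 3%N 4%N isT isT isT isT) ((1) : F).
have {}h : -16 / 81 * R - 8 / 243 = 0 by apply: (last_factor h); nonzero.
have {}h : R = -1 / 6 by lcfB (eqZ (- (81 / 16)) h).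
subst R.
right; left; exists (1 / 3); split; last first.
  by rewrite xE; congr [:: _; _; _; _; _; _]; fldB.
rewrite -subr_eq0 opprK (_ : 1 / 3 + 1 = 4 / 3); last by fldB.
by rewrite mulf_neq0 ?invr_eq0 ?(natF_neq0 char0).
Qed.

Lemma caseB (x : 6.-tuple F) (p r P Q R : F) : regular_at x 4 ->
  x = [:: p + P; p + Q; p - P; p - Q; r + R; r - R] :> seq F -> in_families x.
Proof.
move=> reg xE.
have [p0|np] := eqVneq p 0; first by subst p; apply: (caseB_p0 reg xE).
have [h|nPQ] := eqVneq (P - Q) 0.
  have {}h : Q = P by lc (eqZ (-1) h).
  by subst Q; apply: (caseB_PQ reg xE).
(* With [p] and [P - Q] nonzero, three minors in turn have a single undecided linear factor; they
   determine [P], [r] and [Q]. *)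
have h : (p ^+ 4 * (P - Q)) * (P - Q - 2 * R - 1) ^+ 1 = 0.
  by minorB (@mstd_minor _ char0 _ _ _ _ _ _ reg xE 0%N 1%N 2%N 1%N 3%N 4%N 0%N 2%N isT isT isT isT) ((- (1 / 16)) : F).
have {}h : P - Q - 2 * R - 1 = 0 by apply: (last_factor h); rewrite mulf_neq0 ?expf_neq0.
have {}h : P = Q + 2 * R + 1 by lc h.
subst P.
have nR : 2 * R + 1 != 0 by apply: contra_neq nPQ => hh; lc hh.
have h : (p * (2 * R + 1) ^+ 4) * (2 * p - 2 * r - 1) ^+ 1 = 0.
  by minorB (@mstds_minor _ char0 _ _ _ _ _ _ reg xE 1%N 3%N 4%N 0%N 1%N 2%N 3%N 4%N isT isT isT isT) ((- (1 / 8)) : F).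
have {}h : 2 * p - 2 * r - 1 = 0 by apply: (last_factor h); rewrite mulf_neq0 ?expf_neq0.
have {}h : r = p - 1 / 2 by lcfB (eqZ (- (1 / 2)) h).
subst r.
have h : (p ^+ 4 * (2 * R + 1)) * (6 * Q + 6 * R + 1) ^+ 1 = 0.
  by minorB (@mstd_minor _ char0 _ _ _ _ _ _ reg xE 0%N 1%N 2%N 1%N 2%N 3%N 0%N 4%N isT isT isT isT) ((- (1 / 16)) : F).
have {}h : 6 * Q + 6 * R + 1 = 0 by apply: (last_factor h); rewrite mulf_neq0 ?expf_neq0.
have {}h : Q = - R - 1 / 6 by lcfB (eqZ (1 / 6) h).
subst Q; apply: (@caseB_gen x p R reg) => //.
by rewrite xE; congr [:: _; _; _; _; _; _]; fldB.
Qed.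
End CaseB.

(** * The case x_1 + x_3 <> x_2 + x_4: equations *)

Section Polarized.
Variable F : fieldType.
Hypothesis char0 : [pchar F] =i pred0.
Variables (x : 6.-tuple F) (p q r P Q R : F).
Hypothesis reg : regular_at x 4.
Hypothesis xE : x = [:: p + P; q + Q; p - P; q - Q; r + R; r - R] :> seq F.

(** The right-hand side of (LR) as a map from right combs to left combs, on the isotypic components
    for [S_3]: a two by two matrix, then the scalars [nT], the sum of the [x_i], and [nS], their sum
    with the signs of the permutations. Adding the products with commutative and anticommutative
    outer operation gives twice a right comb, subtracting gives twice a left comb; this explains the
    factors [1 - n] and [1 + n] below. *)
Definition n11 : F := 2 * r - p - q.
Definition n12 : F := 3 * (p - q).
Definition n21 : F := - (P + Q).
Definition n22 : F := 2 * R - P + Q.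
Definition nT : F := 2 * (p + q + r).
Definition nS : F := 2 * (P - Q + R).

(* The relation (LR) for the operations ab + ba and ab - ba, one copy of it for
   each isotypic component of the regular module of S_3. In [relV cl ll cc lc],
   as in [relT] and [relS], the first letter is the outer operation, the second
   one the inner operation: c for commutative, l for anticommutative. *)
Definition relT (cc lc : F) : Prop := (1 - nT) * cc = (1 + nT) * lc.
Definition relS (cl ll : F) : Prop := (1 - nS) * cl = (1 + nS) * ll.
Definition relV (cl ll cc lc : F) : Prop :=
  (1 - n11) * cc - (1 + n11) * lc = n12 * (cl + ll) /\
  (1 - n22) * cl - (1 + n22) * ll = n21 * (cc + lc).

(** Values on polarized products. The sign patterns on shapes 0, 1, 3, 4 encode the outer and the
    middle operation: [y1] has both commutative, [y3] an anticommutative outer one, [y4] an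
    anticommutative middle one, [y5] both anticommutative. [y2] belongs to [(ab)(cd)]. *)
Definition triv_y1 (U : nat -> unit -> F) : F := 2 * U 0%N tt + 2 * U 1%N tt + 2 * U 3%N tt + 2 * U 4%N tt.
Definition triv_y2 (U : nat -> unit -> F) : F := 8 * U 2%N tt.
Definition triv_y3 (U : nat -> unit -> F) : F := -2 * U 0%N tt - 2 * U 1%N tt + 2 * U 3%N tt + 2 * U 4%N tt.
Definition triv_y4 (U : nat -> unit -> F) : F := -2 * U 0%N tt + 2 * U 1%N tt - 2 * U 3%N tt + 2 * U 4%N tt.
Definition triv_y5 (U : nat -> unit -> F) : F := 2 * U 0%N tt - 2 * U 1%N tt - 2 * U 3%N tt + 2 * U 4%N tt.

Lemma triv_rels U : base1 x 1 U ->
  relT (triv_y1 U) (triv_y4 U) /\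
  relT (triv_y3 U) (triv_y5 U) /\
  relT (2*triv_y1 U+triv_y2 U) (2*triv_y3 U) /\
  relV (triv_y4 U) (triv_y5 U) (triv_y2 U-triv_y1 U) (-triv_y3 U).
Proof.
move=> [E0 E1 E2 E3 E4]; rewrite xE /= in E0 E1 E2 E3 E4.
rewrite /relT /relS /relV /n11 /n12 /n21 /n22 /nT /nS.
rewrite /triv_y1 /triv_y2 /triv_y3 /triv_y4 /triv_y5.
split; first by lc (eqD (eqZ (4) E0) (eqZ (4) E4)).
split; first by lc (eqD (eqZ (- (4)) E0) (eqZ (4) E4)).
split; first by lc (eqD (eqZ (8) E1) (eqD (eqZ (8) E2) (eqZ (8) E3))).
by split; [lc (eqD (eqZ (- (4)) E1) (eqD (eqZ (- (4)) E2) (eqZ (8) E3)))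
  | lc (eqD (eqZ (- (4)) E1) (eqZ (4) E2))].
Qed.

(** Polarization is invertible in characteristic 0: each original value, times 8, is a signed sum of
    polarized ones. *)
Lemma triv_table0 U : 
  triv_y1 U = 0 -> triv_y2 U = 0 -> triv_y3 U = 0 -> triv_y4 U = 0 -> triv_y5 U = 0 ->
  forall s j, (s < 5)%N -> U s j != 0 -> False.
Proof.
move=> zy1 zy2 zy3 zy4 zy5.
rewrite /triv_y1 /triv_y2 /triv_y3 /triv_y4 /triv_y5 in zy1 zy2 zy3 zy4 zy5.
have u00 : U 0%N tt = 0 by apply: (@nat_mul0 _ char0 7); lc (eqD (eqZ 1 zy1) (eqD (eqZ (- (1)) zy3) (eqD (eqZ (- (1)) zy4) (eqZ 1 zy5)))).
have u10 : U 1%N tt = 0 by apply: (@nat_mul0 _ char0 7); lc (eqD (eqZ 1 zy1) (eqD (eqZ (- (1)) zy3) (eqD (eqZ 1 zy4) (eqZ (- (1)) zy5)))).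
have u20 : U 2%N tt = 0 by apply: (@nat_mul0 _ char0 7); lc (eqZ 1 zy2).
have u30 : U 3%N tt = 0 by apply: (@nat_mul0 _ char0 7); lc (eqD (eqZ 1 zy1) (eqD (eqZ 1 zy3) (eqD (eqZ (- (1)) zy4) (eqZ (- (1)) zy5)))).
have u40 : U 4%N tt = 0 by apply: (@nat_mul0 _ char0 7); lc (eqD (eqZ 1 zy1) (eqD (eqZ 1 zy3) (eqD (eqZ 1 zy4) (eqZ 1 zy5)))).
move=> s [] lt; case: s lt => [|[|[|[|[|s]]]]] // _; by rewrite ?u00 ?u10 ?u20 ?u30 ?u40 eqxx.
Qed.

Definition sign_y1 (U : nat -> unit -> F) : F := -2 * U 0%N tt - 2 * U 1%N tt + 2 * U 3%N tt + 2 * U 4%N tt.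
Definition sign_y2 (U : nat -> unit -> F) : F := 8 * U 2%N tt.
Definition sign_y3 (U : nat -> unit -> F) : F := 2 * U 0%N tt + 2 * U 1%N tt + 2 * U 3%N tt + 2 * U 4%N tt.
Definition sign_y4 (U : nat -> unit -> F) : F := 2 * U 0%N tt - 2 * U 1%N tt - 2 * U 3%N tt + 2 * U 4%N tt.
Definition sign_y5 (U : nat -> unit -> F) : F := -2 * U 0%N tt + 2 * U 1%N tt - 2 * U 3%N tt + 2 * U 4%N tt.

Lemma sign_rels U : base1 x (-1) U ->
  relS (sign_y1 U) (sign_y4 U) /\
  relS (sign_y3 U) (sign_y5 U) /\
  relS (sign_y2 U+2*sign_y4 U) (2*sign_y5 U) /\
  relV (sign_y4 U-sign_y2 U) (sign_y5 U) (3*sign_y1 U) (3*sign_y3 U).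
Proof.
move=> [E0 E1 E2 E3 E4]; rewrite xE /= in E0 E1 E2 E3 E4.
rewrite /relT /relS /relV /n11 /n12 /n21 /n22 /nT /nS.
rewrite /sign_y1 /sign_y2 /sign_y3 /sign_y4 /sign_y5.
split; first by lc (eqD (eqZ (- (4)) E0) (eqZ (4) E4)).
split; first by lc (eqD (eqZ (4) E0) (eqZ (4) E4)).
split; first by lc (eqD (eqZ (8) E1) (eqD (eqZ (- (8)) E2) (eqZ (8) E3))).
by split; [lc (eqD (eqZ (- (12)) E1) (eqZ (- (12)) E2))
  | lc (eqD (eqZ (4) E1) (eqD (eqZ (- (4)) E2) (eqZ (- (8)) E3)))].
Qed.

Lemma sign_table0 U : 
  sign_y1 U = 0 -> sign_y2 U = 0 -> sign_y3 U = 0 -> sign_y4 U = 0 -> sign_y5 U = 0 ->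
  forall s j, (s < 5)%N -> U s j != 0 -> False.
Proof.
move=> zy1 zy2 zy3 zy4 zy5.
rewrite /sign_y1 /sign_y2 /sign_y3 /sign_y4 /sign_y5 in zy1 zy2 zy3 zy4 zy5.
have u00 : U 0%N tt = 0 by apply: (@nat_mul0 _ char0 7); lc (eqD (eqZ (- (1)) zy1) (eqD (eqZ 1 zy3) (eqD (eqZ 1 zy4) (eqZ (- (1)) zy5)))).
have u10 : U 1%N tt = 0 by apply: (@nat_mul0 _ char0 7); lc (eqD (eqZ (- (1)) zy1) (eqD (eqZ 1 zy3) (eqD (eqZ (- (1)) zy4) (eqZ 1 zy5)))).
have u20 : U 2%N tt = 0 by apply: (@nat_mul0 _ char0 7); lc (eqZ 1 zy2).
have u30 : U 3%N tt = 0 by apply: (@nat_mul0 _ char0 7); lc (eqD (eqZ 1 zy1) (eqD (eqZ 1 zy3) (eqD (eqZ (- (1)) zy4) (eqZ (- (1)) zy5)))).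
have u40 : U 4%N tt = 0 by apply: (@nat_mul0 _ char0 7); lc (eqD (eqZ 1 zy1) (eqD (eqZ 1 zy3) (eqD (eqZ 1 zy4) (eqZ 1 zy5)))).
move=> s [] lt; case: s lt => [|[|[|[|[|s]]]]] // _; by rewrite ?u00 ?u10 ?u20 ?u30 ?u40 eqxx.
Qed.

(** Polarized values with commutative ([C]) and anticommutative ([L]) innermost operation, and those
    on [(ab)(cd)] ([K]). The scalars keep all coefficients integral. *)
Definition two_C1 (U : nat -> 'I_4 * 'I_4 -> F) : F := 6 * U 0%N c01 - 6 * U 1%N c01 - 6 * U 1%N c02 - 6 * U 3%N c01 - 6 * U 3%N c02 + 6 * U 4%N c01.
Definition two_C2 (U : nat -> 'I_4 * 'I_4 -> F) : F := -6 * U 0%N c01 + 6 * U 1%N c01 + 6 * U 1%N c02 - 6 * U 3%N c01 - 6 * U 3%N c02 + 6 * U 4%N c01.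
Definition two_C3 (U : nat -> 'I_4 * 'I_4 -> F) : F := -6 * U 0%N c01 - 6 * U 1%N c01 - 6 * U 1%N c02 + 6 * U 3%N c01 + 6 * U 3%N c02 + 6 * U 4%N c01.
Definition two_C4 (U : nat -> 'I_4 * 'I_4 -> F) : F := 6 * U 0%N c01 + 6 * U 1%N c01 + 6 * U 1%N c02 + 6 * U 3%N c01 + 6 * U 3%N c02 + 6 * U 4%N c01.
Definition two_K1 (U : nat -> 'I_4 * 'I_4 -> F) : F := 24 * U 2%N c01.
Definition two_K2 (U : nat -> 'I_4 * 'I_4 -> F) : F := -8 * U 2%N c01 - 16 * U 2%N c02.
Definition two_L1 (U : nat -> 'I_4 * 'I_4 -> F) : F := 2 * U 0%N c01 + 4 * U 0%N c02 + 2 * U 1%N c01 - 2 * U 1%N c02 - 2 * U 3%N c01 + 2 * U 3%N c02 - 2 * U 4%N c01 - 4 * U 4%N c02.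
Definition two_L2 (U : nat -> 'I_4 * 'I_4 -> F) : F := -2 * U 0%N c01 - 4 * U 0%N c02 - 2 * U 1%N c01 + 2 * U 1%N c02 - 2 * U 3%N c01 + 2 * U 3%N c02 - 2 * U 4%N c01 - 4 * U 4%N c02.
Definition two_L3 (U : nat -> 'I_4 * 'I_4 -> F) : F := -2 * U 0%N c01 - 4 * U 0%N c02 + 2 * U 1%N c01 - 2 * U 1%N c02 + 2 * U 3%N c01 - 2 * U 3%N c02 - 2 * U 4%N c01 - 4 * U 4%N c02.
Definition two_L4 (U : nat -> 'I_4 * 'I_4 -> F) : F := 2 * U 0%N c01 + 4 * U 0%N c02 - 2 * U 1%N c01 + 2 * U 1%N c02 + 2 * U 3%N c01 - 2 * U 3%N c02 - 2 * U 4%N c01 - 4 * U 4%N c02.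

Lemma two_rels U : base2 x U -> (forall s, U s c01 + U s c02 + U s c03 = 0) ->
  relV (two_L1 U) (two_L3 U) (two_C1 U) (two_C3 U) /\
  relV (two_L2 U) (two_L4 U) (two_C2 U) (two_C4 U) /\
  relT (2*two_C1 U+two_K1 U) (2*two_C2 U) /\
  relV (two_C3 U) (two_C4 U) (two_K1 U-two_C1 U) (-two_C2 U) /\
  relV (two_L3 U-two_K2 U) (two_L4 U) (3*two_L1 U) (3*two_L2 U) /\
  relS (two_K2 U+2*two_L3 U) (2*two_L4 U).
Proof.
move=> [[E01 [E02 E03]] [E11 [E12 E13]] [E21 [E22 E23]] [E31 [E32 E33]] [E41 [E42 E43]]] H.
have h3 s : U s c03 = - (U s c01 + U s c02) by lc (H s).
rewrite !xE /= ?h3 in E01 E02 E03 E11 E12 E13 E21 E22 E23 E31 E32 E33 E41 E42 E43.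
rewrite /relT /relS /relV /n11 /n12 /n21 /n22 /nT /nS.
rewrite /two_C1 /two_C2 /two_C3 /two_C4 /two_K1 /two_K2 /two_L1 /two_L2 /two_L3 /two_L4.
split; first by split; [lc (eqD (eqZ (12) E01) (eqD (eqZ (- (12)) E41) (eqZ (- (12)) E42)))
  | lc (eqD (eqZ (4) E01) (eqD (eqZ (8) E02) (eqD (eqZ (- (4)) E41) (eqZ (4) E42))))].
split; first by split; [lc (eqD (eqZ (- (12)) E01) (eqD (eqZ (- (12)) E41) (eqZ (- (12)) E42)))
  | lc (eqD (eqZ (- (4)) E01) (eqD (eqZ (- (8)) E02) (eqD (eqZ (- (4)) E41) (eqZ (4) E42))))].
split; first by lc (eqD (eqZ (24) E11) (eqD (eqZ (- (24)) E21) (eqD (eqZ (- (24)) E22) (eqZ (24) E31)))).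
split; first by split; [lc (eqD (eqZ (- (12)) E11) (eqD (eqZ (12) E21) (eqD (eqZ (12) E22) (eqZ (24) E31))))
  | lc (eqD (eqZ (- (12)) E11) (eqD (eqZ (- (12)) E21) (eqZ (- (12)) E22)))].
split; first by split; [lc (eqD (eqZ (12) E11) (eqD (eqZ (24) E12) (eqD (eqZ (12) E21) (eqZ (- (12)) E22))))
  | lc (eqD (eqZ (- (4)) E11) (eqD (eqZ (- (8)) E12) (eqD (eqZ (4) E21) (eqD (eqZ (- (4)) E22) (eqD (eqZ (8) E31) (eqZ (16) E32))))))].
by lc (eqD (eqZ (- (8)) E11) (eqD (eqZ (- (16)) E12) (eqD (eqZ (8) E21) (eqD (eqZ (- (8)) E22) (eqD (eqZ (- (8)) E31) (eqZ (- (16)) E32)))))).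
Qed.

Lemma two_table0 U : (forall s, U s c01 + U s c02 + U s c03 = 0) -> 
  two_C1 U = 0 -> two_C2 U = 0 -> two_C3 U = 0 -> two_C4 U = 0 -> two_K1 U = 0 -> two_K2 U = 0 -> two_L1 U = 0 -> two_L2 U = 0 -> two_L3 U = 0 -> two_L4 U = 0 ->
  forall s, (s < 5)%N -> (U s c01 != 0) || (U s c02 != 0) -> False.
Proof.
move=> H zC1 zC2 zC3 zC4 zK1 zK2 zL1 zL2 zL3 zL4.
rewrite /two_C1 /two_C2 /two_C3 /two_C4 /two_K1 /two_K2 /two_L1 /two_L2 /two_L3 /two_L4 in zC1 zC2 zC3 zC4 zK1 zK2 zL1 zL2 zL3 zL4.
have u01 : U 0%N c01 = 0 by apply: (@nat_mul0 _ char0 23); lc (eqD (eqZ 1 zC1) (eqD (eqZ (- (1)) zC2) (eqD (eqZ (- (1)) zC3) (eqZ 1 zC4)))).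
have u02 : U 0%N c02 = 0 by apply: (@nat_mul0 _ char0 47); lc (eqD (eqZ (- (1)) zC1) (eqD (eqZ 1 zC2) (eqD (eqZ 1 zC3) (eqD (eqZ (- (1)) zC4) (eqD (eqZ (3) zL1) (eqD (eqZ (- (3)) zL2) (eqD (eqZ (- (3)) zL3) (eqZ (3) zL4)))))))).
have u11 : U 1%N c01 = 0 by apply: (@nat_mul0 _ char0 47); lc (eqD (eqZ (- (1)) zC1) (eqD (eqZ 1 zC2) (eqD (eqZ (- (1)) zC3) (eqD (eqZ 1 zC4) (eqD (eqZ (3) zL1) (eqD (eqZ (- (3)) zL2) (eqD (eqZ (3) zL3) (eqZ (- (3)) zL4)))))))).
have u12 : U 1%N c02 = 0 by apply: (@nat_mul0 _ char0 47); lc (eqD (eqZ (- (1)) zC1) (eqD (eqZ 1 zC2) (eqD (eqZ (- (1)) zC3) (eqD (eqZ 1 zC4) (eqD (eqZ (- (3)) zL1) (eqD (eqZ (3) zL2) (eqD (eqZ (- (3)) zL3) (eqZ (3) zL4)))))))).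
have u21 : U 2%N c01 = 0 by apply: (@nat_mul0 _ char0 23); lc (eqZ 1 zK1).
have u22 : U 2%N c02 = 0 by apply: (@nat_mul0 _ char0 47); lc (eqD (eqZ (- (1)) zK1) (eqZ (- (3)) zK2)).
have u31 : U 3%N c01 = 0 by apply: (@nat_mul0 _ char0 47); lc (eqD (eqZ (- (1)) zC1) (eqD (eqZ (- (1)) zC2) (eqD (eqZ 1 zC3) (eqD (eqZ 1 zC4) (eqD (eqZ (- (3)) zL1) (eqD (eqZ (- (3)) zL2) (eqD (eqZ (3) zL3) (eqZ (3) zL4)))))))).
have u32 : U 3%N c02 = 0 by apply: (@nat_mul0 _ char0 47); lc (eqD (eqZ (- (1)) zC1) (eqD (eqZ (- (1)) zC2) (eqD (eqZ 1 zC3) (eqD (eqZ 1 zC4) (eqD (eqZ (3) zL1) (eqD (eqZ (3) zL2) (eqD (eqZ (- (3)) zL3) (eqZ (- (3)) zL4)))))))).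
have u41 : U 4%N c01 = 0 by apply: (@nat_mul0 _ char0 23); lc (eqD (eqZ 1 zC1) (eqD (eqZ 1 zC2) (eqD (eqZ 1 zC3) (eqZ 1 zC4)))).
have u42 : U 4%N c02 = 0 by apply: (@nat_mul0 _ char0 47); lc (eqD (eqZ (- (1)) zC1) (eqD (eqZ (- (1)) zC2) (eqD (eqZ (- (1)) zC3) (eqD (eqZ (- (1)) zC4) (eqD (eqZ (- (3)) zL1) (eqD (eqZ (- (3)) zL2) (eqD (eqZ (- (3)) zL3) (eqZ (- (3)) zL4)))))))).
move=> s lt; case: s lt => [|[|[|[|[|s]]]]] // _; by rewrite ?u01 ?u02 ?u11 ?u12 ?u21 ?u22 ?u31 ?u32 ?u41 ?u42 eqxx.
Qed.

Definition std_k1 (U : nat -> 'I_4 -> F) : F := 12 * U 2%N o0 + 12 * U 2%N o1.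
Definition std_k2 (U : nat -> 'I_4 -> F) : F := 12 * U 2%N o0 + 12 * U 2%N o2.
Definition std_k3 (U : nat -> 'I_4 -> F) : F := 12 * U 2%N o1 + 12 * U 2%N o2.
Definition std_l1 (U : nat -> 'I_4 -> F) : F := 3 * U 0%N o0 - 3 * U 0%N o1 + 3 * U 1%N o1 - 3 * U 1%N o2 + 3 * U 3%N o1 - 3 * U 3%N o2 + 3 * U 4%N o0 + 3 * U 4%N o1 + 6 * U 4%N o2.
Definition std_l2 (U : nat -> 'I_4 -> F) : F := -3 * U 0%N o0 + 3 * U 0%N o1 - 3 * U 1%N o1 + 3 * U 1%N o2 + 3 * U 3%N o1 - 3 * U 3%N o2 + 3 * U 4%N o0 + 3 * U 4%N o1 + 6 * U 4%N o2.
Definition std_l3 (U : nat -> 'I_4 -> F) : F := -3 * U 0%N o0 + 3 * U 0%N o1 + 3 * U 1%N o1 - 3 * U 1%N o2 - 3 * U 3%N o1 + 3 * U 3%N o2 + 3 * U 4%N o0 + 3 * U 4%N o1 + 6 * U 4%N o2.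
Definition std_l4 (U : nat -> 'I_4 -> F) : F := 3 * U 0%N o0 - 3 * U 0%N o1 - 3 * U 1%N o1 + 3 * U 1%N o2 - 3 * U 3%N o1 + 3 * U 3%N o2 + 3 * U 4%N o0 + 3 * U 4%N o1 + 6 * U 4%N o2.
Definition std_s1 (U : nat -> 'I_4 -> F) : F := -U 0%N o0 - U 0%N o1 + 2 * U 0%N o2 + 2 * U 1%N o0 - U 1%N o1 - U 1%N o2 - 2 * U 3%N o0 - 3 * U 3%N o1 - 3 * U 3%N o2 + U 4%N o0 + 3 * U 4%N o1.
Definition std_s2 (U : nat -> 'I_4 -> F) : F := U 0%N o0 + U 0%N o1 - 2 * U 0%N o2 - 2 * U 1%N o0 + U 1%N o1 + U 1%N o2 - 2 * U 3%N o0 - 3 * U 3%N o1 - 3 * U 3%N o2 + U 4%N o0 + 3 * U 4%N o1.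
Definition std_s3 (U : nat -> 'I_4 -> F) : F := U 0%N o0 + U 0%N o1 - 2 * U 0%N o2 + 2 * U 1%N o0 - U 1%N o1 - U 1%N o2 + 2 * U 3%N o0 + 3 * U 3%N o1 + 3 * U 3%N o2 + U 4%N o0 + 3 * U 4%N o1.
Definition std_s4 (U : nat -> 'I_4 -> F) : F := -U 0%N o0 - U 0%N o1 + 2 * U 0%N o2 - 2 * U 1%N o0 + U 1%N o1 + U 1%N o2 + 2 * U 3%N o0 + 3 * U 3%N o1 + 3 * U 3%N o2 + U 4%N o0 + 3 * U 4%N o1.
Definition std_t1 (U : nat -> 'I_4 -> F) : F := -8 * U 0%N o0 - 8 * U 0%N o1 - 8 * U 0%N o2 - 8 * U 1%N o0 - 8 * U 1%N o1 - 8 * U 1%N o2 + 8 * U 3%N o0 + 8 * U 4%N o0.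
Definition std_t2 (U : nat -> 'I_4 -> F) : F := 8 * U 0%N o0 + 8 * U 0%N o1 + 8 * U 0%N o2 + 8 * U 1%N o0 + 8 * U 1%N o1 + 8 * U 1%N o2 + 8 * U 3%N o0 + 8 * U 4%N o0.
Definition std_t3 (U : nat -> 'I_4 -> F) : F := 8 * U 0%N o0 + 8 * U 0%N o1 + 8 * U 0%N o2 - 8 * U 1%N o0 - 8 * U 1%N o1 - 8 * U 1%N o2 - 8 * U 3%N o0 + 8 * U 4%N o0.
Definition std_t4 (U : nat -> 'I_4 -> F) : F := -8 * U 0%N o0 - 8 * U 0%N o1 - 8 * U 0%N o2 + 8 * U 1%N o0 + 8 * U 1%N o1 + 8 * U 1%N o2 - 8 * U 3%N o0 + 8 * U 4%N o0.

Lemma std_rels U : base4 x 1 U -> (forall s, U s o0 + U s o1 + U s o2 + U s o3 = 0) ->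
  relT (std_t1 U) (std_t3 U) /\
  relT (std_t2 U) (std_t4 U) /\
  relT (std_t1 U+4*std_s1 U) (std_t2 U+4*std_s2 U-2*std_k1 U) /\
  relV (4*std_s3 U+std_t3 U) (4*std_s4 U+std_t4 U) (-(std_t1 U+4*std_s1 U)) (-(4*std_k1 U+(std_t2 U+4*std_s2 U))) /\
  relV (std_t3 U-2*std_s3 U-2*std_k2 U) (std_t4 U-2*std_s4 U-2*std_k3 U) (3*(std_t1 U-2*std_s1 U)) (3*(std_t2 U-2*std_s2 U)) /\
  relV (std_l1 U) (std_l3 U) (-(3*std_s1 U)) (-(3*std_s3 U)) /\
  relV (std_l2 U) (std_l4 U) (-(3*std_s2 U)) (-(3*std_s4 U)) /\
  relS (std_k2 U+(std_t3 U-2*std_s3 U)) (std_k3 U+(std_t4 U-2*std_s4 U)) /\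
  relT (std_k2 U+2*std_l1 U) (2*std_l2 U-std_k3 U) /\
  relV (std_l3 U) (std_l4 U) (std_k2 U-std_l1 U) (-(std_k3 U+std_l2 U)).
Proof.
move=> [[E00 [E01 [E02 E03]]] [E10 [E11 [E12 E13]]] [E20 [E21 [E22 E23]]] [E30 [E31 [E32 E33]]] [E40 [E41 [E42 E43]]]] H.
have h3 s : U s o3 = - (U s o0 + U s o1 + U s o2) by lc (H s).
rewrite !xE /= ?h3 in E00 E01 E02 E03 E10 E11 E12 E13 E20 E21 E22 E23 E30 E31 E32 E33 E40 E41 E42 E43.
rewrite /relT /relS /relV /n11 /n12 /n21 /n22 /nT /nS.
rewrite /std_k1 /std_k2 /std_k3 /std_l1 /std_l2 /std_l3 /std_l4 /std_s1 /std_s2 /std_s3 /std_s4 /std_t1 /std_t2 /std_t3 /std_t4.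
split; first by lc (eqD (eqZ (- (16)) E00) (eqD (eqZ (- (16)) E01) (eqD (eqZ (- (16)) E02) (eqZ (16) E40)))).
split; first by lc (eqD (eqZ (16) E00) (eqD (eqZ (16) E01) (eqD (eqZ (16) E02) (eqZ (16) E40)))).
split; first by lc (eqD (eqZ (- (24)) E10) (eqD (eqZ (- (24)) E11) (eqD (eqZ (- (24)) E21) (eqD (eqZ (- (24)) E22) (eqD (eqZ (24) E30) (eqZ (24) E31)))))).
split; first by split; [lc (eqD (eqZ (24) E10) (eqD (eqZ (24) E11) (eqD (eqZ (24) E21) (eqD (eqZ (24) E22) (eqD (eqZ (48) E30) (eqZ (48) E31))))))
  | lc (eqD (eqZ (24) E10) (eqD (eqZ (24) E11) (eqD (eqZ (- (24)) E21) (eqZ (- (24)) E22))))].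
split; first by split; [lc (eqD (eqZ (- (36)) E10) (eqD (eqZ (- (36)) E11) (eqD (eqZ (- (72)) E12) (eqD (eqZ (- (72)) E20) (eqD (eqZ (- (36)) E21) (eqZ (- (36)) E22))))))
  | lc (eqD (eqZ (12) E10) (eqD (eqZ (12) E11) (eqD (eqZ (24) E12) (eqD (eqZ (- (24)) E20) (eqD (eqZ (- (12)) E21) (eqD (eqZ (- (12)) E22) (eqD (eqZ (- (24)) E30) (eqZ (24) E31))))))))].
split; first by split; [lc (eqD (eqZ (6) E00) (eqD (eqZ (6) E01) (eqD (eqZ (- (12)) E02) (eqD (eqZ (12) E40) (eqD (eqZ (18) E41) (eqZ (18) E42))))))
  | lc (eqD (eqZ (6) E00) (eqD (eqZ (- (6)) E01) (eqD (eqZ (6) E41) (eqZ (- (6)) E42))))].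
split; first by split; [lc (eqD (eqZ (- (6)) E00) (eqD (eqZ (- (6)) E01) (eqD (eqZ (12) E02) (eqD (eqZ (12) E40) (eqD (eqZ (18) E41) (eqZ (18) E42))))))
  | lc (eqD (eqZ (- (6)) E00) (eqD (eqZ (6) E01) (eqD (eqZ (6) E41) (eqZ (- (6)) E42))))].
split; first by lc (eqD (eqZ (12) E10) (eqD (eqZ (12) E11) (eqD (eqZ (24) E12) (eqD (eqZ (- (24)) E20) (eqD (eqZ (- (12)) E21) (eqD (eqZ (- (12)) E22) (eqD (eqZ (12) E30) (eqZ (- (12)) E31)))))))).
split; first by lc (eqD (eqZ (12) E10) (eqD (eqZ (- (12)) E11) (eqD (eqZ (12) E21) (eqD (eqZ (- (12)) E22) (eqD (eqZ (12) E30) (eqD (eqZ (12) E31) (eqZ (24) E32))))))).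
by split; [lc (eqD (eqZ (- (6)) E10) (eqD (eqZ (6) E11) (eqD (eqZ (- (6)) E21) (eqD (eqZ (6) E22) (eqD (eqZ (12) E30) (eqD (eqZ (12) E31) (eqZ (24) E32)))))))
  | lc (eqD (eqZ (- (6)) E10) (eqD (eqZ (6) E11) (eqD (eqZ (6) E21) (eqZ (- (6)) E22))))].
Qed.

Lemma std_table0 U : (forall s, U s o0 + U s o1 + U s o2 + U s o3 = 0) -> 
  std_k1 U = 0 -> std_k2 U = 0 -> std_k3 U = 0 -> std_l1 U = 0 -> std_l2 U = 0 -> std_l3 U = 0 -> std_l4 U = 0 -> std_s1 U = 0 -> std_s2 U = 0 -> std_s3 U = 0 -> std_s4 U = 0 -> std_t1 U = 0 -> std_t2 U = 0 -> std_t3 U = 0 -> std_t4 U = 0 ->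
  forall s j, (s < 5)%N -> U s j != 0 -> False.
Proof.
move=> H zk1 zk2 zk3 zl1 zl2 zl3 zl4 zs1 zs2 zs3 zs4 zt1 zt2 zt3 zt4.
rewrite /std_k1 /std_k2 /std_k3 /std_l1 /std_l2 /std_l3 /std_l4 /std_s1 /std_s2 /std_s3 /std_s4 /std_t1 /std_t2 /std_t3 /std_t4 in zk1 zk2 zk3 zl1 zl2 zl3 zl4 zs1 zs2 zs3 zs4 zt1 zt2 zt3 zt4.
have u00 : U 0%N o0 = 0 by apply: (@nat_mul0 _ char0 95); lc (eqD (eqZ (- (4)) zs1) (eqD (eqZ (- (1)) zt1) (eqD (eqZ (4) zl1) (eqD (eqZ (4) zs2) (eqD (eqZ 1 zt2) (eqD (eqZ (- (4)) zl2) (eqD (eqZ (4) zs3) (eqD (eqZ 1 zt3) (eqD (eqZ (- (4)) zl3) (eqD (eqZ (- (4)) zs4) (eqD (eqZ (- (1)) zt4) (eqZ (4) zl4)))))))))))).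
have u01 : U 0%N o1 = 0 by apply: (@nat_mul0 _ char0 95); lc (eqD (eqZ (- (4)) zs1) (eqD (eqZ (- (1)) zt1) (eqD (eqZ (- (4)) zl1) (eqD (eqZ (4) zs2) (eqD (eqZ 1 zt2) (eqD (eqZ (4) zl2) (eqD (eqZ (4) zs3) (eqD (eqZ 1 zt3) (eqD (eqZ (4) zl3) (eqD (eqZ (- (4)) zs4) (eqD (eqZ (- (1)) zt4) (eqZ (- (4)) zl4)))))))))))).
have u02 : U 0%N o2 = 0 by apply: (@nat_mul0 _ char0 95); lc (eqD (eqZ (8) zs1) (eqD (eqZ (- (1)) zt1) (eqD (eqZ (- (8)) zs2) (eqD (eqZ 1 zt2) (eqD (eqZ (- (8)) zs3) (eqD (eqZ 1 zt3) (eqD (eqZ (8) zs4) (eqZ (- (1)) zt4)))))))).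
have u10 : U 1%N o0 = 0 by apply: (@nat_mul0 _ char0 95); lc (eqD (eqZ (8) zs1) (eqD (eqZ (- (1)) zt1) (eqD (eqZ (- (8)) zs2) (eqD (eqZ 1 zt2) (eqD (eqZ (8) zs3) (eqD (eqZ (- (1)) zt3) (eqD (eqZ (- (8)) zs4) (eqZ 1 zt4)))))))).
have u11 : U 1%N o1 = 0 by apply: (@nat_mul0 _ char0 95); lc (eqD (eqZ (- (4)) zs1) (eqD (eqZ (- (1)) zt1) (eqD (eqZ (4) zl1) (eqD (eqZ (4) zs2) (eqD (eqZ 1 zt2) (eqD (eqZ (- (4)) zl2) (eqD (eqZ (- (4)) zs3) (eqD (eqZ (- (1)) zt3) (eqD (eqZ (4) zl3) (eqD (eqZ (4) zs4) (eqD (eqZ 1 zt4) (eqZ (- (4)) zl4)))))))))))).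
have u12 : U 1%N o2 = 0 by apply: (@nat_mul0 _ char0 95); lc (eqD (eqZ (- (4)) zs1) (eqD (eqZ (- (1)) zt1) (eqD (eqZ (- (4)) zl1) (eqD (eqZ (4) zs2) (eqD (eqZ 1 zt2) (eqD (eqZ (4) zl2) (eqD (eqZ (- (4)) zs3) (eqD (eqZ (- (1)) zt3) (eqD (eqZ (- (4)) zl3) (eqD (eqZ (4) zs4) (eqD (eqZ 1 zt4) (eqZ (4) zl4)))))))))))).
have u20 : U 2%N o0 = 0 by apply: (@nat_mul0 _ char0 23); lc (eqD (eqZ 1 zk1) (eqD (eqZ 1 zk2) (eqZ (- (1)) zk3))).
have u21 : U 2%N o1 = 0 by apply: (@nat_mul0 _ char0 23); lc (eqD (eqZ 1 zk1) (eqD (eqZ (- (1)) zk2) (eqZ 1 zk3))).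
have u22 : U 2%N o2 = 0 by apply: (@nat_mul0 _ char0 23); lc (eqD (eqZ (- (1)) zk1) (eqD (eqZ 1 zk2) (eqZ 1 zk3))).
have u30 : U 3%N o0 = 0 by apply: (@nat_mul0 _ char0 31); lc (eqD (eqZ 1 zt1) (eqD (eqZ 1 zt2) (eqD (eqZ (- (1)) zt3) (eqZ (- (1)) zt4)))).
have u31 : U 3%N o1 = 0 by apply: (@nat_mul0 _ char0 95); lc (eqD (eqZ (- (4)) zs1) (eqD (eqZ (- (1)) zt1) (eqD (eqZ (4) zl1) (eqD (eqZ (- (4)) zs2) (eqD (eqZ (- (1)) zt2) (eqD (eqZ (4) zl2) (eqD (eqZ (4) zs3) (eqD (eqZ 1 zt3) (eqD (eqZ (- (4)) zl3) (eqD (eqZ (4) zs4) (eqD (eqZ 1 zt4) (eqZ (- (4)) zl4)))))))))))).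
have u32 : U 3%N o2 = 0 by apply: (@nat_mul0 _ char0 95); lc (eqD (eqZ (- (4)) zs1) (eqD (eqZ (- (1)) zt1) (eqD (eqZ (- (4)) zl1) (eqD (eqZ (- (4)) zs2) (eqD (eqZ (- (1)) zt2) (eqD (eqZ (- (4)) zl2) (eqD (eqZ (4) zs3) (eqD (eqZ 1 zt3) (eqD (eqZ (4) zl3) (eqD (eqZ (4) zs4) (eqD (eqZ 1 zt4) (eqZ (4) zl4)))))))))))).
have u40 : U 4%N o0 = 0 by apply: (@nat_mul0 _ char0 31); lc (eqD (eqZ 1 zt1) (eqD (eqZ 1 zt2) (eqD (eqZ 1 zt3) (eqZ 1 zt4)))).
have u41 : U 4%N o1 = 0 by apply: (@nat_mul0 _ char0 95); lc (eqD (eqZ (8) zs1) (eqD (eqZ (- (1)) zt1) (eqD (eqZ (8) zs2) (eqD (eqZ (- (1)) zt2) (eqD (eqZ (8) zs3) (eqD (eqZ (- (1)) zt3) (eqD (eqZ (8) zs4) (eqZ (- (1)) zt4)))))))).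
have u42 : U 4%N o2 = 0 by apply: (@nat_mul0 _ char0 95); lc (eqD (eqZ (- (4)) zs1) (eqD (eqZ (- (1)) zt1) (eqD (eqZ (4) zl1) (eqD (eqZ (- (4)) zs2) (eqD (eqZ (- (1)) zt2) (eqD (eqZ (4) zl2) (eqD (eqZ (- (4)) zs3) (eqD (eqZ (- (1)) zt3) (eqD (eqZ (4) zl3) (eqD (eqZ (- (4)) zs4) (eqD (eqZ (- (1)) zt4) (eqZ (4) zl4)))))))))))).
move=> s j lt; have := H s; elim/ord4P: j; case: s lt => [|[|[|[|[|s]]]]] // _;
by rewrite ?u00 ?u01 ?u02 ?u10 ?u11 ?u12 ?u20 ?u21 ?u22 ?u30 ?u31 ?u32 ?u40 ?u41 ?u42 ?add0r ?eqxx // => ->; rewrite eqxx.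
Qed.

Definition stds_g1 (U : nat -> 'I_4 -> F) : F := -3 * U 0%N o0 + 3 * U 0%N o1 - 3 * U 1%N o1 + 3 * U 1%N o2 + 3 * U 3%N o1 - 3 * U 3%N o2 + 3 * U 4%N o0 + 3 * U 4%N o1 + 6 * U 4%N o2.
Definition stds_g2 (U : nat -> 'I_4 -> F) : F := 3 * U 0%N o0 - 3 * U 0%N o1 + 3 * U 1%N o1 - 3 * U 1%N o2 + 3 * U 3%N o1 - 3 * U 3%N o2 + 3 * U 4%N o0 + 3 * U 4%N o1 + 6 * U 4%N o2.
Definition stds_g3 (U : nat -> 'I_4 -> F) : F := 3 * U 0%N o0 - 3 * U 0%N o1 - 3 * U 1%N o1 + 3 * U 1%N o2 - 3 * U 3%N o1 + 3 * U 3%N o2 + 3 * U 4%N o0 + 3 * U 4%N o1 + 6 * U 4%N o2.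
Definition stds_g4 (U : nat -> 'I_4 -> F) : F := -3 * U 0%N o0 + 3 * U 0%N o1 + 3 * U 1%N o1 - 3 * U 1%N o2 - 3 * U 3%N o1 + 3 * U 3%N o2 + 3 * U 4%N o0 + 3 * U 4%N o1 + 6 * U 4%N o2.
Definition stds_k1 (U : nat -> 'I_4 -> F) : F := 12 * U 2%N o0 + 12 * U 2%N o1.
Definition stds_k2 (U : nat -> 'I_4 -> F) : F := 12 * U 2%N o0 + 12 * U 2%N o2.
Definition stds_k3 (U : nat -> 'I_4 -> F) : F := -12 * U 2%N o1 - 12 * U 2%N o2.
Definition stds_s1 (U : nat -> 'I_4 -> F) : F := U 0%N o0 + U 0%N o1 - 2 * U 0%N o2 - 2 * U 1%N o0 + U 1%N o1 + U 1%N o2 - 2 * U 3%N o0 - 3 * U 3%N o1 - 3 * U 3%N o2 + U 4%N o0 + 3 * U 4%N o1.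
Definition stds_s2 (U : nat -> 'I_4 -> F) : F := -U 0%N o0 - U 0%N o1 + 2 * U 0%N o2 + 2 * U 1%N o0 - U 1%N o1 - U 1%N o2 - 2 * U 3%N o0 - 3 * U 3%N o1 - 3 * U 3%N o2 + U 4%N o0 + 3 * U 4%N o1.
Definition stds_s3 (U : nat -> 'I_4 -> F) : F := -U 0%N o0 - U 0%N o1 + 2 * U 0%N o2 - 2 * U 1%N o0 + U 1%N o1 + U 1%N o2 + 2 * U 3%N o0 + 3 * U 3%N o1 + 3 * U 3%N o2 + U 4%N o0 + 3 * U 4%N o1.
Definition stds_s4 (U : nat -> 'I_4 -> F) : F := U 0%N o0 + U 0%N o1 - 2 * U 0%N o2 + 2 * U 1%N o0 - U 1%N o1 - U 1%N o2 + 2 * U 3%N o0 + 3 * U 3%N o1 + 3 * U 3%N o2 + U 4%N o0 + 3 * U 4%N o1.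
Definition stds_t1 (U : nat -> 'I_4 -> F) : F := 8 * U 0%N o0 + 8 * U 0%N o1 + 8 * U 0%N o2 + 8 * U 1%N o0 + 8 * U 1%N o1 + 8 * U 1%N o2 + 8 * U 3%N o0 + 8 * U 4%N o0.
Definition stds_t2 (U : nat -> 'I_4 -> F) : F := -8 * U 0%N o0 - 8 * U 0%N o1 - 8 * U 0%N o2 - 8 * U 1%N o0 - 8 * U 1%N o1 - 8 * U 1%N o2 + 8 * U 3%N o0 + 8 * U 4%N o0.
Definition stds_t3 (U : nat -> 'I_4 -> F) : F := -8 * U 0%N o0 - 8 * U 0%N o1 - 8 * U 0%N o2 + 8 * U 1%N o0 + 8 * U 1%N o1 + 8 * U 1%N o2 - 8 * U 3%N o0 + 8 * U 4%N o0.
Definition stds_t4 (U : nat -> 'I_4 -> F) : F := 8 * U 0%N o0 + 8 * U 0%N o1 + 8 * U 0%N o2 - 8 * U 1%N o0 - 8 * U 1%N o1 - 8 * U 1%N o2 - 8 * U 3%N o0 + 8 * U 4%N o0.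

Lemma stds_rels U : base4 x (-1) U -> (forall s, U s o0 + U s o1 + U s o2 + U s o3 = 0) ->
  relV (stds_g3 U-stds_k2 U) (stds_g4 U-stds_k3 U) (3*stds_g1 U) (3*stds_g2 U) /\
  relS (2*stds_g3 U+stds_k2 U) (2*stds_g4 U+stds_k3 U) /\
  relV (stds_s1 U) (stds_s3 U) (stds_g1 U) (stds_g3 U) /\
  relV (stds_s2 U) (stds_s4 U) (stds_g2 U) (stds_g4 U) /\
  relT (stds_k2 U+(stds_t1 U-2*stds_s1 U)) (stds_t2 U-2*stds_s2 U-stds_k3 U) /\
  relS (stds_t1 U) (stds_t3 U) /\
  relS (stds_t2 U) (stds_t4 U) /\
  relS (stds_t3 U+4*stds_s3 U) (stds_t4 U+4*stds_s4 U-2*stds_k1 U) /\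
  relV (stds_t3 U+4*stds_s3 U) ((stds_t4 U+4*stds_s4 U)+4*stds_k1 U) (3*(stds_t1 U+4*stds_s1 U)) (3*(stds_t2 U+4*stds_s2 U)) /\
  relV (stds_t3 U-2*stds_s3 U) (stds_t4 U-2*stds_s4 U) (2*stds_k2 U-(stds_t1 U-2*stds_s1 U)) (-(2*stds_k3 U+(stds_t2 U-2*stds_s2 U))).
Proof.
move=> [[E00 [E01 [E02 E03]]] [E10 [E11 [E12 E13]]] [E20 [E21 [E22 E23]]] [E30 [E31 [E32 E33]]] [E40 [E41 [E42 E43]]]] H.
have h3 s : U s o3 = - (U s o0 + U s o1 + U s o2) by lc (H s).
rewrite !xE /= ?h3 in E00 E01 E02 E03 E10 E11 E12 E13 E20 E21 E22 E23 E30 E31 E32 E33 E40 E41 E42 E43.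
rewrite /relT /relS /relV /n11 /n12 /n21 /n22 /nT /nS.
rewrite /stds_g1 /stds_g2 /stds_g3 /stds_g4 /stds_k1 /stds_k2 /stds_k3 /stds_s1 /stds_s2 /stds_s3 /stds_s4 /stds_t1 /stds_t2 /stds_t3 /stds_t4.
split; first by split; [lc (eqD (eqZ (- (18)) E10) (eqD (eqZ (18) E11) (eqD (eqZ (- (18)) E21) (eqZ (18) E22))))
  | lc (eqD (eqZ (6) E10) (eqD (eqZ (- (6)) E11) (eqD (eqZ (- (6)) E21) (eqD (eqZ (6) E22) (eqD (eqZ (- (12)) E30) (eqD (eqZ (- (12)) E31) (eqZ (- (24)) E32)))))))].
split; first by lc (eqD (eqZ (12) E10) (eqD (eqZ (- (12)) E11) (eqD (eqZ (- (12)) E21) (eqD (eqZ (12) E22) (eqD (eqZ (12) E30) (eqD (eqZ (12) E31) (eqZ (24) E32))))))).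
split; first by split; [lc (eqD (eqZ (- (6)) E00) (eqD (eqZ (6) E01) (eqD (eqZ (6) E41) (eqZ (- (6)) E42))))
  | lc (eqD (eqZ (2) E00) (eqD (eqZ (2) E01) (eqD (eqZ (- (4)) E02) (eqD (eqZ (- (4)) E40) (eqD (eqZ (- (6)) E41) (eqZ (- (6)) E42))))))].
split; first by split; [lc (eqD (eqZ (6) E00) (eqD (eqZ (- (6)) E01) (eqD (eqZ (6) E41) (eqZ (- (6)) E42))))
  | lc (eqD (eqZ (- (2)) E00) (eqD (eqZ (- (2)) E01) (eqD (eqZ (4) E02) (eqD (eqZ (- (4)) E40) (eqD (eqZ (- (6)) E41) (eqZ (- (6)) E42))))))].
split; first by lc (eqD (eqZ (12) E10) (eqD (eqZ (12) E11) (eqD (eqZ (24) E12) (eqD (eqZ (24) E20) (eqD (eqZ (12) E21) (eqD (eqZ (12) E22) (eqD (eqZ (12) E30) (eqZ (- (12)) E31)))))))).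
split; first by lc (eqD (eqZ (16) E00) (eqD (eqZ (16) E01) (eqD (eqZ (16) E02) (eqZ (16) E40)))).
split; first by lc (eqD (eqZ (- (16)) E00) (eqD (eqZ (- (16)) E01) (eqD (eqZ (- (16)) E02) (eqZ (16) E40)))).
split; first by lc (eqD (eqZ (- (24)) E10) (eqD (eqZ (- (24)) E11) (eqD (eqZ (24) E21) (eqD (eqZ (24) E22) (eqD (eqZ (24) E30) (eqZ (24) E31)))))).
split; first by split; [lc (eqD (eqZ (72) E10) (eqD (eqZ (72) E11) (eqD (eqZ (72) E21) (eqZ (72) E22))))
  | lc (eqD (eqZ (- (24)) E10) (eqD (eqZ (- (24)) E11) (eqD (eqZ (24) E21) (eqD (eqZ (24) E22) (eqD (eqZ (- (48)) E30) (eqZ (- (48)) E31))))))].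
by split; [lc (eqD (eqZ (- (12)) E10) (eqD (eqZ (- (12)) E11) (eqD (eqZ (- (24)) E12) (eqD (eqZ (- (24)) E20) (eqD (eqZ (- (12)) E21) (eqD (eqZ (- (12)) E22) (eqD (eqZ (24) E30) (eqZ (- (24)) E31))))))))
  | lc (eqD (eqZ (- (12)) E10) (eqD (eqZ (- (12)) E11) (eqD (eqZ (- (24)) E12) (eqD (eqZ (24) E20) (eqD (eqZ (12) E21) (eqZ (12) E22))))))].
Qed.

Lemma stds_table0 U : (forall s, U s o0 + U s o1 + U s o2 + U s o3 = 0) -> 
  stds_g1 U = 0 -> stds_g2 U = 0 -> stds_g3 U = 0 -> stds_g4 U = 0 -> stds_k1 U = 0 -> stds_k2 U = 0 -> stds_k3 U = 0 -> stds_s1 U = 0 -> stds_s2 U = 0 -> stds_s3 U = 0 -> stds_s4 U = 0 -> stds_t1 U = 0 -> stds_t2 U = 0 -> stds_t3 U = 0 -> stds_t4 U = 0 ->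
  forall s j, (s < 5)%N -> U s j != 0 -> False.
Proof.
move=> H zg1 zg2 zg3 zg4 zk1 zk2 zk3 zs1 zs2 zs3 zs4 zt1 zt2 zt3 zt4.
rewrite /stds_g1 /stds_g2 /stds_g3 /stds_g4 /stds_k1 /stds_k2 /stds_k3 /stds_s1 /stds_s2 /stds_s3 /stds_s4 /stds_t1 /stds_t2 /stds_t3 /stds_t4 in zg1 zg2 zg3 zg4 zk1 zk2 zk3 zs1 zs2 zs3 zs4 zt1 zt2 zt3 zt4.
have u00 : U 0%N o0 = 0 by apply: (@nat_mul0 _ char0 95); lc (eqD (eqZ (4) zs1) (eqD (eqZ 1 zt1) (eqD (eqZ (- (4)) zs2) (eqD (eqZ (- (1)) zt2) (eqD (eqZ (- (4)) zs3) (eqD (eqZ (- (1)) zt3) (eqD (eqZ (4) zs4) (eqD (eqZ 1 zt4) (eqD (eqZ (- (4)) zg1) (eqD (eqZ (4) zg2) (eqD (eqZ (4) zg3) (eqZ (- (4)) zg4)))))))))))).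
have u01 : U 0%N o1 = 0 by apply: (@nat_mul0 _ char0 95); lc (eqD (eqZ (4) zs1) (eqD (eqZ 1 zt1) (eqD (eqZ (- (4)) zs2) (eqD (eqZ (- (1)) zt2) (eqD (eqZ (- (4)) zs3) (eqD (eqZ (- (1)) zt3) (eqD (eqZ (4) zs4) (eqD (eqZ 1 zt4) (eqD (eqZ (4) zg1) (eqD (eqZ (- (4)) zg2) (eqD (eqZ (- (4)) zg3) (eqZ (4) zg4)))))))))))).
have u02 : U 0%N o2 = 0 by apply: (@nat_mul0 _ char0 95); lc (eqD (eqZ (- (8)) zs1) (eqD (eqZ 1 zt1) (eqD (eqZ (8) zs2) (eqD (eqZ (- (1)) zt2) (eqD (eqZ (8) zs3) (eqD (eqZ (- (1)) zt3) (eqD (eqZ (- (8)) zs4) (eqZ 1 zt4)))))))).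
have u10 : U 1%N o0 = 0 by apply: (@nat_mul0 _ char0 95); lc (eqD (eqZ (- (8)) zs1) (eqD (eqZ 1 zt1) (eqD (eqZ (8) zs2) (eqD (eqZ (- (1)) zt2) (eqD (eqZ (- (8)) zs3) (eqD (eqZ 1 zt3) (eqD (eqZ (8) zs4) (eqZ (- (1)) zt4)))))))).
have u11 : U 1%N o1 = 0 by apply: (@nat_mul0 _ char0 95); lc (eqD (eqZ (4) zs1) (eqD (eqZ 1 zt1) (eqD (eqZ (- (4)) zs2) (eqD (eqZ (- (1)) zt2) (eqD (eqZ (4) zs3) (eqD (eqZ 1 zt3) (eqD (eqZ (- (4)) zs4) (eqD (eqZ (- (1)) zt4) (eqD (eqZ (- (4)) zg1) (eqD (eqZ (4) zg2) (eqD (eqZ (- (4)) zg3) (eqZ (4) zg4)))))))))))).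
have u12 : U 1%N o2 = 0 by apply: (@nat_mul0 _ char0 95); lc (eqD (eqZ (4) zs1) (eqD (eqZ 1 zt1) (eqD (eqZ (- (4)) zs2) (eqD (eqZ (- (1)) zt2) (eqD (eqZ (4) zs3) (eqD (eqZ 1 zt3) (eqD (eqZ (- (4)) zs4) (eqD (eqZ (- (1)) zt4) (eqD (eqZ (4) zg1) (eqD (eqZ (- (4)) zg2) (eqD (eqZ (4) zg3) (eqZ (- (4)) zg4)))))))))))).
have u20 : U 2%N o0 = 0 by apply: (@nat_mul0 _ char0 23); lc (eqD (eqZ 1 zk2) (eqD (eqZ 1 zk3) (eqZ 1 zk1))).
have u21 : U 2%N o1 = 0 by apply: (@nat_mul0 _ char0 23); lc (eqD (eqZ (- (1)) zk2) (eqD (eqZ (- (1)) zk3) (eqZ 1 zk1))).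
have u22 : U 2%N o2 = 0 by apply: (@nat_mul0 _ char0 23); lc (eqD (eqZ 1 zk2) (eqD (eqZ (- (1)) zk3) (eqZ (- (1)) zk1))).
have u30 : U 3%N o0 = 0 by apply: (@nat_mul0 _ char0 31); lc (eqD (eqZ 1 zt1) (eqD (eqZ 1 zt2) (eqD (eqZ (- (1)) zt3) (eqZ (- (1)) zt4)))).
have u31 : U 3%N o1 = 0 by apply: (@nat_mul0 _ char0 95); lc (eqD (eqZ (- (4)) zs1) (eqD (eqZ (- (1)) zt1) (eqD (eqZ (- (4)) zs2) (eqD (eqZ (- (1)) zt2) (eqD (eqZ (4) zs3) (eqD (eqZ 1 zt3) (eqD (eqZ (4) zs4) (eqD (eqZ 1 zt4) (eqD (eqZ (4) zg1) (eqD (eqZ (4) zg2) (eqD (eqZ (- (4)) zg3) (eqZ (- (4)) zg4)))))))))))).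
have u32 : U 3%N o2 = 0 by apply: (@nat_mul0 _ char0 95); lc (eqD (eqZ (- (4)) zs1) (eqD (eqZ (- (1)) zt1) (eqD (eqZ (- (4)) zs2) (eqD (eqZ (- (1)) zt2) (eqD (eqZ (4) zs3) (eqD (eqZ 1 zt3) (eqD (eqZ (4) zs4) (eqD (eqZ 1 zt4) (eqD (eqZ (- (4)) zg1) (eqD (eqZ (- (4)) zg2) (eqD (eqZ (4) zg3) (eqZ (4) zg4)))))))))))).
have u40 : U 4%N o0 = 0 by apply: (@nat_mul0 _ char0 31); lc (eqD (eqZ 1 zt1) (eqD (eqZ 1 zt2) (eqD (eqZ 1 zt3) (eqZ 1 zt4)))).
have u41 : U 4%N o1 = 0 by apply: (@nat_mul0 _ char0 95); lc (eqD (eqZ (8) zs1) (eqD (eqZ (- (1)) zt1) (eqD (eqZ (8) zs2) (eqD (eqZ (- (1)) zt2) (eqD (eqZ (8) zs3) (eqD (eqZ (- (1)) zt3) (eqD (eqZ (8) zs4) (eqZ (- (1)) zt4)))))))).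
have u42 : U 4%N o2 = 0 by apply: (@nat_mul0 _ char0 95); lc (eqD (eqZ (- (4)) zs1) (eqD (eqZ (- (1)) zt1) (eqD (eqZ (- (4)) zs2) (eqD (eqZ (- (1)) zt2) (eqD (eqZ (- (4)) zs3) (eqD (eqZ (- (1)) zt3) (eqD (eqZ (- (4)) zs4) (eqD (eqZ (- (1)) zt4) (eqD (eqZ (4) zg1) (eqD (eqZ (4) zg2) (eqD (eqZ (4) zg3) (eqZ (4) zg4)))))))))))).
move=> s j lt; have := H s; elim/ord4P: j; case: s lt => [|[|[|[|[|s]]]]] // _;
by rewrite ?u00 ?u01 ?u02 ?u10 ?u11 ?u12 ?u20 ?u21 ?u22 ?u30 ?u31 ?u32 ?u40 ?u41 ?u42 ?add0r ?eqxx // => ->; rewrite eqxx.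
Qed.

(** The matrices from here to [astds] describe what is left of the polarized equations once they are
    solved as in [hT], [hS] and [hV]. The number of unknowns is 2, 2, 2, 4, 4, and the solutions
    have dimension 1, 1, 2, 3, 3; so [atwo] has to be zero and the other matrices have rank at most
    one. *)
Definition atriv (a b c d s k : F) (i j : nat) : F :=
  match i, j with
  | 0, 0 => 2 * b * s + 2 * a + 2 * s
  | 0, 1 => b * s - 2 * a
  | 1, 0 => 2 * d * s + 2 * s ^+ 2 + 2 * c
  | _, _ => d * s + s ^+ 2 - 2 * c
  end.

Definition asign (a b c d s k : F) (i j : nat) : F :=
  match i, j with
  | 0, 0 => 3 * a * k - 3 * k ^+ 2
  | 0, 1 => 3 * b * k + 2 * k
  | 1, 0 => -3 * c
  | _, _ => -3 * d + k
  end.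

Definition atwo (a b c d s k : F) (i j : nat) : F :=
  match i, j with
  | 0, 0 => 9 * b ^+ 2 * c * s + 9 * b * d ^+ 2 * s - 9 * a * d * s - 3 * d ^+ 2 * s - 6 * a * c + 3 * c * s
  | 0, 1 => 3 * b ^+ 2 * c * s + 3 * b * d ^+ 2 * s - 6 * a * b * c - 3 * a * d * s - 6 * b * c * d - d ^+ 2 * s + 2 * c * d + c * s
  | 1, 0 => -9 * a * b ^+ 2 * s * k - 9 * b ^+ 2 * d * s * k + 9 * a * b * s * k + 9 * b * d * s * k + 6 * a ^+ 2 * k - 6 * d ^+ 2 * s + 6 * c * s - 6 * c * k
  | _, _ => -3 * a * b ^+ 2 * s * k - 3 * b ^+ 2 * d * s * k + 6 * a ^+ 2 * b * k + 3 * a * b * s * k + 6 * b ^+ 2 * c * k + 3 * b * d * s * k - 6 * a * d * k - 2 * d ^+ 2 * s + 4 * c * d + 2 * c * s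
  end.

Definition astd (a b c d s k : F) (i j : nat) : F :=
  match i, j with
  | 0, 0 => 6 * b * s * k + 3 * a * k - 6 * d * s - 9 * s * k - 3 * c
  | 0, 1 => -3 * b * k + 3 * d + 9 * s
  | 0, 2 => 24 * b * s * k - 24 * a * k - 24 * d * s + 24 * c
  | 0, 3 => -48 * b * k + 48 * d
  | 1, 0 => 12 * b ^+ 2 * s ^+ 2 - 6 * a * b * s - 12 * b * d * s - 4 * b * s ^+ 2 + 5 * a * s + 6 * b * c + 2 * d * s - 3 * s ^+ 2 + 5 * c
  | 1, 1 => -18 * b ^+ 2 * s + 18 * b * d + 9 * b * s + 3 * d - 3 * s
  | 1, 2 => 48 * b ^+ 2 * s ^+ 2 - 24 * a * b * s - 48 * b * d * s + 8 * b * s ^+ 2 + 8 * a * s + 24 * b * c + 8 * d * s - 16 * c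
  | 1, 3 => -72 * b ^+ 2 * s + 72 * b * d - 24 * b * s - 24 * a - 24 * d
  | 2, 0 => -6 * a * b ^+ 2 * s - 6 * b ^+ 2 * d * s + 3 * a ^+ 2 * b + 5 * a * b * s + 3 * b ^+ 2 * c - 8 * b * d * s + 5 * a ^+ 2 + 3 * a * d - 3 * a * s - 5 * b * c + 3 * d * s
  | 2, 1 => 9 * a * b ^+ 2 + 9 * b ^+ 2 * d + 3 * b ^+ 2 * s + 3 * a * b + 6 * b * d + 3 * b * s
  | 2, 2 => -24 * a * b ^+ 2 * s - 24 * b ^+ 2 * d * s + 12 * a ^+ 2 * b + 8 * a * b * s + 12 * b ^+ 2 * c - 32 * b * d * s - 28 * a ^+ 2 + 12 * a * d + 16 * b * c - 12 * c
  | 2, 3 => 36 * a * b ^+ 2 + 36 * b ^+ 2 * d - 36 * a * b + 60 * b * d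
  | 3, 0 => -6 * b ^+ 2 * c * s - 6 * b * d ^+ 2 * s + 3 * a * b * c + 3 * b * c * d + 5 * b * c * s - 8 * d ^+ 2 * s + 5 * a * c - 2 * c * d - 3 * c * s
  | 3, 1 => 9 * b ^+ 2 * c + 9 * b * d ^+ 2 + 3 * b * d * s + 3 * b * c + 6 * d ^+ 2 + 6 * d * s
  | 3, 2 => -24 * b ^+ 2 * c * s - 24 * b * d ^+ 2 * s + 12 * a * b * c + 12 * b * c * d + 8 * b * c * s - 32 * d ^+ 2 * s - 28 * a * c + 28 * c * d
  | _, _ => 36 * b ^+ 2 * c + 36 * b * d ^+ 2 - 12 * a * d - 24 * b * c + 60 * d ^+ 2 - 12 * c
  end.

Definition astds (a b c d s k : F) (i j : nat) : F :=
  match i, j with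
  | 0, 0 => 18 * a * b ^+ 2 * k + 15 * a * b * s + 3 * a * b * k - 18 * b ^+ 2 * c - 12 * a ^+ 2 + 6 * b * c + 4 * c
  | 0, 1 => 18 * b ^+ 3 * k - 18 * b ^+ 2 * d + 9 * b ^+ 2 * s + 3 * b ^+ 2 * k - 18 * a * b + 6 * b * d
  | 0, 2 => 6 * b ^+ 2 * s - 18 * b ^+ 2 * k - 12 * a * b - 3 * b * s - 3 * b * k + 4 * d
  | 0, 3 => -3 * b * s - 3 * a + k
  | 1, 0 => 18 * a * b * d * k - 6 * a * b * k ^+ 2 + 15 * a * d * s - 9 * a * d * k - 15 * a * s * k - 3 * a * k ^+ 2 - 18 * b * c * d + 6 * b * c * k - 12 * a * c + 18 * c * d - 14 * c * k
  | 1, 1 => 18 * b ^+ 2 * d * k - 6 * b ^+ 2 * k ^+ 2 - 18 * b * d ^+ 2 + 9 * b * d * s - 3 * b * d * k - 9 * b * s * k - 3 * b * k ^+ 2 - 18 * a * d + 6 * a * k + 18 * d ^+ 2 - 6 * d * k + 12 * c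
  | 1, 2 => 6 * b * d * s - 18 * b * d * k - 6 * b * s * k + 6 * b * k ^+ 2 - 12 * b * c - 3 * d * s + d * k + 3 * s * k + 3 * k ^+ 2
  | 1, 3 => -3 * d * s + 3 * s * k - 2 * k ^+ 2 - 3 * c
  | 2, 0 => -5 * a * b * s - 3 * a * b * k + 4 * a ^+ 2 - 6 * b * c - 2 * c
  | 2, 1 => -3 * b ^+ 2 * s - 3 * b ^+ 2 * k + 6 * a * b - 6 * b * d
  | 2, 2 => -2 * b ^+ 2 * s - 2 * a * b + b * s + 3 * b * k - 2 * a - 2 * d
  | 2, 3 => b * s + a + k
  | 3, 0 => -6 * a * b * k ^+ 2 - 15 * a * d * s - 3 * a * d * k - 15 * a * s * k - 3 * a * k ^+ 2 + 6 * b * c * k + 12 * a * c - 24 * c * d - 6 * c * k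
  | 3, 1 => -6 * b ^+ 2 * k ^+ 2 - 9 * b * d * s + 3 * b * d * k - 9 * b * s * k - 3 * b * k ^+ 2 + 6 * a * k + 18 * b * c - 24 * d ^+ 2 - 6 * d * k - 6 * c
  | 3, 2 => -6 * b * d * s - 6 * b * s * k + 6 * b * k ^+ 2 - 6 * b * c + 3 * d * s + 3 * d * k + 3 * s * k + 3 * k ^+ 2 - 6 * c
  | _, _ => 3 * d * s + 3 * s * k + 3 * c
  end.

(** * Equations in the six parameters of the solved relations *)

Section Chart.
Variables a b c d s k : F.
Hypothesis hT : forall cc lc, relT cc lc -> lc = s * cc.
Hypothesis hS : forall cl ll, relS cl ll -> ll = k * cl.
Hypothesis hV : forall cl ll cc lc, relV cl ll cc lc ->
  cl = a * cc + b * lc /\ ll = c * cc + d * lc.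

Lemma atriv_rows U : base1 x 1 U -> forall i, (i < 2)%N ->
  atriv a b c d s k i 0%N * triv_y1 U + atriv a b c d s k i 1%N * triv_y2 U = 0.
Proof.
move=> Ub; have := triv_rels Ub.
move=> [/hT e0 [/hT e1 [/hT e2 /hV[e3 f3]]]].
case=> [|[|i]] // _; cbv beta iota delta [atriv].
- lc (eqD (eqZ (2) e3) (eqD (eqZ (-b) e2) (eqZ (-2) e0))).
lc (eqD (eqZ (2) f3) (eqD (eqZ (-2) e1) (eqZ (-d - s) e2))).
Qed.

Lemma atriv_table0 U : base1 x 1 U ->
  triv_y1 U = 0 -> triv_y2 U = 0 ->
  forall s j, (s < 5)%N -> U s j != 0 -> False.
Proof.
move=> Ub; have := triv_rels Ub.
move=> [/hT e0 [/hT e1 [/hT e2 /hV[e3 f3]]]].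
move=> zy1 zy2.
have zy4 : triv_y4 U = 0 by apply: (@nat_mul0 _ char0 0); lc (eqD (eqZ 1 e0) (eqZ (s) zy1)).
have zy3 : triv_y3 U = 0 by apply: (@nat_mul0 _ char0 1); lc (eqD (eqZ 1 e2) (eqD (eqZ (2 * s) zy1) (eqZ (s) zy2))).
have zy5 : triv_y5 U = 0 by apply: (@nat_mul0 _ char0 1); lc (eqD (eqZ (2) e1) (eqD (eqZ (s) e2) (eqD (eqZ (2 * s ^+ 2) zy1) (eqZ (s ^+ 2) zy2)))).
by apply: (triv_table0 zy1 zy2 zy3 zy4 zy5).
Qed.

Lemma asign_rows U : base1 x (-1) U -> forall i, (i < 2)%N ->
  asign a b c d s k i 0%N * sign_y1 U + asign a b c d s k i 1%N * sign_y3 U = 0.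
Proof.
move=> Ub; have := sign_rels Ub.
move=> [/hS e0 [/hS e1 [/hS e2 /hV[e3 f3]]]].
case=> [|[|i]] // _; cbv beta iota delta [asign].
- lc (eqD (eqZ 1 e2) (eqD (eqZ (-k) e3) (eqD (eqZ (3 * k) e0) (eqZ (-2) e1)))).
lc (eqD (eqZ 1 f3) (eqZ (-1) e1)).
Qed.

Lemma asign_table0 U : base1 x (-1) U ->
  sign_y1 U = 0 -> sign_y3 U = 0 ->
  forall s j, (s < 5)%N -> U s j != 0 -> False.
Proof.
move=> Ub; have := sign_rels Ub.
move=> [/hS e0 [/hS e1 [/hS e2 /hV[e3 f3]]]].
move=> zy1 zy3.
have zy4 : sign_y4 U = 0 by apply: (@nat_mul0 _ char0 0); lc (eqD (eqZ 1 e0) (eqZ (k) zy1)).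
have zy5 : sign_y5 U = 0 by apply: (@nat_mul0 _ char0 0); lc (eqD (eqZ 1 e1) (eqZ (k) zy3)).
have zy2 : sign_y2 U = 0 by apply: (@nat_mul0 _ char0 0); lc (eqD (eqZ (-1) e3) (eqD (eqZ 1 e0) (eqD (eqZ (-3 * a + k) zy1) (eqZ (-3 * b) zy3)))).
by apply: (sign_table0 zy1 zy2 zy3 zy4 zy5).
Qed.

Lemma atwo_rows U : base2 x U -> (forall s, U s c01 + U s c02 + U s c03 = 0) -> forall i, (i < 2)%N ->
  atwo a b c d s k i 0%N * two_C1 U + atwo a b c d s k i 1%N * (two_K1 U - two_C1 U) = 0.
Proof.
move=> Ub H; have := two_rels Ub H.
move=> [/hV[e0 f0] [/hV[e1 f1] [/hT e2 [/hV[e3 f3] [/hV[e4 f4] /hS e5]]]]].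
case=> [|[|i]] // _; cbv beta iota delta [atwo].
- lc (eqD (eqZ (2) f4) (eqD (eqZ (-2) f1) (eqD (eqZ (6 * b * d - 2 * d) f3) (eqD (eqZ (-3 * b ^+ 2 * c - 3 * b * d ^+ 2 + 3 * a * d + d ^+ 2 - c) e2) (eqD (eqZ (6 * d) e1) (eqD (eqZ (6 * c) e0) (eqZ (6 * b * c) e3))))))).
lc (eqD (eqZ (2) e5) (eqD (eqZ (-2 * k) e4) (eqD (eqZ (-6 * b * k) e1) (eqD (eqZ (-6 * b ^+ 2 * k - 4 * d) f3) (eqD (eqZ (3 * a * b ^+ 2 * k + 3 * b ^+ 2 * d * k - 3 * a * b * k - 3 * b * d * k + 2 * d ^+ 2 - 2 * c) e2) (eqD (eqZ (6 * k) f0) (eqD (eqZ (-6 * a * b * k + 6 * d * k) e3) (eqD (eqZ (-6 * a * k) e0) (eqZ (-4) f1))))))))).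
Qed.

Lemma atwo_table0 U : base2 x U -> (forall s, U s c01 + U s c02 + U s c03 = 0) ->
  two_C1 U = 0 -> two_K1 U = 0 ->
  forall s, (s < 5)%N -> (U s c01 != 0) || (U s c02 != 0) -> False.
Proof.
move=> Ub H; have := two_rels Ub H.
move=> [/hV[e0 f0] [/hV[e1 f1] [/hT e2 [/hV[e3 f3] [/hV[e4 f4] /hS e5]]]]].
move=> zC1 zK1.
have zC2 : two_C2 U = 0 by apply: (@nat_mul0 _ char0 1); lc (eqD (eqZ 1 e2) (eqD (eqZ (2 * s) zC1) (eqZ (s) zK1))).
have zC3 : two_C3 U = 0 by apply: (@nat_mul0 _ char0 1); lc (eqD (eqZ (2) e3) (eqD (eqZ (-b) e2) (eqD (eqZ (-2 * b * s - 2 * a) zC1) (eqZ (-b * s + 2 * a) zK1)))).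
have zC4 : two_C4 U = 0 by apply: (@nat_mul0 _ char0 1); lc (eqD (eqZ (2) f3) (eqD (eqZ (-d) e2) (eqD (eqZ (-2 * d * s - 2 * c) zC1) (eqZ (-d * s + 2 * c) zK1)))).
have zL1 : two_L1 U = 0 by apply: (@nat_mul0 _ char0 1); lc (eqD (eqZ (2) e0) (eqD (eqZ (2 * b) e3) (eqD (eqZ (-b ^+ 2) e2) (eqD (eqZ (-2 * b ^+ 2 * s - 2 * a * b + 2 * a) zC1) (eqZ (-b ^+ 2 * s + 2 * a * b) zK1))))).
have zL3 : two_L3 U = 0 by apply: (@nat_mul0 _ char0 1); lc (eqD (eqZ (2) f0) (eqD (eqZ (2 * d) e3) (eqD (eqZ (-b * d) e2) (eqD (eqZ (-2 * b * d * s - 2 * a * d + 2 * c) zC1) (eqZ (-b * d * s + 2 * a * d) zK1))))).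
have zL2 : two_L2 U = 0 by apply: (@nat_mul0 _ char0 1); lc (eqD (eqZ (2) e1) (eqD (eqZ (2 * b) f3) (eqD (eqZ (-b * d + a) e2) (eqD (eqZ (-2 * b * d * s + 2 * a * s - 2 * b * c) zC1) (eqZ (-b * d * s + a * s + 2 * b * c) zK1))))).
have zL4 : two_L4 U = 0 by apply: (@nat_mul0 _ char0 1); lc (eqD (eqZ (2) f1) (eqD (eqZ (2 * d) f3) (eqD (eqZ (-d ^+ 2 + c) e2) (eqD (eqZ (-2 * d ^+ 2 * s - 2 * c * d + 2 * c * s) zC1) (eqZ (-d ^+ 2 * s + 2 * c * d + c * s) zK1))))).
have zK2 : two_K2 U = 0 by apply: (@nat_mul0 _ char0 1); lc (eqD (eqZ (-2) e4) (eqD (eqZ (-6 * b) e1) (eqD (eqZ (-6 * b ^+ 2) f3) (eqD (eqZ (3 * a * b ^+ 2 + 3 * b ^+ 2 * d - 3 * a * b - b * d) e2) (eqD (eqZ (2) f0) (eqD (eqZ (-6 * a * b + 2 * d) e3) (eqD (eqZ (-6 * a) e0) (eqD (eqZ (6 * a * b ^+ 2 * s + 6 * b ^+ 2 * d * s + 6 * a ^+ 2 * b - 6 * a * b * s + 6 * b ^+ 2 * c - 2 * b * d * s - 6 * a ^+ 2 - 2 * a * d + 2 * c) zC1) (eqZ (3 * a * b ^+ 2 * s + 3 * b ^+ 2 * d * s - 6 * a ^+ 2 * b - 3 * a * b * s - 6 * b ^+ 2 * c - b * d * s + 2 * a * d) zK1))))))))).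
by apply: (two_table0 H zC1 zC2 zC3 zC4 zK1 zK2 zL1 zL2 zL3 zL4).
Qed.

Lemma astd_rows U : base4 x 1 U -> (forall s, U s o0 + U s o1 + U s o2 + U s o3 = 0) -> forall i, (i < 4)%N ->
  astd a b c d s k i 0%N * std_t1 U + astd a b c d s k i 1%N * std_t2 U + astd a b c d s k i 2%N * std_s1 U + astd a b c d s k i 3%N * std_s2 U = 0.
Proof.
move=> Ub H; have := std_rels Ub H.
move=> [/hT e0 [/hT e1 [/hT e2 [/hV[e3 f3] [/hV[e4 f4] [/hV[e5 f5] [/hV[e6 f6] [/hS e7 [/hT e8 /hV[e9 f9]]]]]]]]]].
case=> [|[|[|[|i]]]] // _; cbv beta iota delta [astd].
- lc (eqD (eqZ (4) e7) (eqD (eqZ (2) f4) (eqD (eqZ (3) f3) (eqD (eqZ (-6 * b * k + 6 * d) e2) (eqD (eqZ (-9) e1) (eqD (eqZ (-2 * k) e4) (eqD (eqZ (-3 * k) e3) (eqZ (9 * k) e0)))))))).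
- lc (eqD (eqZ (4) e8) (eqD (eqZ (-8) e6) (eqD (eqZ (6 * b - 1) f3) (eqD (eqZ (-12 * b ^+ 2 * s + 12 * b * d - 2 * b * s - 2 * d) e2) (eqD (eqZ (-6 * b + 3) e1) (eqD (eqZ (8 * s) e5) (eqD (eqZ (-6 * b * s - s) e3) (eqD (eqZ (6 * b * s + 3 * s) e0) (eqD (eqZ (-2) f4) (eqZ (-2 * s) e4)))))))))).
- lc (eqD (eqZ (4) e9) (eqD (eqZ (-4 * b) e6) (eqD (eqZ (3 * b ^+ 2 + b) f3) (eqD (eqZ (6 * a * b ^+ 2 + 6 * b ^+ 2 * d - 2 * a * b + 8 * b * d) e2) (eqD (eqZ (-3 * b ^+ 2 - 3 * b) e1) (eqD (eqZ (-4) f5) (eqD (eqZ (3 * a * b - a + 3 * d) e3) (eqD (eqZ (-3 * a * b + 3 * a - 3 * d) e0) (eqD (eqZ (-4 * a) e5) (eqD (eqZ (2 * b) f4) (eqZ (-2 * a) e4))))))))))).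
lc (eqD (eqZ (4) f9) (eqD (eqZ (-4) f6) (eqD (eqZ (3 * b * d + 4 * d) f3) (eqD (eqZ (6 * b ^+ 2 * c + 6 * b * d ^+ 2 - 2 * b * c + 8 * d ^+ 2) e2) (eqD (eqZ (-3 * b * d - 6 * d) e1) (eqD (eqZ (-4 * d) e6) (eqD (eqZ (-4 * c) e5) (eqD (eqZ (3 * b * c - c) e3) (eqD (eqZ (-3 * b * c + 3 * c) e0) (eqD (eqZ (2 * d) f4) (eqZ (-2 * c) e4))))))))))).
Qed.

Lemma astd_table0 U : base4 x 1 U -> (forall s, U s o0 + U s o1 + U s o2 + U s o3 = 0) ->
  std_t1 U = 0 -> std_t2 U = 0 -> std_s1 U = 0 -> std_s2 U = 0 ->
  forall s j, (s < 5)%N -> U s j != 0 -> False.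
Proof.
move=> Ub H; have := std_rels Ub H.
move=> [/hT e0 [/hT e1 [/hT e2 [/hV[e3 f3] [/hV[e4 f4] [/hV[e5 f5] [/hV[e6 f6] [/hS e7 [/hT e8 /hV[e9 f9]]]]]]]]]].
move=> zt1 zt2 zs1 zs2.
have zt3 : std_t3 U = 0 by apply: (@nat_mul0 _ char0 0); lc (eqD (eqZ 1 e0) (eqZ (s) zt1)).
have zt4 : std_t4 U = 0 by apply: (@nat_mul0 _ char0 0); lc (eqD (eqZ 1 e1) (eqZ (s) zt2)).
have zk1 : std_k1 U = 0 by apply: (@nat_mul0 _ char0 1); lc (eqD (eqZ (-1) e2) (eqD (eqZ (-s) zt1) (eqD (eqZ 1 zt2) (eqD (eqZ (-4 * s) zs1) (eqZ (4) zs2))))).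
have zs3 : std_s3 U = 0 by apply: (@nat_mul0 _ char0 3); lc (eqD (eqZ 1 e3) (eqD (eqZ (2 * b) e2) (eqD (eqZ (-1) e0) (eqD (eqZ (2 * b * s - a - s) zt1) (eqD (eqZ (-3 * b) zt2) (eqD (eqZ (8 * b * s - 4 * a) zs1) (eqZ (-12 * b) zs2))))))).
have zs4 : std_s4 U = 0 by apply: (@nat_mul0 _ char0 3); lc (eqD (eqZ 1 f3) (eqD (eqZ (2 * d) e2) (eqD (eqZ (-1) e1) (eqD (eqZ (2 * d * s - c) zt1) (eqD (eqZ (-3 * d - s) zt2) (eqD (eqZ (8 * d * s - 4 * c) zs1) (eqZ (-12 * d) zs2))))))).
have zk2 : std_k2 U = 0 by apply: (@nat_mul0 _ char0 3); lc (eqD (eqZ (-2) e4) (eqD (eqZ (-1) e3) (eqD (eqZ (-2 * b) e2) (eqD (eqZ (3) e0) (eqD (eqZ (-2 * b * s - 5 * a + 3 * s) zt1) (eqD (eqZ (-3 * b) zt2) (eqD (eqZ (-8 * b * s + 16 * a) zs1) (eqZ (24 * b) zs2)))))))).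
have zk3 : std_k3 U = 0 by apply: (@nat_mul0 _ char0 3); lc (eqD (eqZ (-2) f4) (eqD (eqZ (-1) f3) (eqD (eqZ (-2 * d) e2) (eqD (eqZ (3) e1) (eqD (eqZ (-2 * d * s - 5 * c) zt1) (eqD (eqZ (-3 * d + 3 * s) zt2) (eqD (eqZ (-8 * d * s + 16 * c) zs1) (eqZ (24 * d) zs2)))))))).
have zl1 : std_l1 U = 0 by apply: (@nat_mul0 _ char0 3); lc (eqD (eqZ (4) e5) (eqD (eqZ (-3 * b) e3) (eqD (eqZ (-6 * b ^+ 2) e2) (eqD (eqZ (3 * b) e0) (eqD (eqZ (-6 * b ^+ 2 * s + 3 * a * b + 3 * b * s) zt1) (eqD (eqZ (9 * b ^+ 2) zt2) (eqD (eqZ (-24 * b ^+ 2 * s + 12 * a * b - 12 * a) zs1) (eqZ (36 * b ^+ 2) zs2)))))))).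
have zl3 : std_l3 U = 0 by apply: (@nat_mul0 _ char0 3); lc (eqD (eqZ (4) f5) (eqD (eqZ (-3 * d) e3) (eqD (eqZ (-6 * b * d) e2) (eqD (eqZ (3 * d) e0) (eqD (eqZ (-6 * b * d * s + 3 * a * d + 3 * d * s) zt1) (eqD (eqZ (9 * b * d) zt2) (eqD (eqZ (-24 * b * d * s + 12 * a * d - 12 * c) zs1) (eqZ (36 * b * d) zs2)))))))).
have zl2 : std_l2 U = 0 by apply: (@nat_mul0 _ char0 3); lc (eqD (eqZ (4) e6) (eqD (eqZ (-3 * b) f3) (eqD (eqZ (-6 * b * d) e2) (eqD (eqZ (3 * b) e1) (eqD (eqZ (-6 * b * d * s + 3 * b * c) zt1) (eqD (eqZ (9 * b * d + 3 * b * s) zt2) (eqD (eqZ (-24 * b * d * s + 12 * b * c) zs1) (eqZ (36 * b * d - 12 * a) zs2)))))))).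
have zl4 : std_l4 U = 0 by apply: (@nat_mul0 _ char0 3); lc (eqD (eqZ (4) f6) (eqD (eqZ (-3 * d) f3) (eqD (eqZ (-6 * d ^+ 2) e2) (eqD (eqZ (3 * d) e1) (eqD (eqZ (-6 * d ^+ 2 * s + 3 * c * d) zt1) (eqD (eqZ (9 * d ^+ 2 + 3 * d * s) zt2) (eqD (eqZ (-24 * d ^+ 2 * s + 12 * c * d) zs1) (eqZ (36 * d ^+ 2 - 12 * c) zs2)))))))).
by apply: (std_table0 H zk1 zk2 zk3 zl1 zl2 zl3 zl4 zs1 zs2 zs3 zs4 zt1 zt2 zt3 zt4).
Qed.

Lemma astds_rows U : base4 x (-1) U -> (forall s, U s o0 + U s o1 + U s o2 + U s o3 = 0) -> forall i, (i < 4)%N ->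
  astds a b c d s k i 0%N * stds_g1 U + astds a b c d s k i 1%N * stds_g2 U + astds a b c d s k i 2%N * stds_g3 U + astds a b c d s k i 3%N * stds_t1 U = 0.
Proof.
move=> Ub H; have := stds_rels Ub H.
move=> [/hV[e0 f0] [/hS e1 [/hV[e2 f2] [/hV[e3 f3] [/hT e4 [/hS e5 [/hS e6 [/hS e7 [/hV[e8 f8] /hV[e9 f9]]]]]]]]]].
case=> [|[|[|[|i]]]] // _; cbv beta iota delta [astds].
- lc (eqD (eqZ 1 e8) (eqD (eqZ (-1) e5) (eqD (eqZ (3 * b) e4) (eqD (eqZ (18 * b) e3) (eqD (eqZ (6 * b ^+ 2 + b) e1) (eqD (eqZ (6 * b ^+ 2 - 2 * b) f0) (eqD (eqZ (-6 * b ^+ 2 * k - 3 * b * s - b * k) e0) (eqD (eqZ (-6 * b * s + 12 * a) e2) (eqZ (-4) f2))))))))).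
- lc (eqD (eqZ 1 f8) (eqD (eqZ (2) e7) (eqD (eqZ (-3) e6) (eqD (eqZ (3 * d - 3 * k) e4) (eqD (eqZ (18 * d - 6 * k) e3) (eqD (eqZ (6 * b * d - 2 * b * k - 3 * d - k) e1) (eqD (eqZ (6 * b * d - 2 * b * k - 6 * d + 2 * k) f0) (eqD (eqZ (-6 * b * d * k + 2 * b * k ^+ 2 - 3 * d * s + 3 * d * k + 3 * s * k + k ^+ 2) e0) (eqD (eqZ (-6 * d * s + 6 * s * k + 12 * c) e2) (eqD (eqZ (2 * k) e5) (eqD (eqZ (-12) f3) (eqZ (8 * k) f2)))))))))))).
- lc (eqD (eqZ 1 e9) (eqD (eqZ (-1) e5) (eqD (eqZ (-b) e4) (eqD (eqZ (-b) e1) (eqD (eqZ (2 * b) f0) (eqD (eqZ (b * s + b * k - 2 * a) e0) (eqD (eqZ (2 * b * s + 2 * a) e2) (eqZ (2) f2)))))))).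
lc (eqD (eqZ (3) f9) (eqD (eqZ (-3) e6) (eqD (eqZ (-3 * d - 3 * k) e4) (eqD (eqZ (-6 * k) e3) (eqD (eqZ (-2 * b * k - d - k) e1) (eqD (eqZ (-2 * b * k + 8 * d + 2 * k) f0) (eqD (eqZ (2 * b * k ^+ 2 + 3 * d * s + d * k + 3 * s * k + k ^+ 2 - 6 * c) e0) (eqD (eqZ (6 * d * s + 6 * s * k + 6 * c) e2) (eqZ (6) f3))))))))).
Qed.

Lemma astds_table0 U : base4 x (-1) U -> (forall s, U s o0 + U s o1 + U s o2 + U s o3 = 0) ->
  stds_g1 U = 0 -> stds_g2 U = 0 -> stds_g3 U = 0 -> stds_t1 U = 0 ->
  forall s j, (s < 5)%N -> U s j != 0 -> False.
Proof.
move=> Ub H; have := stds_rels Ub H.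
move=> [/hV[e0 f0] [/hS e1 [/hV[e2 f2] [/hV[e3 f3] [/hT e4 [/hS e5 [/hS e6 [/hS e7 [/hV[e8 f8] /hV[e9 f9]]]]]]]]]].
move=> zg1 zg2 zg3 zt1.
have zk2 : stds_k2 U = 0 by apply: (@nat_mul0 _ char0 0); lc (eqD (eqZ (-1) e0) (eqD (eqZ (-3 * a) zg1) (eqD (eqZ (-3 * b) zg2) (eqZ 1 zg3)))).
have zk3 : stds_k3 U = 0 by apply: (@nat_mul0 _ char0 2); lc (eqD (eqZ (-2) f0) (eqD (eqZ 1 e1) (eqD (eqZ (-k) e0) (eqD (eqZ (-3 * a * k - 6 * c) zg1) (eqD (eqZ (-3 * b * k - 6 * d) zg2) (eqZ (3 * k) zg3)))))).
have zg4 : stds_g4 U = 0 by apply: (@nat_mul0 _ char0 2); lc (eqD (eqZ 1 e1) (eqD (eqZ 1 f0) (eqD (eqZ (-k) e0) (eqD (eqZ (-3 * a * k + 3 * c) zg1) (eqD (eqZ (-3 * b * k + 3 * d) zg2) (eqZ (3 * k) zg3)))))).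
have zs1 : stds_s1 U = 0 by apply: (@nat_mul0 _ char0 0); lc (eqD (eqZ 1 e2) (eqD (eqZ (a) zg1) (eqZ (b) zg3))).
have zs3 : stds_s3 U = 0 by apply: (@nat_mul0 _ char0 0); lc (eqD (eqZ 1 f2) (eqD (eqZ (c) zg1) (eqZ (d) zg3))).
have zs2 : stds_s2 U = 0 by apply: (@nat_mul0 _ char0 2); lc (eqD (eqZ (3) e3) (eqD (eqZ (b) e1) (eqD (eqZ (b) f0) (eqD (eqZ (-b * k) e0) (eqD (eqZ (-3 * a * b * k + 3 * b * c) zg1) (eqD (eqZ (-3 * b ^+ 2 * k + 3 * b * d + 3 * a) zg2) (eqZ (3 * b * k) zg3))))))).
have zs4 : stds_s4 U = 0 by apply: (@nat_mul0 _ char0 2); lc (eqD (eqZ (3) f3) (eqD (eqZ (d) e1) (eqD (eqZ (d) f0) (eqD (eqZ (-d * k) e0) (eqD (eqZ (-3 * a * d * k + 3 * c * d) zg1) (eqD (eqZ (-3 * b * d * k + 3 * d ^+ 2 + 3 * c) zg2) (eqZ (3 * d * k) zg3))))))).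
have zt2 : stds_t2 U = 0 by apply: (@nat_mul0 _ char0 2); lc (eqD (eqZ (3) e4) (eqD (eqZ (6) e3) (eqD (eqZ (2 * b + 1) e1) (eqD (eqZ (2 * b - 2) f0) (eqD (eqZ (-2 * b * k - 3 * s - k) e0) (eqD (eqZ (-6 * s) e2) (eqD (eqZ (-6 * a * b * k - 15 * a * s - 3 * a * k + 6 * b * c - 6 * c) zg1) (eqD (eqZ (-6 * b ^+ 2 * k + 6 * b * d - 9 * b * s - 3 * b * k + 6 * a - 6 * d) zg2) (eqD (eqZ (-6 * b * s + 6 * b * k + 3 * s + 3 * k) zg3) (eqZ (3 * s) zt1)))))))))).
have zt3 : stds_t3 U = 0 by apply: (@nat_mul0 _ char0 0); lc (eqD (eqZ 1 e5) (eqZ (k) zt1)).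
have zt4 : stds_t4 U = 0 by apply: (@nat_mul0 _ char0 2); lc (eqD (eqZ (3) e6) (eqD (eqZ (3 * k) e4) (eqD (eqZ (6 * k) e3) (eqD (eqZ (2 * b * k + k) e1) (eqD (eqZ (2 * b * k - 2 * k) f0) (eqD (eqZ (-2 * b * k ^+ 2 - 3 * s * k - k ^+ 2) e0) (eqD (eqZ (-6 * s * k) e2) (eqD (eqZ (-6 * a * b * k ^+ 2 - 15 * a * s * k - 3 * a * k ^+ 2 + 6 * b * c * k - 6 * c * k) zg1) (eqD (eqZ (-6 * b ^+ 2 * k ^+ 2 + 6 * b * d * k - 9 * b * s * k - 3 * b * k ^+ 2 + 6 * a * k - 6 * d * k) zg2) (eqD (eqZ (-6 * b * s * k + 6 * b * k ^+ 2 + 3 * s * k + 3 * k ^+ 2) zg3) (eqZ (3 * s * k) zt1))))))))))).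
have zk1 : stds_k1 U = 0 by apply: (@nat_mul0 _ char0 5); lc (eqD (eqZ (-3) e7) (eqD (eqZ (3) e6) (eqD (eqZ (3 * k) e4) (eqD (eqZ (6 * k) e3) (eqD (eqZ (2 * b * k + 4 * d + k) e1) (eqD (eqZ (2 * b * k + 4 * d - 2 * k) f0) (eqD (eqZ (-2 * b * k ^+ 2 - 4 * d * k - 3 * s * k - k ^+ 2) e0) (eqD (eqZ (-6 * s * k) e2) (eqD (eqZ (-3 * k) e5) (eqD (eqZ (12) f3) (eqD (eqZ (-12 * k) f2) (eqD (eqZ (-6 * a * b * k ^+ 2 - 12 * a * d * k - 15 * a * s * k - 3 * a * k ^+ 2 + 6 * b * c * k + 12 * c * d - 18 * c * k) zg1) (eqD (eqZ (-6 * b ^+ 2 * k ^+ 2 - 6 * b * d * k - 9 * b * s * k - 3 * b * k ^+ 2 + 6 * a * k + 12 * d ^+ 2 - 6 * d * k + 12 * c) zg2) (eqD (eqZ (-6 * b * s * k + 6 * b * k ^+ 2 + 3 * s * k + 3 * k ^+ 2) zg3) (eqZ (3 * s * k - 3 * k ^+ 2) zt1))))))))))))))).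
by apply: (stds_table0 H zg1 zg2 zg3 zg4 zk1 zk2 zk3 zs1 zs2 zs3 zs4 zt1 zt2 zt3 zt4).
Qed.

Lemma atriv_det : let A := atriv a b c d s k in A 0%N 0%N * A 1%N 1%N - A 0%N 1%N * A 1%N 0%N = 0.
Proof.
have e2 : (1 : F) ^+ 2 = 1 by ring.
have [U [Ub [i lt nz] _]] := one_dim reg e2; have H := atriv_rows Ub.
apply: (cramer2 (H 0%N isT) (H 1%N isT)); apply/norP => -[/negPn/eqP z0 /negPn/eqP z1].
exact: (atriv_table0 Ub z0 z1 lt nz).
Qed.

Lemma asign_det : let A := asign a b c d s k in A 0%N 0%N * A 1%N 1%N - A 0%N 1%N * A 1%N 0%N = 0.
Proof.
have e2 : ((-1) : F) ^+ 2 = 1 by ring.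
have [U [Ub [i lt nz] _]] := one_dim reg e2; have H := asign_rows Ub.
apply: (cramer2 (H 0%N isT) (H 1%N isT)); apply/norP => -[/negPn/eqP z0 /negPn/eqP z1].
exact: (asign_table0 Ub z0 z1 lt nz).
Qed.

(** The solutions fill the plane of the two unknowns, so one of them has only coordinate [j]
    nonzero, and row [i] applied to it leaves that entry. *)
Lemma atwo_entry i j : (i < 2)%N -> (j < 2)%N -> atwo a b c d s k i j = 0.
Proof.
move=> li lj; pose v (U : nat -> 'I_4 * 'I_4 -> F) n :=
  if n is 0%N then two_C1 U else two_K1 U - two_C1 U.
have [|U [Ub Us Ul [t [lt nz]]]] := @two_dim _ _ reg (fun U => v U (1 - j)%N).
  by move=> c1 c2 U1 U2; case: (1 - j)%N => [|n]; rewrite /v /two_C1 /two_K1; ring.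
have H := atwo_rows Ub Us li; have z := atwo_table0 Ub Us.
case: j lj Ul => [|[|j]] // _; rewrite /v /= => Ul; rewrite Ul in H.
  have /mul0[] // : atwo a b c d s k i 0 * two_C1 U = 0 by lc H.
  by move=> C0; case: (z C0 _ t lt nz); rewrite C0 in Ul; lc Ul.
have /mul0[] // : atwo a b c d s k i 1 * two_K1 U = 0 by lc H.
by move=> K0; case: (z Ul K0 t lt nz).
Qed.

(** Two conditions remove the unknowns [j3] and [j4]; a nonzero solution in the other two
    remains. *)
Lemma astd_minor i1 i2 j1 j2 j3 j4 : (i1 < 4)%N -> (i2 < 4)%N ->
  perm_eq [:: j1; j2; j3; j4] (iota 0 4) ->
  let A := astd a b c d s k in A i1 j1 * A i2 j2 - A i1 j2 * A i2 j1 = 0.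
Proof.
move=> l1 l2 pj /=; have e2 : (1 : F) ^+ 2 = 1 by ring.
pose v (U : nat -> 'I_4 -> F) n :=
  match n with 0 => std_t1 U | 1 => std_t2 U | 2 => std_s1 U | _ => std_s2 U end.
have vlin n c1 c2 c3 U1 U2 U3 : v (fun s j => c1 * U1 s j + c2 * U2 s j + c3 * U3 s j) n =
    c1 * v U1 n + c2 * v U2 n + c3 * v U3 n.
  by case: n => [|[|[|n]]]; rewrite /v /std_t1 /std_t2 /std_s1 /std_s2; ring.
have [|| U [Ub Us [Ul1 Ul2] [t [j [lt nz]]]]] :=
    @three_dim _ _ reg _ (fun U => v U j3) (fun U => v U j4) e2; try by move=> *; apply: vlin.
have H := astd_rows Ub Us.
have sumE i : astd a b c d s k i 0%N * v U 0%N + astd a b c d s k i 1%N * v U 1%N +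
    astd a b c d s k i 2%N * v U 2%N + astd a b c d s k i 3%N * v U 3%N =
    astd a b c d s k i j1 * v U j1 + astd a b c d s k i j2 * v U j2.
  transitivity (\sum_(j <- iota 0 4) astd a b c d s k i j * v U j).
    by rewrite !big_cons big_nil; ring.
  by rewrite -(perm_big _ pj) !big_cons big_nil /= Ul1 Ul2; ring.
apply: (cramer2 (u := v U j1) (v := v U j2)); rewrite -?sumE ?H //.
apply/norP => -[/negPn/eqP z1 /negPn/eqP z2].
have z n : (n < 4)%N -> v U n = 0.
  move=> ln; have : n \in [:: j1; j2; j3; j4] by rewrite (perm_mem pj) mem_iota.
  by rewrite !inE => /or4P[] /eqP->.
exact: (astd_table0 Ub Us (z 0%N isT) (z 1%N isT) (z 2%N isT) (z 3%N isT) lt nz).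
Qed.

Lemma astds_minor i1 i2 j1 j2 j3 j4 : (i1 < 4)%N -> (i2 < 4)%N ->
  perm_eq [:: j1; j2; j3; j4] (iota 0 4) ->
  let A := astds a b c d s k in A i1 j1 * A i2 j2 - A i1 j2 * A i2 j1 = 0.
Proof.
move=> l1 l2 pj /=; have e2 : ((-1) : F) ^+ 2 = 1 by ring.
pose v (U : nat -> 'I_4 -> F) n :=
  match n with 0 => stds_g1 U | 1 => stds_g2 U | 2 => stds_g3 U | _ => stds_t1 U end.
have vlin n c1 c2 c3 U1 U2 U3 : v (fun s j => c1 * U1 s j + c2 * U2 s j + c3 * U3 s j) n =
    c1 * v U1 n + c2 * v U2 n + c3 * v U3 n.
  by case: n => [|[|[|n]]]; rewrite /v /stds_g1 /stds_g2 /stds_g3 /stds_t1; ring.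
have [|| U [Ub Us [Ul1 Ul2] [t [j [lt nz]]]]] :=
    @three_dim _ _ reg _ (fun U => v U j3) (fun U => v U j4) e2; try by move=> *; apply: vlin.
have H := astds_rows Ub Us.
have sumE i : astds a b c d s k i 0%N * v U 0%N + astds a b c d s k i 1%N * v U 1%N +
    astds a b c d s k i 2%N * v U 2%N + astds a b c d s k i 3%N * v U 3%N =
    astds a b c d s k i j1 * v U j1 + astds a b c d s k i j2 * v U j2.
  transitivity (\sum_(j <- iota 0 4) astds a b c d s k i j * v U j).
    by rewrite !big_cons big_nil; ring.
  by rewrite -(perm_big _ pj) !big_cons big_nil /= Ul1 Ul2; ring.
apply: (cramer2 (u := v U j1) (v := v U j2)); rewrite -?sumE ?H //.
apply/norP => -[/negPn/eqP z1 /negPn/eqP z2].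
have z n : (n < 4)%N -> v U n = 0.
  move=> ln; have : n \in [:: j1; j2; j3; j4] by rewrite (perm_mem pj) mem_iota.
  by rewrite !inE => /or4P[] /eqP->.
exact: (astds_table0 Ub Us (z 0%N isT) (z 1%N isT) (z 2%N isT) (z 3%N isT) lt nz).
Qed.

End Chart.
End Polarized.

(** * The case x_1 + x_3 <> x_2 + x_4: solutions *)

Section CaseA.
Variable F : fieldType.
Hypothesis char0 : [pchar F] =i pred0.
Local Ltac lcfA pf := lcf char0 pf.
Local Ltac fldA := fld char0.
Local Ltac minorA pf k :=
  let h := fresh in have h := pf;
  cbv beta iota zeta delta [atriv asign atwo astd astds] in h; lcf char0 (eqZ k h).

(** The branches with [s], [k] or [c] zero are settled by minors that factor, as in the other case.
    With all three nonzero the minors no longer factor conveniently, and a power of [s] is shown to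
    lie in the ideal they generate. *)
Lemma chart_cases (a b c d s k : F) :
  (let A := atriv a b c d s k in A 0%N 0%N * A 1%N 1%N - A 0%N 1%N * A 1%N 0%N = 0) ->
  (let A := asign a b c d s k in A 0%N 0%N * A 1%N 1%N - A 0%N 1%N * A 1%N 0%N = 0) ->
  (forall i j, (i < 2)%N -> (j < 2)%N -> atwo a b c d s k i j = 0) ->
  (forall i1 i2 j1 j2 j3 j4, (i1 < 4)%N -> (i2 < 4)%N ->
    perm_eq [:: j1; j2; j3; j4] (iota 0 4) ->
    let A := astd a b c d s k in A i1 j1 * A i2 j2 - A i1 j2 * A i2 j1 = 0) ->
  (forall i1 i2 j1 j2 j3 j4, (i1 < 4)%N -> (i2 < 4)%N ->
    perm_eq [:: j1; j2; j3; j4] (iota 0 4) ->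
    let A := astds a b c d s k in A i1 j1 * A i2 j2 - A i1 j2 * A i2 j1 = 0) ->
  [/\ a = 0, c = 0, d = 0, s = 0 & k = 0] \/ [/\ a = 0, d = 0, s = 0, k = 0 & 3 * b + 1 = 0].
Proof.
move=> Htriv Hsign Htwo Hstd Hstds.
have [h|ns] := eqVneq s 0.
{
  subst s.
  have [h|nk] := eqVneq k 0.
  {
    subst k.
    have [h|n11] := eqVneq (c) 0.
    {
      have {}h : c = 0 by lcfA (eqZ 1 h).
      subst c.
      have [h|n12] := eqVneq (d) 0.
      {
        have {}h : d = 0 by lcfA (eqZ 1 h).
        subst d.
        have [h|n13] := eqVneq (a) 0.
        {
          have {}h : a = 0 by lcfA (eqZ 1 h).
          subst a.
          by left.
        }
        have h : ((a) ^+ 2) * (3 * b + 1) ^+ 1 = 0 by minorA (Hstds 0%N 2%N 2%N 3%N 0%N 1%N isT isT isT) ((- (1 / 6)) : F).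
        have k0 : a != 0 by apply: contra_neq n13 => hh; lcfA (eqZ 1 hh).
        have {}h : 3 * b + 1 = 0 by apply: (last_factor h); nonzero.
        move=> {k0}.
        have {}h : b = -1 / 3 by lcfA (eqZ (1 / 3) h).
        subst b.
        have h : ((a) ^+ 3) = 0 by minorA (Hstd 1%N 2%N 0%N 3%N 1%N 2%N isT isT isT) ((1 / 96) : F).
        have k0 : a != 0 by apply: contra_neq n13 => hh; lcfA (eqZ 1 hh).
        by exfalso; move/eqP: h; apply/negP; nonzero.
      }
      have h : ((d) ^+ 2) * (a) ^+ 1 = 0 by minorA (Hstds 0%N 3%N 1%N 3%N 0%N 2%N isT isT isT) ((- (1 / 72)) : F).
      have k0 : d != 0 by apply: contra_neq n12 => hh; lcfA (eqZ 1 hh).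
      have {}h : a = 0 by apply: (last_factor h); nonzero.
      move=> {k0}.
      have {}h : a = 0 by lcfA (eqZ 1 h).
      subst a.
      have h : ((d) ^+ 3) = 0 by minorA (Hstds 0%N 3%N 1%N 2%N 0%N 3%N isT isT isT) ((1 / 96) : F).
      have k0 : d != 0 by apply: contra_neq n12 => hh; lcfA (eqZ 1 hh).
      by exfalso; move/eqP: h; apply/negP; nonzero.
    }
    have h : ((c) ^+ 1) * (a) ^+ 1 = 0 by minorA (Htwo 0%N 0%N isT isT) ((- (1 / 6)) : F).
    have k0 : c != 0 by apply: contra_neq n11 => hh; lcfA (eqZ 1 hh).
    have {}h : a = 0 by apply: (last_factor h); nonzero.
    move=> {k0}.
    have {}h : a = 0 by lcfA (eqZ 1 h).
    subst a.
    have h : ((c) ^+ 1) * (d) ^+ 1 = 0 by minorA (eqD (Htwo 1%N 0%N isT isT) (eqZ (- (3)) (Htwo 1%N 1%N isT isT))) ((- (1 / 12)) : F).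
    have k0 : c != 0 by apply: contra_neq n11 => hh; lcfA (eqZ 1 hh).
    have {}h : d = 0 by apply: (last_factor h); nonzero.
    move=> {k0}.
    have {}h : d = 0 by lcfA (eqZ 1 h).
    subst d.
    have h : ((c) ^+ 2) * (3 * b + 1) ^+ 1 = 0 by minorA (Hstd 0%N 1%N 0%N 2%N 1%N 3%N isT isT isT) ((- (1 / 72)) : F).
    have k0 : c != 0 by apply: contra_neq n11 => hh; lcfA (eqZ 1 hh).
    have {}h : 3 * b + 1 = 0 by apply: (last_factor h); nonzero.
    move=> {k0}.
    have {}h : b = -1 / 3 by lcfA (eqZ (1 / 3) h).
    subst b.
    by right; split=> //; fldA.
  }
  have [h|n14] := eqVneq (c) 0.
  {
    have {}h : c = 0 by lcfA (eqZ 1 h).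
    subst c.
    have h : ((k) ^+ 1) * (a) ^+ 2 = 0 by minorA (Htwo 1%N 0%N isT isT) ((1 / 6) : F).
    have k0 : k != 0 by apply: contra_neq nk => hh; lcfA (eqZ 1 hh).
    have {}h : a = 0 by apply: (last_factor h); nonzero.
    move=> {k0}.
    have {}h : a = 0 by lcfA (eqZ 1 h).
    subst a.
    have h : ((k) ^+ 2) * (3 * d - k) ^+ 1 = 0 by minorA Hsign ((1 / 3) : F).
    have k0 : k != 0 by apply: contra_neq nk => hh; lcfA (eqZ 1 hh).
    have {}h : 3 * d - k = 0 by apply: (last_factor h); nonzero.
    move=> {k0}.
    have {}h : k = 3 * d by lcfA (eqZ (- (1)) h).
    subst k.
    have h : ((3 * d) ^+ 3) * (3 * b + 1) ^+ 1 = 0 by minorA (Hstd 1%N 3%N 1%N 3%N 0%N 2%N isT isT isT) ((1 / 12) : F).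
    have k0 : 3 * d != 0 by apply: contra_neq nk => hh; lcfA (eqZ 1 hh).
    have {}h : 3 * b + 1 = 0 by apply: (last_factor h); nonzero.
    move=> {k0}.
    have {}h : b = -1 / 3 by lcfA (eqZ (1 / 3) h).
    subst b.
    have h : ((3 * d) ^+ 3) = 0 by minorA (Hstds 0%N 1%N 1%N 2%N 0%N 3%N isT isT isT) ((- (9 / 56)) : F).
    have k0 : 3 * d != 0 by apply: contra_neq nk => hh; lcfA (eqZ 1 hh).
    by exfalso; move/eqP: h; apply/negP; nonzero.
  }
  have h : ((c) ^+ 1) * (a) ^+ 1 = 0 by minorA (Htwo 0%N 0%N isT isT) ((- (1 / 6)) : F).
  have k0 : c != 0 by apply: contra_neq n14 => hh; lcfA (eqZ 1 hh).
  have {}h : a = 0 by apply: (last_factor h); nonzero.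
  move=> {k0}.
  have {}h : a = 0 by lcfA (eqZ 1 h).
  subst a.
  have h : ((k) ^+ 1 * (c) ^+ 1) = 0 by minorA (Htwo 1%N 0%N isT isT) ((- (1 / 6)) : F).
  have k0 : k != 0 by apply: contra_neq nk => hh; lcfA (eqZ 1 hh).
  have k1 : c != 0 by apply: contra_neq n14 => hh; lcfA (eqZ 1 hh).
  by exfalso; move/eqP: h; apply/negP; nonzero.
}
have [h|nk] := eqVneq k 0.
{
  subst k.
  have [h|n15] := eqVneq (d) 0.
  {
    have {}h : d = 0 by lcfA (eqZ 1 h).
    subst d.
    have h : ((s) ^+ 1) * (c) ^+ 1 = 0 by minorA (Htwo 1%N 0%N isT isT) ((1 / 6) : F).
    have k0 : s != 0 by apply: contra_neq ns => hh; lcfA (eqZ 1 hh).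
    have {}h : c = 0 by apply: (last_factor h); nonzero.
    move=> {k0}.
    have {}h : c = 0 by lcfA (eqZ 1 h).
    subst c.
    have h : ((s) ^+ 2) * (3 * a + s) ^+ 1 = 0 by minorA Htriv ((1 / 2) : F).
    have k0 : s != 0 by apply: contra_neq ns => hh; lcfA (eqZ 1 hh).
    have {}h : 3 * a + s = 0 by apply: (last_factor h); nonzero.
    move=> {k0}.
    have {}h : s = -3 * a by lcfA (eqZ 1 h).
    subst s.
    have [h|n16] := eqVneq (b) 0.
    {
      have {}h : b = 0 by lcfA (eqZ 1 h).
      subst b.
      have h : ((-3 * a) ^+ 3) = 0 by minorA (Hstd 0%N 1%N 0%N 1%N 2%N 3%N isT isT isT) ((1 / 42) : F).
      have k0 : -3 * a != 0 by apply: contra_neq ns => hh; lcfA (eqZ 1 hh).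
      by exfalso; move/eqP: h; apply/negP; nonzero.
    }
    have h : ((-3 * a) ^+ 2 * (b) ^+ 1) * (b - 1) ^+ 1 = 0 by minorA (Hstd 0%N 2%N 1%N 3%N 0%N 2%N isT isT isT) ((- (1 / 108)) : F).
    have k0 : -3 * a != 0 by apply: contra_neq ns => hh; lcfA (eqZ 1 hh).
    have k1 : b != 0 by apply: contra_neq n16 => hh; lcfA (eqZ 1 hh).
    have {}h : b - 1 = 0 by apply: (last_factor h); nonzero.
    move=> {k0 k1}.
    have {}h : b = 1 by lcfA (eqZ 1 h).
    subst b.
    have h : ((-3 * a) ^+ 3) = 0 by minorA (Hstd 0%N 1%N 0%N 1%N 2%N 3%N isT isT isT) ((- (1 / 48)) : F).
    have k0 : -3 * a != 0 by apply: contra_neq ns => hh; lcfA (eqZ 1 hh).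
    by exfalso; move/eqP: h; apply/negP; nonzero.
  }
  have h : ((d) ^+ 1) * (c) ^+ 1 = 0 by minorA (eqD (Htwo 1%N 0%N isT isT) (eqZ (- (3)) (Htwo 1%N 1%N isT isT))) ((- (1 / 12)) : F).
  have k0 : d != 0 by apply: contra_neq n15 => hh; lcfA (eqZ 1 hh).
  have {}h : c = 0 by apply: (last_factor h); nonzero.
  move=> {k0}.
  have {}h : c = 0 by lcfA (eqZ 1 h).
  subst c.
  have h : ((s) ^+ 1 * (d) ^+ 2) = 0 by minorA (Htwo 1%N 0%N isT isT) ((- (1 / 6)) : F).
  have k0 : s != 0 by apply: contra_neq ns => hh; lcfA (eqZ 1 hh).
  have k1 : d != 0 by apply: contra_neq n15 => hh; lcfA (eqZ 1 hh).
  by exfalso; move/eqP: h; apply/negP; nonzero.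
}
have [h|nc] := eqVneq c 0.
{
  subst c.
  have [h|n17] := eqVneq (d + s) 0.
  {
    have {}h : s = -d by lcfA (eqZ 1 h).
    subst s.
    have [h|n18] := eqVneq (a - k) 0.
    {
      have {}h : k = a by lcfA (eqZ (- (1)) h).
      subst k.
      have [h|n19] := eqVneq (a + d) 0.
      {
        have {}h : a = -d by lcfA (eqZ 1 h).
        subst a.
        have h : ((-d) ^+ 3) * (3 * b + 2) ^+ 1 = 0 by minorA (Htwo 0%N 0%N isT isT) ((1 / 3) : F).
        have k0 : -d != 0 by apply: contra_neq ns => hh; lcfA (eqZ 1 hh).
        have {}h : 3 * b + 2 = 0 by apply: (last_factor h); nonzero.
        move=> {k0}.
        have {}h : b = -2 / 3 by lcfA (eqZ (1 / 3) h).
        subst b.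
        have h : ((-d) ^+ 4) = 0 by minorA (Hstd 0%N 1%N 0%N 2%N 1%N 3%N isT isT isT) ((1 / 64) : F).
        have k0 : -d != 0 by apply: contra_neq ns => hh; lcfA (eqZ 1 hh).
        by exfalso; move/eqP: h; apply/negP; nonzero.
      }
      have h : ((-d) ^+ 3 * (a) ^+ 1 * (a + d) ^+ 1) * (3 * b + 4) ^+ 1 = 0 by minorA (Hstd 0%N 3%N 0%N 2%N 1%N 3%N isT isT isT) ((- (1 / 72)) : F).
      have k0 : -d != 0 by apply: contra_neq ns => hh; lcfA (eqZ 1 hh).
      have k1 : a != 0 by apply: contra_neq nk => hh; lcfA (eqZ 1 hh).
      have k2 : a + d != 0 by apply: contra_neq n19 => hh; lcfA (eqZ 1 hh).
      have {}h : 3 * b + 4 = 0 by apply: (last_factor h); nonzero.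
      move=> {k0 k1 k2}.
      have {}h : b = -4 / 3 by lcfA (eqZ (1 / 3) h).
      subst b.
      have h : ((-d) ^+ 2) * (9 * a + 15 * d) ^+ 1 = 0 by minorA (Htwo 0%N 0%N isT isT) ((1) : F).
      have k0 : -d != 0 by apply: contra_neq ns => hh; lcfA (eqZ 1 hh).
      have {}h : 9 * a + 15 * d = 0 by apply: (last_factor h); nonzero.
      move=> {k0}.
      have {}h : a = -5 / 3 * d by lcfA (eqZ (1 / 9) h).
      subst a.
      have h : ((-d) ^+ 3) = 0 by minorA (eqD (Htwo 1%N 0%N isT isT) (eqZ (- (3)) (Htwo 1%N 1%N isT isT))) ((9 / 800) : F).
      have k0 : -d != 0 by apply: contra_neq ns => hh; lcfA (eqZ 1 hh).
      by exfalso; move/eqP: h; apply/negP; nonzero.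
    }
    have h : ((k) ^+ 1 * (a - k) ^+ 1) * (3 * d - k) ^+ 1 = 0 by minorA Hsign ((- (1 / 3)) : F).
    have k0 : k != 0 by apply: contra_neq nk => hh; lcfA (eqZ 1 hh).
    have k1 : a - k != 0 by apply: contra_neq n18 => hh; lcfA (eqZ 1 hh).
    have {}h : 3 * d - k = 0 by apply: (last_factor h); nonzero.
    move=> {k0 k1}.
    have {}h : k = 3 * d by lcfA (eqZ (- (1)) h).
    subst k.
    have h : ((-d) ^+ 4) * (576 * b + 96) ^+ 1 = 0 by minorA (Hstds 1%N 3%N 2%N 3%N 0%N 1%N isT isT isT) ((1 / 3) : F).
    have k0 : -d != 0 by apply: contra_neq ns => hh; lcfA (eqZ 1 hh).
    have {}h : 576 * b + 96 = 0 by apply: (last_factor h); nonzero.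
    move=> {k0}.
    have {}h : b = -1 / 6 by lcfA (eqZ (1 / 576) h).
    subst b.
    have h : ((-d) ^+ 1) * (-108 * a + 189 * d) ^+ 1 = 0 by minorA (Hstd 0%N 1%N 1%N 3%N 0%N 2%N isT isT isT) ((1) : F).
    have k0 : -d != 0 by apply: contra_neq ns => hh; lcfA (eqZ 1 hh).
    have {}h : -108 * a + 189 * d = 0 by apply: (last_factor h); nonzero.
    move=> {k0}.
    have {}h : a = 7 / 4 * d by lcfA (eqZ (- (1 / 108)) h).
    subst a.
    have h : ((-d) ^+ 3) = 0 by minorA (Htwo 0%N 0%N isT isT) ((- (4 / 81)) : F).
    have k0 : -d != 0 by apply: contra_neq ns => hh; lcfA (eqZ 1 hh).
    by exfalso; move/eqP: h; apply/negP; nonzero.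
  }
  have h : ((s) ^+ 1 * (d + s) ^+ 1) * (3 * a + s) ^+ 1 = 0 by minorA Htriv ((1 / 2) : F).
  have k0 : s != 0 by apply: contra_neq ns => hh; lcfA (eqZ 1 hh).
  have k1 : d + s != 0 by apply: contra_neq n17 => hh; lcfA (eqZ 1 hh).
  have {}h : 3 * a + s = 0 by apply: (last_factor h); nonzero.
  move=> {k0 k1}.
  have {}h : s = -3 * a by lcfA (eqZ 1 h).
  subst s.
  have [h|n20] := eqVneq (a - k) 0.
  {
    have {}h : k = a by lcfA (eqZ (- (1)) h).
    subst k.
    have [h|n21] := eqVneq (d) 0.
    {
      have {}h : d = 0 by lcfA (eqZ 1 h).
      subst d.
      have h : ((-3 * a) ^+ 3) * (3 * b - 1) ^+ 1 = 0 by minorA (eqD (Htwo 1%N 0%N isT isT) (eqZ (- (3)) (Htwo 1%N 1%N isT isT))) ((9 / 2) : F).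
      have k0 : -3 * a != 0 by apply: contra_neq ns => hh; lcfA (eqZ 1 hh).
      have {}h : 3 * b - 1 = 0 by apply: (last_factor h); nonzero.
      move=> {k0}.
      have {}h : b = 1 / 3 by lcfA (eqZ (1 / 3) h).
      subst b.
      have h : ((-3 * a) ^+ 3) = 0 by minorA (Hstd 0%N 1%N 0%N 1%N 2%N 3%N isT isT isT) ((1 / 32) : F).
      have k0 : -3 * a != 0 by apply: contra_neq ns => hh; lcfA (eqZ 1 hh).
      by exfalso; move/eqP: h; apply/negP; nonzero.
    }
    have h : ((-3 * a) ^+ 3 * (d) ^+ 2) * (3 * b + 4) ^+ 1 = 0 by minorA (Hstd 0%N 3%N 0%N 2%N 1%N 3%N isT isT isT) ((- (1 / 32)) : F).
    have k0 : -3 * a != 0 by apply: contra_neq ns => hh; lcfA (eqZ 1 hh).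
    have k1 : d != 0 by apply: contra_neq n21 => hh; lcfA (eqZ 1 hh).
    have {}h : 3 * b + 4 = 0 by apply: (last_factor h); nonzero.
    move=> {k0 k1}.
    have {}h : b = -4 / 3 by lcfA (eqZ (1 / 3) h).
    subst b.
    have h : ((-3 * a) ^+ 3) = 0 by minorA (Hstds 0%N 2%N 0%N 3%N 1%N 2%N isT isT isT) ((- (3 / 32)) : F).
    have k0 : -3 * a != 0 by apply: contra_neq ns => hh; lcfA (eqZ 1 hh).
    by exfalso; move/eqP: h; apply/negP; nonzero.
  }
  have h : ((k) ^+ 1 * (a - k) ^+ 1) * (3 * d - k) ^+ 1 = 0 by minorA Hsign ((- (1 / 3)) : F).
  have k0 : k != 0 by apply: contra_neq nk => hh; lcfA (eqZ 1 hh).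
  have k1 : a - k != 0 by apply: contra_neq n20 => hh; lcfA (eqZ 1 hh).
  have {}h : 3 * d - k = 0 by apply: (last_factor h); nonzero.
  move=> {k0 k1}.
  have {}h : k = 3 * d by lcfA (eqZ (- (1)) h).
  subst k.
  have h : ((-3 * a) ^+ 2 * (3 * d) ^+ 3) * (3 * b + 4) ^+ 1 = 0 by minorA (Hstd 0%N 3%N 0%N 2%N 1%N 3%N isT isT isT) ((3 / 32) : F).
  have k0 : -3 * a != 0 by apply: contra_neq ns => hh; lcfA (eqZ 1 hh).
  have k1 : 3 * d != 0 by apply: contra_neq nk => hh; lcfA (eqZ 1 hh).
  have {}h : 3 * b + 4 = 0 by apply: (last_factor h); nonzero.
  move=> {k0 k1}.
  have {}h : b = -4 / 3 by lcfA (eqZ (1 / 3) h).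
  subst b.
  have h : ((3 * d) ^+ 1) * (-976 / 3 * a - 144 * d) ^+ 1 = 0 by minorA (Hstds 0%N 2%N 1%N 3%N 0%N 2%N isT isT isT) ((1) : F).
  have k0 : 3 * d != 0 by apply: contra_neq nk => hh; lcfA (eqZ 1 hh).
  have {}h : -976 / 3 * a - 144 * d = 0 by apply: (last_factor h); nonzero.
  move=> {k0}.
  have {}h : a = -27 / 61 * d by lcfA (eqZ (- (3 / 976)) h).
  subst a.
  have h : ((81 / 61 * d) ^+ 3) = 0 by minorA (Htwo 0%N 0%N isT isT) ((- (2187 / 13664)) : F).
  have k0 : 81 / 61 * d != 0 by apply: contra_neq ns => hh; lcfA (eqZ 1 hh).
  by exfalso; move/eqP: h; apply/negP; nonzero.
}
(* This combination cancels every term of the first row of [atwo] that contains [s]. *)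
have h : c * (3 * b - 1) * (a + d) = 0 by minorA (eqD (Htwo 0%N 0%N isT isT) (eqZ (- (3)) (Htwo 0%N 1%N isT isT))) ((1 / 6) : F).
have [h'|nad] := eqVneq (a + d) 0.
{
  have {}h : d = - a by lcfA (eqZ 1 h').
  subst d => {h'}.
  have {}h : (k - s) * (c - a ^+ 2) = 0 by minorA (Htwo 1%N 0%N isT isT) ((- (1 / 6)) : F).
  have {}h : k = s.
  {
    case/mul0: h => h; first by lcfA (eqZ 1 h).
    have {}h : c = a ^+ 2 by lcfA (eqZ 1 h).
    subst c.
    have na : a ^+ 2 != 0 by [].
    (* This equation and the next differ only by [s] against [k]. Their difference gives [s = k],
       unless [b ^+ 2 + b + 1] vanishes, which forces [a = 0] against [c != 0]. *)
    have h : a ^+ 2 * (3 * s * (b ^+ 2 + b + 1) - 2 * a) = 0 by minorA (Htwo 0%N 0%N isT isT) ((1 / 3) : F).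
    have h1 : a ^+ 2 * (3 * k * (b ^+ 2 + b + 1) - 2 * a) = 0 by minorA (eqD (Htwo 1%N 0%N isT isT) (eqZ (- (3)) (Htwo 1%N 1%N isT isT))) ((- (1 / 6)) : F).
    case/mul0: h => [h|h]; first by rewrite h eqxx in na.
    case/mul0: h1 => [h1|h1]; first by rewrite h1 eqxx in na.
    have : 3 * ((k - s) * (b ^+ 2 + b + 1)) = 0 by lcfA (eqD (eqZ 1 h1) (eqZ (-1) h)).
    move/(nat_mul0 char0)/mul0 => [h2|h2]; first by lcfA (eqZ 1 h2).
    have : 2 * a = 0 by rewrite h2 in h; lcfA (eqZ (-1) h).
    by move/(nat_mul0 char0) => a0; rewrite a0 expr0n eqxx in na.
  }
  subst k.
  have g0 := Htriv; cbv beta iota zeta delta [atriv asign atwo astd astds] in g0.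
  have g1 := (Htwo 0%N 0%N isT isT); cbv beta iota zeta delta [atriv asign atwo astd astds] in g1.
  have g2 := (Hstds 0%N 1%N 2%N 3%N 0%N 1%N isT isT isT); cbv beta iota zeta delta [atriv asign atwo astd astds] in g2.
  have g3 := (Hstd 0%N 1%N 1%N 3%N 0%N 2%N isT isT isT); cbv beta iota zeta delta [atriv asign atwo astd astds] in g3.
  have g4 := (Hstd 0%N 1%N 2%N 3%N 0%N 1%N isT isT isT); cbv beta iota zeta delta [atriv asign atwo astd astds] in g4.
  (* An ideal membership certificate: [s ^+ 4] is a combination of the five minors, against
     [s != 0]. *)
  have h : (16 * 16 * 12 * 15) * s ^+ 4 = 0.
    lcfA (eqD (eqZ ((16 * 12 * 3 * 23) * b * s + (16 * 18 * 11) * a + (16 * 24 * 21) * s) g0)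
    (eqD (eqZ (- (16 * 16 * 27) * b * s - (16 * 16 * 27) * a + (16 * 16 * 6 * 7) * s) g1)
    (eqD (eqZ (- (16 * 12 * 59) * b * s - (16 * 6 * 61) * a - (16 * 24 * 13) * s) g2)
    (eqD (eqZ (- (8 * 17) * b * s ^+ 2 - (16 * 11) * a * s + 96 * s ^+ 2 + 40 * c) g3)
    (eqZ (- (9 * 17) * b * s - 45 * a - (3 * 71) * s) g4))))).
  by exfalso; move/eqP: h; apply/negP; nonzero; exact: (natF_neq0 char0 _).
}
have {}h : 3 * b - 1 = 0.
  case/mul0: h => [/mul0[h|//]|h]; first by rewrite h eqxx in nc.
  by rewrite h eqxx in nad.
have {}h : b = 1 / 3 by lcfA (eqZ (1 / 3) h).
subst b.
have g0 := (Htwo 0%N 0%N isT isT); cbv beta iota zeta delta [atriv asign atwo astd astds] in g0.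
have g1 := (Hstd 1%N 2%N 1%N 3%N 0%N 2%N isT isT isT); cbv beta iota zeta delta [atriv asign atwo astd astds] in g1.
have g2 := Htriv; cbv beta iota zeta delta [atriv asign atwo astd astds] in g2.
have g3 := (Hstds 0%N 2%N 1%N 3%N 0%N 2%N isT isT isT); cbv beta iota zeta delta [atriv asign atwo astd astds] in g3.
have g4 := (Hstd 0%N 2%N 1%N 3%N 0%N 2%N isT isT isT); cbv beta iota zeta delta [atriv asign atwo astd astds] in g4.
have g5 := (Hstds 0%N 2%N 1%N 2%N 0%N 3%N isT isT isT); cbv beta iota zeta delta [atriv asign atwo astd astds] in g5.
have g6 := (Hstd 0%N 1%N 1%N 3%N 0%N 2%N isT isT isT); cbv beta iota zeta delta [atriv asign atwo astd astds] in g6.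
have g7 := (Hstds 0%N 2%N 2%N 3%N 0%N 1%N isT isT isT); cbv beta iota zeta delta [atriv asign atwo astd astds] in g7.
(* The same conclusion with [b = 1/3], from eight equations. *)
have h : (16 * 16 * 27 * 27) * s ^+ 4 = 0.
  lcfA (eqD (eqZ (- (16 * 18 * 27 * 5) * a + (16 * 18 * 27 * 7) * d + (16 * 12 * 27 * 5) * s - (16 * 24 * 27) * k) g0)
  (eqD (eqZ ((12 * 27 * 15 * 7) * a * s + (12 * 3 * 139) * d * s - (27 * 5 * 167) * s ^+ 2 - (15 * 311) * s * k - (18 * 27) * c) g1)
  (eqD (eqZ (- (16 * 18 * 27 * 3) * a - (16 * 18 * 27 * 3) * d + (16 * 12 * 27 * 3) * s - (16 * 12 * 27 * 3) * k) g2)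
  (eqD (eqZ ((16 * 16 * 18 * 9 * 5) * a * s + (16 * 18 * 27 * 3 * 11) * d * s + (16 * 27 * 67) * s ^+ 2) g3)
  (eqD (eqZ ((24 * 15 * 43) * a * s + (12 * 9 * 241) * d * s + (27 * 3 * 11) * s ^+ 2 - (27 * 103) * s * k - (18 * 27 * 5) * c) g4)
  (eqD (eqZ (- (24 * 27 * 15 * 7) * a * s + (24 * 27 * 9 * 17) * d * s - (18 * 9 * 5 * 37) * s ^+ 2 + (18 * 27 * 5 * 17) * s * k - (12 * 27 * 27) * c) g5)
  (eqD (eqZ (- (20 * 13 * 17) * s ^+ 2) g6)
  (eqZ (- (16 * 12 * 27) * s ^+ 2) g7)))))))).
by exfalso; move/eqP: h; apply/negP; nonzero; exact: (natF_neq0 char0 _).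
Qed.

(** For the trivial module the value on [(ab)(cd)] and a common value on the other four shapes are
    independent, giving two dimensions in place of one. At [p = 1] this is the excluded member
    [s = -1] of family (b). *)
Lemma not_regular_f (x : 6.-tuple F) (p : F) : regular_at x 4 ->
  x = [:: p; - p; p; - p; 1; 0] :> seq F -> False.
Proof.
move=> reg xE; have e2 : (1 : F) ^+ 2 = 1 by ring.
have [U [_ _ H]] := one_dim reg e2.
pose V (a b : F) (s : nat) (j : unit) : F := if s == 2%N then a else b.
have Vb a b : base1 x 1 (V a b) by rewrite /V /base1 /= xE /=; split; ring.
have [c1 h1] := H _ (Vb 1 0); have [c2 h2] := H _ (Vb 0 1).
have := (h1 2%N isT, h1 4%N isT, h2 2%N isT, h2 4%N isT); rewrite /V /= => -[[[a1 a2] a3] a4].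
have : (1 : F) = 0.
  rewrite [LHS](_ : 1 = 1 * 1); last by rewrite mul1r.
  by rewrite {1}a1 a4 mulrACA (mulrC (U 2%N tt)) -mulrACA -a2 mul0r.
by move/eqP; rewrite oner_eq0.
Qed.

(** The first equation of [relV] is left with [n12] times the sum, and [n12] is invertible; the
    second then determines the difference. *)
Lemma relV0 (p q r P Q R cl ll : F) : p - q != 0 ->
  relV p q r P Q R cl ll 0 0 -> cl = 0 /\ ll = 0.
Proof.
rewrite /relV /n12 => npq [h1 h2].
have {}h1 : cl + ll = 0.
  have {h1 h2} : 3 * ((p - q) * (cl + ll)) = 0 by lc (eqZ (-1) h1).
  by move/(nat_mul0 char0)/mul0 => [h|//]; rewrite h eqxx in npq.
have h : cl - ll = 0 by lc (eqD h2 (eqZ (n22 P Q R) h1)).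
by split; apply: (@nat_mul0 _ char0 1); [lc (eqD h1 h) | lc (eqD h1 (eqZ (-1) h))].
Qed.

Lemma caseA (x : 6.-tuple F) (p q r P Q R : F) : regular_at x 4 ->
  x = [:: p + P; q + Q; p - P; q - Q; r + R; r - R] :> seq F -> p - q != 0 -> in_families x.
Proof.
move=> reg xE npq.
have n12_neq0 : n12 p q != 0 by rewrite mulf_neq0 // (natF_neq0 char0).
(* With [nT = -1], [relT] makes all its commutative arguments zero; then [relV0] kills the rest, and
   the trivial module would have no nonzero solution. The sign module handles [nS] alike. *)
have nT_neq0 : 1 + nT p q r != 0.
  apply/negP => /eqP nT1; have e2 : (1 : F) ^+ 2 = 1 by ring.
  have [U [Ub [i lt nz] _]] := one_dim reg e2.
  have T0 cc lc : relT p q r cc lc -> cc = 0.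
    by rewrite /relT => h; apply: (@nat_mul0 _ char0 1); lc (eqD h (eqZ (cc + lc) nT1)).
  have [/T0 y1 [/T0 y3 [/T0 y2 hV]]] := triv_rels xE Ub.
  rewrite y1 in y2; have {}y2 : triv_y2 U = 0 by lc y2.
  rewrite y1 y2 y3 !subr0 oppr0 in hV; have [y4 y5] := relV0 npq hV.
  exact: (triv_table0 char0 y1 y2 y3 y4 y5 lt nz).
have nS_neq0 : 1 + nS P Q R != 0.
  apply/negP => /eqP nS1; have e2 : (-1 : F) ^+ 2 = 1 by ring.
  have [U [Ub [i lt nz] _]] := one_dim reg e2.
  have S0 cl ll : relS P Q R cl ll -> cl = 0.
    by rewrite /relS => h; apply: (@nat_mul0 _ char0 1); lc (eqD h (eqZ (cl + ll) nS1)).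
  have [/S0 y1 [/S0 y3 [/S0 y24 hV]]] := sign_rels xE Ub.
  rewrite y1 y3 !mulr0 in hV; have [y42 y5] := relV0 npq hV.
  have y4 : sign_y4 U = 0 by apply: (@nat_mul0 _ char0 2); lc (eqD y24 y42).
  have y2 : sign_y2 U = 0 by rewrite y4 in y42; lc (eqZ (-1) y42).
  exact: (sign_table0 char0 y1 y2 y3 y4 y5 lt nz).
pose N11 := n11 p q r; pose N12 := n12 p q; pose N21 := n21 P Q; pose N22 := n22 P Q R.
have two_neq0 : (2 : F) != 0 by apply: (natF_neq0 char0 1).
(* The solution of the two equations [relV] for [cl] and [ll]: the first gives their sum after
   division by [N12], the second then their difference. *)
pose a := ((1 + N22) * (1 - N11) / N12 + N21) / 2.
pose b := (- ((1 + N22) * (1 + N11) / N12) + N21) / 2.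
pose c := ((1 - N22) * (1 - N11) / N12 - N21) / 2.
pose d := (- ((1 - N22) * (1 + N11) / N12) - N21) / 2.
pose s := (1 - nT p q r) / (1 + nT p q r); pose k := (1 - nS P Q R) / (1 + nS P Q R).
have hT cc lc : relT p q r cc lc -> lc = s * cc.
  by rewrite /relT /s => h; apply: (mulfI nT_neq0); rewrite -h mulrA mulrCA mulfV // mulr1 mulrC.
have hS cl ll : relS P Q R cl ll -> ll = k * cl.
  by rewrite /relS /k => h; apply: (mulfI nS_neq0); rewrite -h mulrA mulrCA mulfV // mulr1 mulrC.
have hV cl ll cc lc : relV p q r P Q R cl ll cc lc ->
    cl = a * cc + b * lc /\ ll = c * cc + d * lc.
  rewrite /relV -/N11 -/N12 -/N21 -/N22 /a /b /c /d => -[h1 h2]; move: n12_neq0; rewrite -/N12.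
  move: N11 N12 N21 N22 h1 h2 {a b c d} => m11 m12 m21 m22 h1 h2 nz; split.
    apply: (eq_lc (eqD (eqZ (- (1 + m22) / (2 * m12)) h1) (eqZ (1 / 2) h2))).
    by field; rewrite nz two_neq0.
  apply: (eq_lc (eqD (eqZ (- (1 - m22) / (2 * m12)) h1) (eqZ (- (1 / 2)) h2))).
  by field; rewrite nz two_neq0.
have aE : a * (2 * N12) = (1 + N22) * (1 - N11) + N21 * N12.
  by rewrite /a; field; rewrite n12_neq0 two_neq0.
have bE : b * (2 * N12) = - ((1 + N22) * (1 + N11)) + N21 * N12.
  by rewrite /b; field; rewrite n12_neq0 two_neq0.
have cE : c * (2 * N12) = (1 - N22) * (1 - N11) - N21 * N12.
  by rewrite /c; field; rewrite n12_neq0 two_neq0.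
have dE : d * (2 * N12) = - ((1 - N22) * (1 + N11)) - N21 * N12.
  by rewrite /d; field; rewrite n12_neq0 two_neq0.
have sE : s = 0 -> nT p q r = 1.
  move/eqP; rewrite mulf_eq0 invr_eq0 (negbTE nT_neq0) orbF subr_eq0 => /eqP; exact: esym.
have kE : k = 0 -> nS P Q R = 1.
  move/eqP; rewrite mulf_eq0 invr_eq0 (negbTE nS_neq0) orbF subr_eq0 => /eqP; exact: esym.
case: (chart_cases (atriv_det char0 reg xE k hT hV) (asign_det char0 reg xE s hS hV)
  (atwo_entry char0 reg xE hT hS hV) (astd_minor char0 reg xE hT hS hV)
  (astds_minor char0 reg xE hT hS hV)).
  (* Translated back, this solution is the line of [not_regular_f]. *)
  move=> [a0 c0 d0 /sE T1 /kE S1]; exfalso.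
  rewrite a0 mul0r in aE; rewrite c0 mul0r in cE; rewrite d0 mul0r in dE.
  have h11 : N11 = 1 by apply/eqP; rewrite eq_sym -subr_eq0; apply/eqP/(@nat_mul0 _ char0 1);
    lc (eqZ (-1) (eqD aE cE)).
  have h21 : N21 = 0.
    have /mul0[//|h] : N21 * N12 = 0 by rewrite h11 in aE; lc (eqZ (-1) aE).
    by case/eqP: n12_neq0.
  have h22 : N22 = 1 by apply/eqP; rewrite -subr_eq0; apply/eqP/(@nat_mul0 _ char0 1);
    rewrite h11 h21 in dE; lc (eqZ (-1) dE).
  rewrite /N11 /n11 in h11; rewrite /N21 /n21 in h21; rewrite /N22 /n22 in h22.
  rewrite /nT in T1; rewrite /nS in S1.
  have rE : r = 1 / 2 by lcfA (eqZ (1 / 6) (eqD T1 (eqZ 2 h11))).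
  have RE : R = 1 / 2 by lcfA (eqZ (1 / 6) (eqD S1 (eqZ 2 h22))).
  subst r R.
  have qE : q = - p by lcfA (eqZ (1 / 2) T1).
  have PE : P = 0 by lcfA (eqZ (1 / 2) (eqD (eqZ (1 / 2) S1) (eqZ (-1) h21))).
  have QE : Q = 0 by rewrite PE in h21; lc (eqZ (-1) h21).
  subst q P Q; apply: (@not_regular_f x p reg).
  by rewrite xE; congr [:: _; _; _; _; _; _]; fldA.
(* Translated back, this solution is family (b) with [s = 1 - 2 * p]. *)
move=> [a0 d0 /sE T1 /kE S1 b0].
have n12E : N12 = 3 * (p - q) by [].
rewrite a0 mul0r in aE; rewrite d0 mul0r in dE.
have h22 : 1 + N22 = p - q.
  apply/eqP; rewrite -subr_eq0; apply/eqP/(@nat_mul0 _ char0 5).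
  rewrite n12E in aE bE.
  lc (eqD (eqZ (-3) aE) (eqD (eqZ 3 bE) (eqZ (-6 * (p - q)) b0))).
have h11 : N11 = N22.
  apply/eqP; rewrite -subr_eq0; apply/eqP/(@nat_mul0 _ char0 1).
  lc (eqD aE dE).
have h21 : 3 * N21 = p - q - 2.
  apply: (mulfI npq); rewrite h11 n12E in aE.
  have e : N22 = p - q - 1 by lc h22.
  rewrite e in aE; lc (eqZ (-1) aE).
have {}h11 : 1 + N11 = p - q by rewrite h11.
rewrite /N11 /n11 in h11; rewrite /N21 /n21 in h21; rewrite /N22 /n22 in h22.
rewrite /nT in T1; rewrite /nS in S1.
have qE : q = 1 - 2 * p by lcfA (eqZ (1 / 2) (eqD T1 (eqZ (-1) h11))).
subst q.
have rE : r = p - 1 / 2 by lcfA (eqZ (1 / 6) (eqD T1 (eqZ 2 h11))).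
have RE : R = p - 1 / 2 by lcfA (eqZ (1 / 6) (eqD S1 (eqZ 2 h22))).
subst r R.
have QE : Q = 0.
  by lcfA (eqZ (1 / 6) (eqD (eqZ (-1) h21) (eqD (eqZ (-1) S1) (eqZ 1 h22)))).
subst Q; have PE : P = 1 - p by lcfA (eqZ (- (1 / 3)) h21).
subst P; right; left; exists (1 - 2 * p); split; last first.
  by rewrite xE; congr [:: _; _; _; _; _; _]; fldA.
apply/negP => /eqP h; have {}h : p = 1 by lcfA (eqZ (- (1 / 2)) h).
subst p; apply: (@not_regular_f x 1 reg).
by rewrite xE; congr [:: _; _; _; _; _; _]; fldA.
Qed.

Theorem regular_in_families (x : 6.-tuple F) : regular_operad x -> in_families x.
Proof.
move=> reg; have {}reg : regular_at x 4 by apply: reg.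
have two_neq0 : (2 : F) != 0 by apply: (natF_neq0 char0 1).
have xE : x = [:: (x`_0 + x`_2) / 2 + (x`_0 - x`_2) / 2; (x`_1 + x`_3) / 2 + (x`_1 - x`_3) / 2;
    (x`_0 + x`_2) / 2 - (x`_0 - x`_2) / 2; (x`_1 + x`_3) / 2 - (x`_1 - x`_3) / 2;
    (x`_4 + x`_5) / 2 + (x`_4 - x`_5) / 2; (x`_4 + x`_5) / 2 - (x`_4 - x`_5) / 2] :> seq F.
  have h1 (u v : F) : (u + v) / 2 + (u - v) / 2 = u by fldA.
  have h2 (u v : F) : (u + v) / 2 - (u - v) / 2 = v by fldA.
  rewrite !h1 !h2; apply: (@eq_from_nth _ 0); rewrite ?size_tuple // => i.
  by case: i => [|[|[|[|[|[|i]]]]]].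
have [h|npq] := eqVneq ((x`_0 + x`_2) / 2 - (x`_1 + x`_3) / 2) 0; last exact: (caseA reg xE npq).
have {}h : (x`_1 + x`_3) / 2 = (x`_0 + x`_2) / 2 by apply/esym/eqP; rewrite -subr_eq0 h.
by rewrite h in xE; apply: (caseB char0 reg xE).
Qed.
End CaseA.

(** * Isomorphisms by substitution of the generator *)

Ltac perm_solve := apply/seq.permP => ?; rewrite !count_cat; lia.

Section Substitution.
Variable F : fieldType.
Variable T : eqType.
Implicit Types (u t A B C : tree T) (v w : tree T -> F) (s : fsum F T) (l : seq T).

(* The product of the free algebra, for elements given by their coefficient functions. *)
Definition mulf v w t : F := if t is Node t1 t2 then v t1 * w t2 else 0.
Definition delta u t : F := (u == t)%:R.

Lemma mulfN v w t1 t2 : mulf v w (Node t1 t2) = v t1 * w t2. Proof. by []. Qed.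
Lemma mulfL v w a : mulf v w (Leaf a) = 0. Proof. by []. Qed.

Lemma deltaN A B : delta (Node A B) =1 mulf (delta A) (delta B).
Proof.
case=> [a|t1 t2] //; rewrite mulfN /delta.
have -> : (Node A B == Node t1 t2) = (A == t1) && (B == t2) by [].
by case: eqP; case: eqP; rewrite /= ?mulr0 ?mulr1 ?mul0r.
Qed.

Lemma coef_lin s t : coef s t = lin (fun u => delta u t) s.
Proof.
by apply: eq_bigr => p _; rewrite /delta; case: eqP => _; rewrite ?mulr1 ?mulr0.
Qed.

Lemma coef_nil t : coef ([::] : fsum F T) t = 0.
Proof. by rewrite /coef big_nil. Qed.

Lemma coef_cons (p : F * tree T) s t : coef (p :: s) t = p.1 * delta p.2 t + coef s t.
Proof. by rewrite !coef_lin /lin big_cons. Qed.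

Lemma coef_cat s1 s2 t : coef (s1 ++ s2) t = coef s1 t + coef s2 t.
Proof. by rewrite !coef_lin lin_cat. Qed.

Lemma coef_scale a s t : coef (scale a s) t = a * coef s t.
Proof. by rewrite !coef_lin lin_scale. Qed.

Lemma lin_fmul (f : tree T -> F) s1 s2 : lin f (fmul s1 s2) =
  \sum_(p <- s1) \sum_(q <- s2) p.1 * q.1 * f (Node p.2 q.2).
Proof. by rewrite /lin /fmul big_allpairs_dep. Qed.

Lemma coef_fmul s1 s2 t : coef (fmul s1 s2) t = mulf (coef s1) (coef s2) t.
Proof.
rewrite coef_lin lin_fmul; case: t => [a|t1 t2].
  by rewrite mulfL big1 // => p _; rewrite big1 // => q _; rewrite /delta mulr0.
rewrite mulfN !coef_lin /lin big_distrlr /=; apply: eq_bigr => p _; apply: eq_bigr => q _.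
by rewrite deltaN mulfN; ring.
Qed.

(** * Coefficient functions of elements of the ideal *)

Section Ideal.
Variable y : 6.-tuple F.

(** Membership in [J_y] for coefficient functions, with the leaves prescribed by a word [l] in place
    of all of ['I_n]: the induction over contexts passes to subtrees, which contain only part of the
    letters. *)
Definition inJf l v : Prop :=
  exists g : seq (F * (ctx T * tree T * tree T * tree T)),
    all (fun q => perm_eq (leaves (plug q.2.1.1.1 (Node (Node q.2.1.1.2 q.2.1.2) q.2.2))) l) g /\
    forall t, v t =
      coef (flatten [seq scale q.1 (relgen y q.2.1.1.1 q.2.1.1.2 q.2.1.2 q.2.2) | q <- g]) t.

Lemma coef_gens (g : seq (F * (ctx T * tree T * tree T * tree T))) t :
  coef (flatten [seq scale q.1 (relgen y q.2.1.1.1 q.2.1.1.2 q.2.1.2 q.2.2) | q <- g]) t =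
  \sum_(q <- g) q.1 * coef (relgen y q.2.1.1.1 q.2.1.1.2 q.2.1.2 q.2.2) t.
Proof.
by rewrite coef_lin lin_flatten big_map; apply: eq_bigr => q _; rewrite lin_scale -coef_lin.
Qed.

Lemma inJf_ext l v w : v =1 w -> inJf l w -> inJf l v.
Proof. by move=> e [g [ga gE]]; exists g; split=> // t; rewrite e gE. Qed.

Lemma inJf_perm l l' v : perm_eq l l' -> inJf l v -> inJf l' v.
Proof.
move=> ll' [g [ga gE]]; exists g; split=> //.
by apply: sub_all ga => q qg; apply: perm_trans qg ll'.
Qed.

Lemma inJf0 l : inJf l (fun=> 0).
Proof. by exists [::]; split=> // t; rewrite coef_nil. Qed.

Lemma inJfD l v w : inJf l v -> inJf l w -> inJf l (fun t => v t + w t).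
Proof.
move=> [g [ga gE]] [h [ha hE]]; exists (g ++ h); rewrite all_cat ga ha; split=> // t.
by rewrite map_cat flatten_cat coef_cat gE hE.
Qed.

Lemma inJfZ l a v : inJf l v -> inJf l (fun t => a * v t).
Proof.
move=> [g [ga gE]]; exists [seq (a * q.1, q.2) | q <- g]; split; first by rewrite all_map.
by move=> t; rewrite gE !coef_gens big_map mulr_sumr; apply: eq_bigr => q _; rewrite mulrA.
Qed.

Lemma inJf_rel c A B C :
  inJf (leaves (plug c (Node (Node A B) C))) (coef (relgen y c A B C)).
Proof.
exists [:: (1, (c, A, B, C))]; split; first by rewrite /= perm_refl.
by move=> t; rewrite coef_gens big_seq1 mul1r.
Qed.

Lemma coef_mapl s u t : coef [seq (p.1, Node p.2 u) | p <- s] t = mulf (coef s) (delta u) t.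
Proof.
rewrite coef_lin /lin big_map; case: t => [a|t1 t2]; first by apply: big1 => p _; rewrite mulr0.
by rewrite mulfN coef_lin mulr_suml; apply: eq_bigr => p _; rewrite deltaN mulfN mulrA.
Qed.

Lemma coef_mapr s u t : coef [seq (p.1, Node u p.2) | p <- s] t = mulf (delta u) (coef s) t.
Proof.
rewrite coef_lin /lin big_map; case: t => [a|t1 t2]; first by apply: big1 => p _; rewrite mulr0.
by rewrite mulfN coef_lin mulr_sumr; apply: eq_bigr => p _; rewrite deltaN mulfN; ring.
Qed.

Lemma inJf_deltar l v u : inJf l v -> inJf (l ++ leaves u) (mulf v (delta u)).
Proof.
move=> [g [ga gE]].
exists [seq (q.1, (CL q.2.1.1.1 u, q.2.1.1.2, q.2.1.2, q.2.2)) | q <- g]; split.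
  by rewrite all_map; apply: sub_all ga => q /=; rewrite perm_cat2r.
move=> t; rewrite coef_gens big_map.
under eq_bigr => q _ do rewrite [coef _ _](coef_mapl (relgen y q.2.1.1.1 q.2.1.1.2 q.2.1.2 q.2.2)).
case: t => [a|t1 t2]; first by rewrite mulfL big1 // => q _; rewrite mulfL mulr0.
by rewrite mulfN gE coef_gens mulr_suml; apply: eq_bigr => q _; rewrite mulfN mulrA.
Qed.

Lemma inJf_deltal l v u : inJf l v -> inJf (leaves u ++ l) (mulf (delta u) v).
Proof.
move=> [g [ga gE]].
exists [seq (q.1, (CR u q.2.1.1.1, q.2.1.1.2, q.2.1.2, q.2.2)) | q <- g]; split.
  by rewrite all_map; apply: sub_all ga => q /=; rewrite perm_cat2l.
move=> t; rewrite coef_gens big_map.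
under eq_bigr => q _ do rewrite [coef _ _](coef_mapr (relgen y q.2.1.1.1 q.2.1.1.2 q.2.1.2 q.2.2)).
case: t => [a|t1 t2]; first by rewrite mulfL big1 // => q _; rewrite mulfL mulr0.
by rewrite mulfN gE coef_gens mulr_sumr; apply: eq_bigr => q _; rewrite mulfN mulrCA.
Qed.

Lemma inJf_mulr l l' v s : inJf l v -> all (fun p => perm_eq (leaves p.2) l') s ->
  inJf (l ++ l') (mulf v (coef s)).
Proof.
move=> vJ; elim: s => [|p s IH] /=.
  move=> _; apply: inJf_ext (inJf0 _).
  by case=> [a|t1 t2]; rewrite ?mulfL ?mulfN // coef_nil mulr0.
case/andP => pl /IH sJ; have pJ := inJf_perm _ (inJf_deltar p.2 vJ).
apply: inJf_ext (inJfD (inJfZ p.1 (pJ (l ++ l') _)) sJ); last by rewrite perm_cat2l.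
by case=> [a|t1 t2]; rewrite ?mulfL ?mulfN ?coef_cons; ring.
Qed.

Lemma inJf_mull l l' v s : inJf l v -> all (fun p => perm_eq (leaves p.2) l') s ->
  inJf (l' ++ l) (mulf (coef s) v).
Proof.
move=> vJ; elim: s => [|p s IH] /=.
  move=> _; apply: inJf_ext (inJf0 _).
  by case=> [a|t1 t2]; rewrite ?mulfL ?mulfN // coef_nil mul0r.
case/andP => pl /IH sJ; have pJ := inJf_perm _ (inJf_deltal p.2 vJ).
apply: inJf_ext (inJfD (inJfZ p.1 (pJ (l' ++ l) _)) sJ); last by rewrite perm_cat2r.
by case=> [a|t1 t2]; rewrite ?mulfL ?mulfN ?coef_cons; ring.
Qed.

(** The relation as a trilinear expression in arbitrary elements of the free algebra; substituted
    arguments are sums, not single trees. *)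
Definition relf (a b c : tree T -> F) t : F :=
  mulf (mulf a b) c t - y`_0 * mulf a (mulf b c) t - y`_1 * mulf a (mulf c b) t
  - y`_2 * mulf b (mulf a c) t - y`_3 * mulf b (mulf c a) t
  - y`_4 * mulf c (mulf a b) t - y`_5 * mulf c (mulf b a) t.

Ltac relf_lin H :=
  case=> [?|[?|? ?] [?|? ?]]; rewrite /relf ?(mulfN, mulfL) ?H; ring.

Lemma relf_lin1 k a a1 a2 b c : (forall t, a t = k * a1 t + a2 t) ->
  forall t, relf a b c t = k * relf a1 b c t + relf a2 b c t.
Proof. by move=> H; relf_lin H. Qed.

Lemma relf_lin2 k a b b1 b2 c : (forall t, b t = k * b1 t + b2 t) ->
  forall t, relf a b c t = k * relf a b1 c t + relf a b2 c t.
Proof. by move=> H; relf_lin H. Qed.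

Lemma relf_lin3 k a b c c1 c2 : (forall t, c t = k * c1 t + c2 t) ->
  forall t, relf a b c t = k * relf a b c1 t + relf a b c2 t.
Proof. by move=> H; relf_lin H. Qed.

Lemma relf0 a b c : (forall t, a t = 0) \/ (forall t, b t = 0) \/ (forall t, c t = 0) ->
  forall t, relf a b c t = 0.
Proof. by case=> [H|[H|H]]; relf_lin H. Qed.

Lemma relf_delta A B C : relf (delta A) (delta B) (delta C) =1 coef (relgen y (Hole _) A B C).
Proof.
move=> t; have dN X Y Z : delta (Node X (Node Y Z)) t = mulf (delta X) (mulf (delta Y) (delta Z)) t.
  by rewrite deltaN; case: t => // t1 t2; rewrite !mulfN deltaN.
rewrite /relgen /= !coef_cons coef_nil /= !dN /relf.
have -> : delta (Node (Node A B) C) t = mulf (mulf (delta A) (delta B)) (delta C) t.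
  by rewrite deltaN; case: t {dN} => // t1 t2; rewrite !mulfN deltaN.
ring.
Qed.

(** Trilinearity reduces the claim, one argument at a time, to single trees, where it is the
    defining relation at the root. *)
Lemma inJf_relf la lb lc sa sb sc :
  all (fun p => perm_eq (leaves p.2) la) sa -> all (fun p => perm_eq (leaves p.2) lb) sb ->
  all (fun p => perm_eq (leaves p.2) lc) sc ->
  inJf (la ++ lb ++ lc) (relf (coef sa) (coef sb) (coef sc)).
Proof.
move=> Ha Hb Hc; elim: sa Ha => [|p sa IHa] /=.
  by move=> _; apply: inJf_ext (inJf0 _) => t; apply: relf0; left=> u; rewrite coef_nil.
case/andP => pa /IHa Ja; apply: inJf_ext (relf_lin1 _ _ (coef_cons p sa)) _.
apply: inJfD Ja; apply: inJfZ => {IHa sa}; elim: sb Hb => [|q sb IHb] /=.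
  by move=> _; apply: inJf_ext (inJf0 _) => t; apply: relf0; right; left=> u; rewrite coef_nil.
case/andP => qb /IHb Jb; apply: inJf_ext (relf_lin2 _ _ (coef_cons q sb)) _.
apply: inJfD Jb; apply: inJfZ => {IHb sb}; elim: sc Hc => [|r sc IHc] /=.
  by move=> _; apply: inJf_ext (inJf0 _) => t; apply: relf0; right; right=> u; rewrite coef_nil.
case/andP => rc /IHc Jc; apply: inJf_ext (relf_lin3 _ _ (coef_cons r sc)) _.
apply: inJfD Jc; apply: inJfZ; apply: inJf_ext (relf_delta _ _ _) _.
apply: inJf_perm (inJf_rel _ _ _ _); rewrite /= -catA.
by rewrite perm_cat // perm_cat.
Qed.

End Ideal.

(** * The image of the ideal under a substitution of the generator *)

Section Image.
Variables al be : F.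

Definition Sf u t : F := coef (substT al be u) t.

Lemma SfN A B t : Sf (Node A B) t = al * mulf (Sf A) (Sf B) t + be * mulf (Sf B) (Sf A) t.
Proof. by rewrite /Sf /= coef_cat !coef_scale !coef_fmul. Qed.

Lemma coef_substS s t : coef (substS al be s) t = lin (fun u => Sf u t) s.
Proof.
elim: s => [|p s IH]; first by rewrite coef_nil /lin big_nil.
by rewrite /substS /= coef_cat coef_scale -/(substS al be s) IH /lin big_cons.
Qed.

Lemma leaves_substT t : all (fun p => perm_eq (leaves p.2) (leaves t)) (substT al be t).
Proof.
elim: t => [a|t1 IH1 t2 IH2] /=; first by rewrite perm_refl.
have scaleE a (s : fsum F T) l : all (fun p => perm_eq (leaves p.2) l) s ->
    all (fun p => perm_eq (leaves p.2) l) (scale a s) by rewrite all_map.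
have mulE (s1 s2 : fsum F T) l1 l2 : all (fun p => perm_eq (leaves p.2) l1) s1 ->
    all (fun p => perm_eq (leaves p.2) l2) s2 ->
    all (fun p => perm_eq (leaves p.2) (l1 ++ l2)) (fmul s1 s2).
  move=> /allP h1 /allP h2; apply/allP => _ /allpairsP[[p q] /= [/h1 hp /h2 hq ->]] /=.
  exact: perm_cat.
rewrite all_cat; apply/andP; split; apply: scaleE; first exact: mulE.
by apply: sub_all (mulE _ _ _ _ IH2 IH1) => p hp; rewrite (perm_trans hp) // perm_catC.
Qed.

Lemma lin_Sfl s u t : lin (fun t' => Sf (Node t' u) t) s =
  al * mulf (coef (substS al be s)) (Sf u) t + be * mulf (Sf u) (coef (substS al be s)) t.
Proof.
case: t => [a|t1 t2].
  by rewrite !mulfL !mulr0 addr0; apply: big1 => p _; rewrite SfN !mulfL; ring.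
rewrite !mulfN !coef_substS /lin mulr_suml !mulr_sumr -big_split; apply: eq_bigr => p _ /=.
by rewrite SfN !mulfN; ring.
Qed.

Lemma lin_Sfr s u t : lin (fun t' => Sf (Node u t') t) s =
  al * mulf (Sf u) (coef (substS al be s)) t + be * mulf (coef (substS al be s)) (Sf u) t.
Proof.
case: t => [a|t1 t2].
  by rewrite !mulfL !mulr0 addr0; apply: big1 => p _; rewrite SfN !mulfL; ring.
rewrite !mulfN !coef_substS /lin mulr_suml !mulr_sumr -big_split; apply: eq_bigr => p _ /=.
by rewrite SfN !mulfN; ring.
Qed.

(* The right combs of the substituted relation of O_x, reduced modulo O_y, cancel. *)
Definition compat (x y : 6.-tuple F) : Prop :=
  [/\ - x`_0 * y`_4 * al * be - x`_0 * y`_5 * be ^+ 2 - x`_1 * y`_4 * be ^+ 2 - x`_1 * y`_5 * al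
     * be - x`_2 * y`_1 * al * be - x`_2 * y`_3 * be ^+ 2 - x`_3 * y`_1 * be ^+ 2 - x`_3 * y`_3
     * al * be - x`_4 * y`_0 * al * be - x`_4 * y`_2 * be ^+ 2 - x`_5 * y`_0 * be ^+ 2 - x`_5 *
     y`_2 * al * be - x`_0 * al ^+ 2 - x`_1 * al * be + y`_0 * al ^+ 2 + y`_2 * al * be = 0,
     - x`_0 * y`_4 * be ^+ 2 - x`_0 * y`_5 * al * be - x`_1 * y`_4 * al * be - x`_1 * y`_5 * be
     ^+ 2 - x`_2 * y`_0 * al * be - x`_2 * y`_2 * be ^+ 2 - x`_3 * y`_0 * be ^+ 2 - x`_3 * y`_2
     * al * be - x`_4 * y`_1 * al * be - x`_4 * y`_3 * be ^+ 2 - x`_5 * y`_1 * be ^+ 2 - x`_5 *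
     y`_3 * al * be - x`_0 * al * be - x`_1 * al ^+ 2 + y`_1 * al ^+ 2 + y`_3 * al * be = 0,
     - x`_0 * y`_1 * al * be - x`_0 * y`_3 * be ^+ 2 - x`_1 * y`_1 * be ^+ 2 - x`_1 * y`_3 * al
     * be - x`_2 * y`_4 * al * be - x`_2 * y`_5 * be ^+ 2 - x`_3 * y`_4 * be ^+ 2 - x`_3 * y`_5
     * al * be - x`_4 * y`_0 * be ^+ 2 - x`_4 * y`_2 * al * be - x`_5 * y`_0 * al * be - x`_5 *
     y`_2 * be ^+ 2 - x`_2 * al ^+ 2 - x`_3 * al * be + y`_0 * al * be + y`_2 * al ^+ 2 = 0
   & [/\ - x`_0 * y`_0 * al * be - x`_0 * y`_2 * be ^+ 2 - x`_1 * y`_0 * be ^+ 2 - x`_1 * y`_2 * al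
     * be - x`_2 * y`_4 * be ^+ 2 - x`_2 * y`_5 * al * be - x`_3 * y`_4 * al * be - x`_3 * y`_5
     * be ^+ 2 - x`_4 * y`_1 * be ^+ 2 - x`_4 * y`_3 * al * be - x`_5 * y`_1 * al * be - x`_5 *
     y`_3 * be ^+ 2 - x`_2 * al * be - x`_3 * al ^+ 2 + y`_1 * al * be + y`_3 * al ^+ 2 = 0,
     - x`_0 * y`_1 * be ^+ 2 - x`_0 * y`_3 * al * be - x`_1 * y`_1 * al * be - x`_1 * y`_3 * be
     ^+ 2 - x`_2 * y`_0 * be ^+ 2 - x`_2 * y`_2 * al * be - x`_3 * y`_0 * al * be - x`_3 * y`_2
     * be ^+ 2 - x`_4 * y`_4 * al * be - x`_4 * y`_5 * be ^+ 2 - x`_5 * y`_4 * be ^+ 2 - x`_5 *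
     y`_5 * al * be - x`_4 * al ^+ 2 - x`_5 * al * be + y`_4 * al ^+ 2 + y`_5 * al * be + al *
     be = 0
   & - x`_0 * y`_0 * be ^+ 2 - x`_0 * y`_2 * al * be - x`_1 * y`_0 * al * be - x`_1 * y`_2 * be
     ^+ 2 - x`_2 * y`_1 * be ^+ 2 - x`_2 * y`_3 * al * be - x`_3 * y`_1 * al * be - x`_3 * y`_3
     * be ^+ 2 - x`_4 * y`_4 * be ^+ 2 - x`_4 * y`_5 * al * be - x`_5 * y`_4 * al * be - x`_5 *
     y`_5 * be ^+ 2 - x`_4 * al * be - x`_5 * al ^+ 2 + y`_4 * al * be + y`_5 * al ^+ 2 + be ^+
     2 = 0]].

(** Induction on the context. At the root [compat] applies; a product with a further factor becomes
    the two products in both orders, each of which stays in the ideal. *)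
Lemma inJf_subst_rel (x y : 6.-tuple F) c A B C : compat x y ->
  inJf y (leaves (plug c (Node (Node A B) C))) (coef (substS al be (relgen x c A B C))).
Proof.
move=> [h0 h1 h2 [h3 h4 h5]]; elim: c => [|c IH u|u c IH].
- have R X Y Z : perm_eq (leaves X ++ leaves Y ++ leaves Z) (leaves A ++ leaves B ++ leaves C) ->
      inJf y (leaves A ++ leaves B ++ leaves C) (relf y (Sf X) (Sf Y) (Sf Z)).
    by move=> p; apply: inJf_perm p (inJf_relf _ _ _ _); apply: leaves_substT.
  rewrite /= -catA.
  (* The multipliers are the coefficients of the six left combs in the substituted relation. After
     subtracting these relations of [O_y] only right combs remain, and their coefficients vanish by
     [compat]. *)
  apply: (@inJf_ext _ _ _ (fun t =>
    (al ^+ 2 - x`_4 * (al * be) - x`_5 * be ^+ 2) * relf y (Sf A) (Sf B) (Sf C) t +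
    ((al * be - x`_4 * be ^+ 2 - x`_5 * (al * be)) * relf y (Sf B) (Sf A) (Sf C) t +
    (- (x`_0 * (al * be) + x`_1 * be ^+ 2) * relf y (Sf B) (Sf C) (Sf A) t +
    (- (x`_0 * be ^+ 2 + x`_1 * (al * be)) * relf y (Sf C) (Sf B) (Sf A) t +
    (- (x`_2 * (al * be) + x`_3 * be ^+ 2) * relf y (Sf A) (Sf C) (Sf B) t +
    - (x`_2 * be ^+ 2 + x`_3 * (al * be)) * relf y (Sf C) (Sf A) (Sf B) t)))))).
    move=> t; rewrite coef_substS /lin /relgen /= !big_cons big_nil /= /relf.
    case: t => [a|l r]; rewrite !SfN ?mulfL; first by ring.
    rewrite !mulfN !SfN.
    lc (eqD (eqZ (Sf A l * mulf (Sf B) (Sf C) r) h0)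
    (eqD (eqZ (Sf A l * mulf (Sf C) (Sf B) r) h1)
    (eqD (eqZ (Sf B l * mulf (Sf A) (Sf C) r) h2)
    (eqD (eqZ (Sf B l * mulf (Sf C) (Sf A) r) h3)
    (eqD (eqZ (Sf C l * mulf (Sf A) (Sf B) r) h4)
    (eqZ (Sf C l * mulf (Sf B) (Sf A) r) h5)))))).
  do 5 (apply: inJfD; first by apply: inJfZ; apply: R;
    perm_solve).
  by apply: inJfZ; apply: R; perm_solve.
- have -> : relgen x (CL c u) A B C = [seq (p.1, Node p.2 u) | p <- relgen x c A B C] by [].
  apply: (@inJf_ext _ _ _ (fun t => al * mulf (coef (substS al be (relgen x c A B C))) (Sf u) t +
      be * mulf (Sf u) (coef (substS al be (relgen x c A B C))) t)).
    by move=> t; rewrite coef_substS -lin_Sfl /lin big_map.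
  apply: inJfD; apply: inJfZ; first exact: inJf_mulr IH (leaves_substT u).
  by apply: inJf_perm (inJf_mull IH (leaves_substT u)); rewrite /= perm_catC.
have -> : relgen x (CR u c) A B C = [seq (p.1, Node u p.2) | p <- relgen x c A B C] by [].
apply: (@inJf_ext _ _ _ (fun t => al * mulf (Sf u) (coef (substS al be (relgen x c A B C))) t +
    be * mulf (coef (substS al be (relgen x c A B C))) (Sf u) t)).
  by move=> t; rewrite coef_substS -lin_Sfr /lin big_map.
apply: inJfD; apply: inJfZ; first exact: inJf_mull IH (leaves_substT u).
by apply: inJf_perm (inJf_mulr IH (leaves_substT u)); rewrite /= perm_catC.
Qed.

End Image.

(** The equations are homogeneous of degree two in [al] and [be]. *)
Lemma compatZ (k al be : F) (x y : 6.-tuple F) : compat al be x y -> compat (k * al) (k * be) x y.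
Proof.
move=> [h0 h1 h2 [h3 h4 h5]].
by split; [lc (eqZ (k ^+ 2) h0) | lc (eqZ (k ^+ 2) h1) | lc (eqZ (k ^+ 2) h2) | split;
  [lc (eqZ (k ^+ 2) h3) | lc (eqZ (k ^+ 2) h4) | lc (eqZ (k ^+ 2) h5)]].
Qed.

(** Substitutions compose like the elements [al + be * tau] of the group algebra of [S_2], [tau]
    being the swap; the hypotheses say that the two elements are inverse to each other. *)
Lemma substS_inv (al be al' be' : F) : al * al' + be * be' = 1 -> al * be' + be * al' = 0 ->
  forall s, coef (substS al' be' (substS al be s)) =1 coef s.
Proof.
move=> e1 e2.
have fmulE s1 s2 t : coef (substS al' be' (fmul s1 s2)) t =
    al' * mulf (coef (substS al' be' s1)) (coef (substS al' be' s2)) t +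
    be' * mulf (coef (substS al' be' s2)) (coef (substS al' be' s1)) t.
  rewrite coef_substS lin_fmul; case: t => [a|t1 t2].
    rewrite !mulfL big1 => [|p _]; first ring.
    by apply: big1 => q _; rewrite SfN !mulfL; ring.
  rewrite !mulfN !coef_substS /lin [X in be' * X]mulrC !big_distrlr /= !mulr_sumr -big_split.
  apply: eq_bigr => p _; rewrite [X in _ = X + _]mulr_sumr [X in _ = _ + X]mulr_sumr -big_split.
  apply: eq_bigr => q _ /=; by rewrite SfN !mulfN; ring.
have treeE t : coef (substS al' be' (substT al be t)) =1 delta t.
  elim: t => [a|t1 IH1 t2 IH2] t; first by rewrite coef_substS /lin big_seq1 mul1r /Sf /=
    coef_cons coef_nil mul1r addr0.
  rewrite coef_substS /= lin_cat !lin_scale -!coef_substS !fmulE deltaN.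
  case: t => [a|u1 u2]; first by rewrite !mulfL; ring.
  rewrite !mulfN !IH1 !IH2.
  lc (eqD (eqZ (delta t1 u1 * delta t2 u2) e1) (eqZ (delta t2 u1 * delta t1 u2) e2)).
move=> s t; rewrite coef_substS coef_lin.
elim: s => [|p s IH]; first by rewrite /lin !big_nil.
rewrite [substS _ _ _]/= lin_cat lin_scale -/(substS al be s) IH -coef_substS treeE.
by rewrite /lin big_cons.
Qed.
End Substitution.

Lemma inJ_subst (F : fieldType) (al be : F) (x y : 6.-tuple F) n (s : fsum F 'I_n) :
  compat al be x y -> inJ x s -> inJ y (substS al be s).
Proof.
move=> xy [g [gm gE]]; change (inJf y (enum 'I_n) (coef (substS al be s))).
apply: (@inJf_ext _ _ _ _ _ (fun t => \sum_(q <- g) q.1 *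
    coef (substS al be (relgen x q.2.1.1.1 q.2.1.1.2 q.2.1.2 q.2.2)) t)) => [t|].
  rewrite coef_substS (eq_coef_lin _ gE) lin_flatten big_map.
  by apply: eq_bigr => q _; rewrite lin_scale coef_substS.
elim: g gm {gE} => [|q g IH] /=.
  by move=> _; apply: inJf_ext (inJf0 _ _) => t; rewrite big_nil.
case/andP => mq /IH gJ; apply: inJf_ext (inJfD (inJfZ q.1 _) gJ) => [t|]; first by rewrite big_cons.
exact: inJf_perm mq (inJf_subst_rel _ _ _ _ xy).
Qed.

(** The inverse of [al + be * tau] is [al - be * tau] divided by [al ^+ 2 - be ^+ 2]; homogeneity
    allows the second compatibility to be stated without this denominator. *)
Lemma iso_of_compat (F : fieldType) (al be : F) (x y : 6.-tuple F) :
  al ^+ 2 - be ^+ 2 != 0 -> compat al be x y -> compat al (- be) y x -> operad_iso x y.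
Proof.
move=> nz xy yx; pose k := (al ^+ 2 - be ^+ 2)^-1.
have kE : k * (al ^+ 2 - be ^+ 2) = 1 by rewrite mulVf.
have {}yx := compatZ k yx.
exists al, be => n _; split=> [s _|s _|t mt]; first exact: inJ_subst.
  move=> /(inJ_subst yx) [g [gm gE]]; exists g; split=> // t; rewrite -gE.
  by rewrite (@substS_inv _ _ al be) //; [lc kE | ring].
exists (substT (k * al) (k * - be) t); split.
  by apply: sub_all (leaves_substT _ _ t) => p /perm_trans; apply.
exists [::]; split=> // u; rewrite coef_cat coef_nil.
have -> : substT (k * al) (k * - be) t = substS (k * al) (k * - be) [:: (1, t)].
  rewrite /substS /= cats0 /scale -[LHS]map_id; apply: eq_map => -[c v] /=; by rewrite mul1r.
rewrite (@substS_inv _ _ (k * al) (k * - be)); [|by lc kE|by ring].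
by rewrite !coef_cons coef_nil /=; ring.
Qed.

(** * Explicit isomorphisms for the four families *)

Section Classification.
Variable F : closedFieldType.
Hypothesis char0 : [pchar F] =i pred0.

(** Each equation of [compat] is the listed multiple of the single equation [hc] satisfied by the
    parameters. *)
Ltac compat_conic xE hc q0 q1 q2 q3 q4 q5 := rewrite /compat xE /=; split;
  [lc (eqZ q0 hc) | lc (eqZ q1 hc) | lc (eqZ q2 hc) | split;
    [lc (eqZ q3 hc) | lc (eqZ q4 hc) | lc (eqZ q5 hc)]].

(* On the conic, be / al = (u - 1) / (v - u) is the substitution parameter; the
   two excluded points are those where al^2 = be^2. *)
Lemma conic_det (u v : F) : on_conic u v -> (v - u) ^+ 2 - (u - 1) ^+ 2 != 0.
Proof.
move=> [hc [n1 n2]]; apply/negP => /eqP.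
have -> : (v - u) ^+ 2 - (u - 1) ^+ 2 = (v - 1) * (v - 2 * u + 1) by ring.
case/mul0 => h.
  have {}h : v = 1 by lc h.
  subst v; have : (u - 1) ^+ 2 = 0 by lc (eqZ (-1) hc).
  by move/eqP; rewrite expf_eq0 subr_eq0 => /andP[_ /eqP u1]; subst u.
have {}h : v = 2 * u - 1 by lc h.
subst v; have : (u - 1) * (3 * u - 1) = 0 by lc hc.
case/mul0 => h; first by apply: n1; have -> : u = 1 by [lc h]; congr (_, _); ring.
apply: n2; have -> : u = 3^-1.
  by apply: (mulfI (natF_neq0 char0 2)); rewrite mulfV ?(natF_neq0 char0) //; lc h.
by congr (_, _); field; apply: (natF_neq0 char0 2).
Qed.

Theorem families_iso (x : 6.-tuple F) : in_families x ->
  exists y : 6.-tuple F,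
    ((y : seq F) = [:: 0; 0; 0; 0; 0; 0] \/
     (y : seq F) = [:: 1; 0; 0; 0; 0; 0] \/
     (y : seq F) = [:: 1; 0; -1; 0; 0; 0] \/
     (y : seq F) = [:: 1; 1; 0; 0; 0; 0] \/
     (y : seq F) = [:: 1; 3^-1; - 3^-1; 3^-1; - 3^-1; 0])
    /\ operad_iso x y.
Proof.
case=> [[s [n1 n2 xE]]|[[s [n1 xE]]|[[u [v [hc xE]]]|[u [v [hc xE]]]]]].
- exists [tuple 0; 0; 0; 0; 0; 0]; split; first by left.
  (* Replacing [ab] by [ab + s * ba] turns [(ab)c = s * c(ab)] into consequences of left nilpotency;
     [1 - s ^+ 2] is invertible exactly because [s] is not 1 or -1. *)
  apply: (@iso_of_compat _ 1 s).
  + have -> : 1 ^+ 2 - s ^+ 2 = - ((s - 1) * (s + 1)) by ring.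
    by rewrite oppr_eq0 mulf_neq0 // ?subr_eq0 // -[1]opprK subr_eq0.
  + by rewrite /compat xE /=; split; [ring | ring | ring | split; ring].
  by rewrite /compat xE /=; split; [ring | ring | ring | split; ring].
- have [s3|ns] := eqVneq s 3^-1.
    exists [tuple 1; 3^-1; - 3^-1; 3^-1; - 3^-1; 0]; split; first by do 4 right.
    rewrite s3 in xE; apply: (@iso_of_compat _ 1 0).
    + by rewrite expr1n expr0n subr0 oner_eq0.
    + by rewrite /compat xE /=; split; [ring | ring | ring | split; ring].
    by rewrite /compat xE /=; split; [ring | ring | ring | split; ring].
  have nd : 1 - 3 * s != 0.
    apply: contra_neq ns => h; apply: (mulfI (natF_neq0 char0 2)).
    by rewrite mulfV ?(natF_neq0 char0) //; lc (eqZ (-1) h).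
  (* Algebraic closure supplies a square root of [(1 + s) / (1 - 3 * s)]. The denominator vanishes
     at the Poisson value [s = 1/3], and the root is nonzero since [s != -1]. *)
  have [t tE] := @solve_monicpoly F 2 (nth 0 [:: (1 + s) / (1 - 3 * s)]) isT.
  have {}tE : t ^+ 2 * (1 - 3 * s) - (1 + s) = 0.
    rewrite tE !big_ord_recl big_ord0 /= mul0r !addr0 expr0 mulr1 divfK //; ring.
  have nt : t != 0.
    apply/negP => /eqP t0; case/eqP: n1; rewrite t0 in tE; lc (eqZ (-1) tE).
  exists [tuple 1; 0; 0; 0; 0; 0]; split; first by right; left.
  (* The generator goes to [(ab + ba) + t * (ab - ba)], which rescales the commutator of the
     associative product against its anticommutator. *)
  apply: (@iso_of_compat _ (1 + t) (1 - t)).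
  + have -> : (1 + t) ^+ 2 - (1 - t) ^+ 2 = 4 * t by ring.
    by rewrite mulf_neq0 // (natF_neq0 char0).
  + compat_conic xE tE (0 : F) (1 : F) (-1 : F) (1 : F) (-1 : F) (0 : F).
  compat_conic xE tE (0 : F) (-1 : F) (1 : F) (-1 : F) (1 : F) (0 : F).
- exists [tuple 1; 1; 0; 0; 0; 0]; split; first by do 3 right; left.
  apply: (@iso_of_compat _ (v - u) (u - 1)); first exact: conic_det.
    by case: hc => hc _; compat_conic xE hc (u - 1) (u - 1) (- u + v) (- u + v) (- u + v) (u - 1).
  by case: hc => hc _; compat_conic xE hc (u - 1) (u - 1) (u - v) (u - v) (u - v) (u - 1).
exists [tuple 1; 0; -1; 0; 0; 0]; split; first by do 2 right; left.
apply: (@iso_of_compat _ (v - u) (u - 1)); first exact: conic_det.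
  by case: hc => hc _; compat_conic xE hc (- u + 1) (u - v) (u - 1) (- u + v) (- u + v) (u - 1).
by case: hc => hc _; compat_conic xE hc (- u + 1) (- u + v) (u - 1) (u - v) (u - v) (u - 1).
Qed.
End Classification.

Theorem mainTheorem1 :
  (forall (F : fieldType), [pchar F] =i pred0 ->
   forall x : 6.-tuple F, regular_operad x ->
     (exists s : F, [/\ s != 1, s != -1 & (x : seq F) = [:: 0; 0; 0; 0; s; 0]]) \/
     (exists s : F, s != -1 /\ (x : seq F) = [:: 1; s; - s; s; - s; 0]) \/
     (exists u v : F, on_conic u v /\ (x : seq F) = [:: u; u; - v; - v; - v; u - 1]) \/
     (exists u v : F, on_conic u v /\ (x : seq F) = [:: u; v; - u; - v; - v; 1 - u]))
  /\
  (forall (F : closedFieldType), [pchar F] =i pred0 ->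
   forall x : 6.-tuple F, regular_operad x ->
     exists y : 6.-tuple F,
       ((y : seq F) = [:: 0; 0; 0; 0; 0; 0] \/
        (y : seq F) = [:: 1; 0; 0; 0; 0; 0] \/
        (y : seq F) = [:: 1; 0; -1; 0; 0; 0] \/
        (y : seq F) = [:: 1; 1; 0; 0; 0; 0] \/
        (y : seq F) = [:: 1; 3^-1; - 3^-1; 3^-1; - 3^-1; 0])
       /\ operad_iso x y).
Proof.
split=> F char0 x reg; first exact: (regular_in_families char0 reg).
exact: (families_iso char0 (regular_in_families char0 reg)).
Qed.
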